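(* There exist numerical constants $c_0,c_1,c_2,c_3>0$ such that the following holds. Suppose that (i) $\mathcal{G}$ is a closed subgroup of $\mathcal{O}(d)$ for which there are constants $\alpha\ge1$ and $\beta\in(0,1]$ such that for all $X\in\mathrm{conv}(\mathcal{G})$, $\mathrm{dist}(X,\mathcal{G})\le\alpha\,\mathrm{Tr}(I_d-X^\top\Pi(X))$ and $\beta\,\mathrm{Tr}(I_d-X^\top\Pi(X))\le d-\|X\|_F^2$; (ii) the measurement graph is an Erdős–Rényi random graph on $[n]$ with observation rate $p\in(0,1]$; (iii) the noise matrices $\{\Theta_{ij}:1\le i<j\le n\}\subset\mathbb{R}^{d\times d}$ are independent of each other and of the measurement graph, and their entries are i.i.d. sub-Gaussian random variables with parameter $\sigma>0$. If $p\ge c_0\max\left\{\frac{\alpha^2d}{\beta^2n},\frac{(\log n)^2}{n}\right\}$ and $\sigma\le\frac{c_1\beta\sqrt{pn}}{\alpha d}$, then the entropic spectral estimator $\widehat G$ with $\epsilon\le\frac{c_2\sqrt\beta}{\alpha}$ satisfies $$\Pr\left(\varepsilon(\widehat G)\le\frac{\sqrt n}{2\alpha}\right)\ge1-\frac{c_3}{n}.$$ If the sub-Gaussian entries of the $\Theta_{ij}$ are zero-mean Gaussian with standard deviation $\sigma>0$, then the same inequality $\Pr\left(\varepsilon(\widehat G)\le\frac{\sqrt n}{2\alpha}\right)\ge1-\frac{c_3}{n}$ holds under the weaker requirement $p\ge c_0\max\left\{\frac{\alpha^2d}{\beta^2n},\frac{\log n}{n}\right\}$ (in place of the requirement $p\ge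 c_0\max\left\{\frac{\alpha^2d}{\beta^2n},\frac{(\log n)^2}{n}\right\}$).
   Context: $\mathcal{O}(d)$ is the group of $d\times d$ real orthogonal matrices; $\|\cdot\|$, $\|\cdot\|_F$ are the operator and Frobenius norms; $\mathrm{conv}$ is the Euclidean convex hull in $\mathbb{R}^{d\times d}$; $\mathrm{dist}(X,\mathcal{G})=\min_{Q\in\mathcal{G}}\|X-Q\|_F$. $\mathcal{G}^n\subset\mathbb{R}^{nd\times d}$ is the set of $G$ whose $n$ consecutive $d\times d$ blocks $[G]_i$ lie in $\mathcal{G}$; $G^*\in\mathcal{G}^n$ is the ground truth, $G^*_i=[G^*]_i$. $\Pi(X)\in\operatorname{argmin}_{Q\in\mathcal{G}}\|X-Q\|_F$ for $X\in\mathbb{R}^{d\times d}$ (any choice of minimizer), and $[\Pi^n(Y)]_i=\Pi([Y]_i)$ for $Y\in\mathbb{R}^{nd\times d}$. Estimation error: $\varepsilon(G)=\min_{Q\in\mathcal{G}}\|G-G^*Q\|_F$. A random variable $\xi$ is sub-Gaussian with parameter $\sigma>0$ if $\mathbb{E}[\exp(\lambda\xi)]\le\exp(\lambda^2\sigma^2/2)$ for all $\lambda\in\mathbb{R}$. Erdős–Rényi with observation rate $p$: the edge indicators $\{w_{ij}:1\le i<j\le n\}$ are i.i.d. Bernoulli($p$); $E$ is the set of edges $(i,j)$, $i<j$, with $w_{ij}=1$. Observations follow the additive noise model $C_{ij}=G_i^*{G_j^*}^\top+\Theta_{ij}$, $(i,j)\in E$. The symmetric matrix $C\in\mathbb{R}^{nd\times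 nd}$ has blocks $[C]_{ij}=C_{ij}$ if $(i,j)\in E$, $C_{ji}^\top$ if $(j,i)\in E$, $I_d$ if $i=j$, $\mathbf0$ otherwise. $V_C\in\mathbb{R}^{nd\times d}$ is a matrix whose columns are orthonormal eigenvectors of $C$ associated with its $d$ largest eigenvalues. $Q^*\in\mathcal{O}(d)$ denotes an orthogonal matrix with $\|V_CQ^*-\frac1{\sqrt n}G^*\|_F\le\frac{2\sqrt{2d}\,\|C-\eta\cdot G^*{G^*}^\top\|}{\eta n}$, where $\eta=p$ (such a $Q^*$ exists by a variant of the Davis–Kahan theorem). $\mathcal{O}(d)/\mathcal{G}$ is the set of left cosets $[Q]=\{QQ':Q'\in\mathcal{G}\}$, with $\mathrm{dist}([Q_1],[Q_2])=\min_{Q'\in\mathcal{G}}\|Q_1-Q_2Q'\|_F$. Entropic spectral estimator with parameter $\epsilon\ge0$: the input is $C$ and a finite set $\mathcal{Q}\subseteq\mathcal{O}(d)/\mathcal{G}$ satisfying $\min_{[Q]\in\mathcal{Q}}\mathrm{dist}([Q],[Q^*])\le\epsilon$. Let $[\widehat Q]$ be a maximizer over $[Q]\in\mathcal{Q}$ of $\psi([Q])=\langle C\,\Pi^n(V_CQ),\Pi^n(V_CQ)\rangle$, where $\langle X,Y\rangle=\mathrm{Tr}(X^\top Y)$ (since $\Pi^n(V_CQQ')=\Pi^n(V_CQ)Q'$ for $Q'\in\mathcal{G}$, $\psi$ does not depend on the representative; where projections are not unique a fixed choice compatible with this is made). The output is $\widehat G=\Pi^n(V_C\widehat Q)$. 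*)

(* Defs.v *)
From HB Require Import structures.
From mathcomp Require Import all_boot all_order all_algebra.
From mathcomp Require Import all_classical all_reals all_analysis.
Import Order.TTheory GRing.Theory Num.Theory.
Import numFieldNormedType.Exports.

Set Implicit Arguments.
Unset Strict Implicit.
Unset Printing Implicit Defensive.

Local Open Scope classical_set_scope.
Local Open Scope ring_scope.

Section Matrices.
Context (R : realType).

Definition inner m n (X Y : 'M[R]_(m, n)) : R := \tr (X^T *m Y).

Definition frob m n (X : 'M[R]_(m, n)) : R := Num.sqrt (inner X X).

(* [frob] of a column vector is its Euclidean norm. *)
Definition opnorm m n (A : 'M[R]_(m, n)) : R :=
  sup [set frob (A *m x) | x in [set x : 'cV[R]_n | frob x <= 1]].

Definition Orth d : set 'M[R]_d := [set Q | Q^T *m Q = 1%:M].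

Definition closed_subgroup_Orth d (G : set 'M[R]_d) : Prop :=
  [/\ G `<=` @Orth d,
      closed G,
      G 1%:M,
      forall Q Q', G Q -> G Q' -> G (Q *m Q')
    & forall Q, G Q -> G (invmx Q)].

Definition conv d (A : set 'M[R]_d) : set 'M[R]_d :=
  smallest (fun M => @convex_set R 'M[R]_d M) A.

(* The minima over G in [dist], [coset_dist] and [est_err] are written as
   infima; they are attained, G being nonempty and compact. *)
Definition dist d (G : set 'M[R]_d) (X : 'M[R]_d) : R :=
  inf [set frob (X - Q) | Q in G].

Definition is_proj d (G : set 'M[R]_d) (X Q : 'M[R]_d) : Prop :=
  G Q /\ forall Q', G Q' -> frob (X - Q) <= frob (X - Q').

Definition left_coset d (G : set 'M[R]_d) (Q : 'M[R]_d) : set 'M[R]_d :=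
  [set Q *m Q' | Q' in G].

Definition coset_dist d (G : set 'M[R]_d) (Q1 Q2 : 'M[R]_d) : R :=
  inf [set frob (Q1 - Q2 *m Q') | Q' in G].

Definition error_bound_conv d (G : set 'M[R]_d) (Pi : 'M[R]_d -> 'M[R]_d)
    (alpha beta : R) : Prop :=
  forall X, conv G X ->
    dist G X <= alpha * \tr (1%:M - X^T *m Pi X) /\
    beta * \tr (1%:M - X^T *m Pi X) <= d%:R - frob X ^+ 2.

(* V has orthonormal columns, its columns are eigenvectors of A, and the
   associated eigenvalues are, up to order, the first d terms of the decreasing
   list of all the eigenvalues of A counted with multiplicity. *)
Definition top_eigvecs N d (A : 'M[R]_N) (V : 'M[R]_(N, d)) : Prop :=
  V^T *m V = 1%:M /\
  exists (s : seq R) (lam : 'I_d -> R),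
    [/\ sorted (fun x y => y <= x) s,
        char_poly A = \prod_(a <- s) ('X - a%:P),
        perm_eq [seq lam k | k <- enum 'I_d] (take d s)
      & forall k, A *m col k V = lam k *: col k V].

End Matrices.

Notation blockcol R n d := ('M[R]_(\sum_(i < n) d, d)).
Notation blocksq R n d := ('M[R]_(\sum_(i < n) d)).
Notation block Y i := (@submxcol _ _ (fun=> _) _ Y i).

Section Synchronization.
Context (R : realType) (n d : nat).
Implicit Types (G : set 'M[R]_d) (Gstar Y Z : blockcol R n d).

Definition in_Gn G Y : Prop := forall i : 'I_n, G (block Y i).

Definition est_err G Gstar Y : R := inf [set frob (Y - Gstar *m Q) | Q in G].

Definition is_projn G Y Z : Prop :=
  forall i : 'I_n, is_proj G (block Y i) (block Z i).

(* Only the entries [w i j] and [Theta i j] with i < j are used. *)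
Definition obs_block Gstar (w : 'I_n -> 'I_n -> bool)
    (Theta : 'I_n -> 'I_n -> 'M[R]_d) (i j : 'I_n) : 'M[R]_d :=
  let Cij k l := block Gstar k *m (block Gstar l)^T + Theta k l in
  if i == j then 1%:M
  else if (i < j)%N then (if w i j then Cij i j else 0)
  else (if w j i then (Cij j i)^T else 0).

Definition obs_mx Gstar (w : 'I_n -> 'I_n -> bool)
    (Theta : 'I_n -> 'I_n -> 'M[R]_d) : blocksq R n d :=
  \mxblock_(i < n, j < n) obs_block Gstar w Theta i j.

Definition is_Qstar (eta : R) Gstar (C : blocksq R n d)
    (V : blockcol R n d) (Q : 'M[R]_d) : Prop :=
  @Orth R d Q /\
  frob (V *m Q - (Num.sqrt n%:R)^-1 *: Gstar)
    <= 2 * Num.sqrt (2 * d%:R) * opnorm (C - eta *: (Gstar *m Gstar^T))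
       / (eta * n%:R).

(* A finite set of left cosets of G in O(d), one of which is within eps of the
   coset of Qstar. *)
Definition admissible_cosets G (eps : R) (Qstar : 'M[R]_d)
    (QQ : set (set 'M[R]_d)) : Prop :=
  [/\ finite_set QQ,
      QQ `<=` [set left_coset G Q | Q in @Orth R d]
    & exists Q, [/\ @Orth R d Q, QQ (left_coset G Q)
                  & coset_dist G Q Qstar <= eps]].

(* A choice of the projections of the V Q, for Q in O(d), that is compatible
   with right multiplication by G. The choice is made on the products V Q, as a
   function of Q: no map Pi on all matrices can satisfy
   Pi (X *m Q') = Pi X *m Q' for all Q' in G at a singular X such as 0. *)
Definition compatible_projn G (V : blockcol R n d)
    (PV : 'M[R]_d -> blockcol R n d) : Prop :=
  (forall Q, @Orth R d Q -> is_projn G (V *m Q) (PV Q)) /\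
  (forall Q Q', @Orth R d Q -> G Q' -> PV (Q *m Q') = PV Q *m Q').

(* [Ghat] is an output of the entropic spectral estimator. *)
Definition entropic_spectral_output G (C : blocksq R n d)
    (V : blockcol R n d) (QQ : set (set 'M[R]_d)) (Ghat : blockcol R n d)
    : Prop :=
  exists (PV : 'M[R]_d -> blockcol R n d) (Qhat : 'M[R]_d),
    let psi Q := inner (C *m PV Q) (PV Q) in
    [/\ compatible_projn G V PV,
        @Orth R d Qhat /\ QQ (left_coset G Qhat),
        forall Q, @Orth R d Q -> QQ (left_coset G Q) -> psi Q <= psi Qhat
      & Ghat = PV Qhat].

End Synchronization.

Section Probability.
Context (R : realType) (dsp : measure_display) (T : measurableType dsp)
  (P : probability T R).

(* Mutual independence of the families of events F i, i in D. *)
Definition mutually_independent (I : finType) (D : {set I})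
    (F : I -> set (set T)) : Prop :=
  forall (S : {set I}) (A : I -> set T),
    S \subset D -> (forall i, i \in S -> F i (A i)) ->
    P (\bigcap_(i in [set` S]) A i) = (\prod_(i in S) P (A i))%E.

Definition sigma_RV d' (T' : measurableType d') (X : {RV P >-> T'})
    : set (set T) := preimage_set_system setT X measurable.

Definition sub_gaussian (X : {RV P >-> measurableTypeR R}) (sigma : R) : Prop :=
  forall t : R, ('M_P X t <= (expR (t ^+ 2 * sigma ^+ 2 / 2))%:E)%E.

(* Inner probability: no measurability of the event E is needed, so that
   eigenvectors, projections and maximizers may be selected arbitrarily. *)
Definition prob_at_least (E : set T) (r : R) : Prop :=
  exists A, [/\ measurable A, A `<=` E & (r%:E <= P A)%E].

Lemma prob_at_leastE (E : set T) (r : R) : measurable E ->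
  prob_at_least E r <-> (r%:E <= P E)%E.
Proof.
move=> mE; split=> [[A [mA AE rA]]|rE]; last by exists E; split.
by apply: (le_trans rA); apply: le_measure; rewrite ?inE.
Qed.

Section Model.
Context (n d : nat).
Variables (w : 'I_n -> 'I_n -> {RV P >-> bool})
  (Theta : 'I_n -> 'I_n -> 'I_d -> 'I_d -> {RV P >-> measurableTypeR R}).

Definition noise_mx (x : T) (i j : 'I_n) : 'M[R]_d :=
  \matrix_(k, l) Theta i j k l x.

(* [inl (i, j)] indexes w_ij, and [inr (i, j, (k, l))] the (k, l) entry of
   Theta_ij. *)
Definition model_index : finType :=
  (('I_n * 'I_n) + ('I_n * 'I_n * ('I_d * 'I_d)))%type.

Definition upper_index : {set model_index} :=
  [set a : model_index | match a with
                         | inl e => (e.1 < e.2)%N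
                         | inr (e, _) => (e.1 < e.2)%N
                         end].

Definition model_events (a : model_index) : set (set T) :=
  match a with
  | inl (i, j) => sigma_RV (w i j)
  | inr (i, j, (k, l)) => sigma_RV (Theta i j k l)
  end.

Definition model_independent : Prop :=
  mutually_independent upper_index model_events.

Definition edges_bernoulli (p : R) : Prop :=
  forall i j : 'I_n, (i < j)%N ->
    forall A, measurable A -> distribution P (w i j) A = bernoulli_prob p A.

Definition noise_identically_distributed : Prop :=
  forall (i j i' j' : 'I_n) (k l k' l' : 'I_d), (i < j)%N -> (i' < j')%N ->
    forall A, measurable A ->
      distribution P (Theta i j k l) A = distribution P (Theta i' j' k' l') A.

Definition noise_sub_gaussian (sigma : R) : Prop :=
  forall (i j : 'I_n) (k l : 'I_d), (i < j)%N ->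
    sub_gaussian (Theta i j k l) sigma.

Definition noise_gaussian (sigma : R) : Prop :=
  forall (i j : 'I_n) (k l : 'I_d), (i < j)%N ->
    forall A, measurable A ->
      distribution P (Theta i j k l) A = normal_prob 0 sigma A.

Definition random_obs_mx (Gstar : blockcol R n d) (x : T) : blocksq R n d :=
  obs_mx Gstar (fun i j => w i j x) (noise_mx x).

End Model.
End Probability.

(* Main.v *)
(* Write D = C - p G* G*^T. If the operator norm b of D satisfies b sqrt(d) << (beta / alpha) p n,
   the closeness of V_C Q* to G* / sqrt n makes the best candidate in Q a matrix G0 close to
   G* Q' for some Q' in G, and the inequality psi(Ghat) >= psi(G0) forces X = G*^T Ghat / n, a
   point of conv(G), to have d - ||X||_F^2 small. The second error bound then makes
   Tr(I - X^T Pi(X)) small, and ||Ghat - G* Pi(X)||_F^2 = 2 n Tr(I - X^T Pi(X)).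

   The norm of D is controlled by tr((A A^T)^k), k of order p n or d p n a power of two, and
   Markov's inequality, for A either the strictly upper triangular centred adjacency matrix or
   the strictly upper triangular noise conditioned on a realisation of the graph whose degrees
   are at most k / d. The expected trace is a sum over closed walks (u, v) of length 2k, weighted
   by the moments mu_m of the multiplicities of the cells that they visit, with mu_1 = 0, the
   walk staying in a sparse set of cells. Grouping the walks by equality pattern and exploring
   each along a spanning tree compares this sum to the same one over an alphabet of 2k letters
   with all cells allowed. There, averaging over permutations of the positions decouples the two
   matchings of the letters of u with those of v, and the Leibniz rule bounds the sum by a
   derivative at 0 of a product of exponential generating functions, each at most
   exp(th y^2). This only uses the
   sub-Gaussian bound and loses no logarithm, so Gaussian and sub-Gaussian noise are treated alike. *)

Require Import Defs.
From HB Require Import structures.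
From mathcomp Require Import all_boot all_order all_algebra all_fingroup.
From mathcomp Require Import all_classical all_reals all_analysis.
From mathcomp Require Import measurable_realfun simple_functions ring lra.
Import Order.TTheory GRing.Theory Num.Theory.
Import numFieldNormedType.Exports.

Set Implicit Arguments.
Unset Strict Implicit.
Unset Printing Implicit Defensive.

Local Open Scope ring_scope.

(** * Sums over closed walks *)

(** The moment order [k] must be at least of order [p n]: this quantity dominates both [d] and
    [ln n], so the prefactors of the trace, polynomial in [n] and [d], are absorbed by a constant to
    the power [k]. At such an order the walks may revisit cells arbitrarily often, and separating
    tree-like walks from the others is hopeless. The bound must have the form [(const * th * k) ^ k]
    for all of them together, hence the generating functions.

    Keeping only the strict upper triangle makes all entries independent; the walk of [A *m A^T]
    then alternates between rows and columns with no symmetry constraint.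

    The same walk bound serves twice, with [th = 2] and each visited cell charged [p] for the graph,
    and with [th = sigma ^ 2] and a 0-1 mask for the noise. The first use supplies the degree bound
    needed by the second, so the degrees require no concentration inequality of their own.
    Conditioning on the graph is done by multiplying by the indicator of each realisation and
    summing over realisations. *)

Section Sequences.
Variables (n : nat) (C : finType).

Definition ffrcons (y : {ffun 'I_n -> C}) (a : C) : {ffun 'I_n.+1 -> C} :=
  [ffun t => if unlift ord_max t is Some s then y s else a].

Lemma ffrcons_lift y a s : ffrcons y a (lift ord_max s) = y s.
Proof. by rewrite ffunE liftK. Qed.

Lemma ffrcons_max y a : ffrcons y a ord_max = a.
Proof. by rewrite ffunE unlift_none. Qed.

Lemma ffrcons_bij : bijective (fun p : {ffun 'I_n -> C} * C => ffrcons p.1 p.2).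
Proof.
exists (fun x : {ffun 'I_n.+1 -> C} => ([ffun s => x (lift ord_max s)], x ord_max)).
  case=> y a /=; rewrite ffrcons_max; congr pair.
  by apply/ffunP => s; rewrite ffunE ffrcons_lift.
move=> x /=; apply/ffunP => t; rewrite ffunE.
by case: unliftP => [s ->|->] //; rewrite ffunE.
Qed.

Lemma sum_ffrcons (V : nmodType) (E : {ffun 'I_n.+1 -> C} -> V) :
  \sum_x E x = \sum_(y : {ffun 'I_n -> C}) \sum_(a : C) E (ffrcons y a).
Proof.
rewrite pair_big /=.
by rewrite (reindex _ (onW_bij _ ffrcons_bij)).
Qed.

End Sequences.

Definition cnt (n : nat) (C : finType) (x : 'I_n -> C) (c : C) : nat :=
  (\sum_t (x t == c))%N.

Lemma cnt_ffrcons n (C : finType) (y : {ffun 'I_n -> C}) a c :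
  cnt (ffrcons y a) c = (cnt y c + (a == c))%N.
Proof.
rewrite /cnt (bigD1_ord ord_max) //= ffrcons_max addnC; congr addn.
by apply: eq_bigr => s _; rewrite ffrcons_lift.
Qed.

Lemma cnt_perm n (C : finType) (x : 'I_n -> C) (s : {perm 'I_n}) c :
  cnt (x \o s) c = cnt x c.
Proof. by rewrite /cnt [RHS](reindex_inj (@perm_inj _ s)). Qed.

Lemma sum_cnt n (C : finType) (x : 'I_n -> C) : (\sum_c cnt x c)%N = n.
Proof.
rewrite /cnt exchange_big /= -[RHS]card_ord -sum1_card; apply: eq_bigr => t _.
by rewrite (bigD1 (x t)) //= eqxx big1 // => c; rewrite eq_sym => /negbTE ->.
Qed.

Lemma cnt_le n (C : finType) (x : 'I_n -> C) c : (cnt x c <= n)%N.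
Proof. by rewrite -[leqRHS](sum_cnt x) (bigD1 c) //= leq_addr. Qed.

Lemma prod_cnt (R : comNzRingType) n (C : finType) (x : 'I_n -> C) (z : C -> R) :
  \prod_t z (x t) = \prod_c z c ^+ cnt x c.
Proof.
rewrite /cnt; under [RHS]eq_bigr do rewrite expr_sum.
rewrite exchange_big /=; apply: eq_bigr => t _.
rewrite (bigD1 (x t)) //= eqxx expr1 big1 ?mulr1 // => c.
by rewrite eq_sym => /negbTE ->.
Qed.

Lemma derivnDn (R : nzRingType) (p : {poly R}) m n : p^`(m + n) = p^`(m)^`(n).
Proof. by rewrite addnC /derivn iterD. Qed.

Section Leibniz.
Variables (R : comNzRingType) (C : finType).

Lemma deriv_prod (G : C -> {poly R}) :
  (\prod_c G c)^`() = \sum_a \prod_c (G c)^`(a == c).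
Proof.
have H (r : seq C) : uniq r -> (\prod_(c <- r) G c)^`() =
    \sum_(a <- r) \prod_(c <- r) (G c)^`(a == c).
  elim: r => [|b r IH] /=; first by rewrite !big_nil derivC.
  case/andP=> br ur; rewrite !big_cons derivM IH // eqxx derivn1; congr (_ * _ + _).
    apply: eq_big_seq => c cr; case: eqP => // bc; by rewrite bc cr in br.
  rewrite mulr_sumr; apply: eq_big_seq => a ar; rewrite big_cons.
  by case: eqP => [ab|//]; rewrite -ab ar in br.
by rewrite H ?index_enum_uniq.
Qed.

(** A word [x] records which factor is differentiated at each of the [n] steps, so the factor [c] is
    differentiated once per occurrence of [c]. *)
Lemma derivn_prod (F : C -> {poly R}) n :
  (\prod_c F c)^`(n) = \sum_(x : {ffun 'I_n -> C}) \prod_c (F c)^`(cnt x c).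
Proof.
elim: n => [|n IH].
  rewrite (bigD1 [ffun t : 'I_0 => match t with Ordinal _ p => False_rect C (notF p) end]) //=.
  rewrite [X in _ + X]big1 ?addr0.
    by apply: eq_bigr => c _; rewrite /cnt big_ord0.
  by move=> x /eqP[]; apply/ffunP; case.
rewrite derivnS IH raddf_sum sum_ffrcons; apply: eq_bigr => y _ /=.
rewrite deriv_prod; apply: eq_bigr => a _; apply: eq_bigr => c _.
by rewrite cnt_ffrcons; case: (a == c); rewrite ?addn0 ?addn1 ?derivnS ?derivn1.
Qed.

End Leibniz.

(** Cauchy's estimate in elementary form: for nonnegative coefficients one term is at most the whole
    sum. *)
Lemma coef_le_horner (R : numDomainType) (p : {poly R}) (s : R) n :
  (forall i, 0 <= p`_i) -> 0 <= s -> p`_n * s ^+ n <= p.[s].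
Proof.
move=> pn s0; rewrite horner_coef.
have T i : 0 <= p`_i * s ^+ i by rewrite mulr_ge0 ?exprn_ge0.
have [nl|nl] := ltnP n (size p).
  by rewrite (bigD1 (Ordinal nl)) //= lerDl sumr_ge0.
by rewrite nth_default // mul0r sumr_ge0.
Qed.

Lemma coef_prod_ge0 (R : numDomainType) (C : finType) (F : C -> {poly R}) :
  (forall c i, 0 <= (F c)`_i) -> forall i, 0 <= (\prod_c F c)`_i.
Proof.
move=> F0; apply: (big_ind (fun p : {poly R} => forall i, 0 <= p`_i)) => //.
  by move=> i; rewrite coef1 ler0n.
by move=> p q p0 q0 i; rewrite coefM sumr_ge0 // => j _; rewrite mulr_ge0.
Qed.

Section CellSums.
Variables (R : realFieldType) (C : finType) (k : nat) (mu : nat -> R).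
Hypothesis mu_ge0 : forall m, 0 <= mu m.

Definition cell_weight (x0 x1 : 'I_k -> C) : R :=
  \prod_c mu (cnt x0 c + cnt x1 c).

(** Let [F c] be the truncated exponential generating function of [mu], with variable scaled by
    [z c]. Differentiating [\prod_c F c] first [k] and then [k] more times produces the pairs of
    words, and evaluating at 0 leaves exactly the moments; Cauchy's estimate at radius [s]
    concludes. The truncation loses nothing, since no letter occurs more than [k + k] times. *)
Lemma sum_cell_weight_le (z : C -> R) (s : R) :
  (forall c, 0 <= z c) -> 0 < s ->
  \sum_(x0 : {ffun 'I_k -> C}) \sum_(x1 : {ffun 'I_k -> C})
     cell_weight x0 x1 * (\prod_t z (x0 t) * \prod_t z (x1 t)) <=
  (k + k)`!%:R / s ^+ (k + k) *
  \prod_c \sum_(m < (k + k).+1) mu m * (z c * s) ^+ m / m`!%:R.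
Proof.
move=> z0 s0.
pose F c := \poly_(m < (k + k).+1) (mu m * z c ^+ m / m`!%:R).
have Fn c i : 0 <= (F c)`_i.
  by rewrite coef_poly; case: ifP => _ //; rewrite divr_ge0 ?mulr_ge0 ?exprn_ge0.
have -> : \sum_(x0 : {ffun 'I_k -> C}) \sum_(x1 : {ffun 'I_k -> C})
     cell_weight x0 x1 * (\prod_t z (x0 t) * \prod_t z (x1 t)) =
    ((\prod_c F c)^`(k + k)).[0].
  rewrite derivnDn derivn_prod raddf_sum horner_sum /=.
  apply: eq_bigr => x0 _; rewrite derivn_prod horner_sum; apply: eq_bigr => x1 _.
  rewrite horner_prod !prod_cnt -!big_split /=; apply: eq_bigr => c _.
  rewrite -derivnDn horner_coef0 coef_derivn addn0 ffactnn coef_poly.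
  have le : (cnt x0 c + cnt x1 c <= k + k)%N by apply: leq_add; exact: cnt_le.
  rewrite ltnS le -exprD -[RHS]mulr_natr divfK //.
rewrite horner_coef0 coef_derivn addn0 ffactnn -[leLHS]mulr_natl -[leRHS]mulrA ler_wpM2l //.
rewrite mulrC ler_pdivlMr ?exprn_gt0 //.
apply: le_trans (coef_le_horner _ _ (ltW s0)) _; first exact: coef_prod_ge0.
rewrite horner_prod le_eqVlt; apply/orP; left; apply/eqP; apply: eq_bigr => c _.
rewrite horner_poly; apply: eq_bigr => m _.
by rewrite exprMn mulrA mulrAC.
Qed.
End CellSums.

Lemma ler_sum_inj (R : numDomainType) (I J : finType) (h : I -> J) (F : J -> R) :
  injective h -> (forall j, 0 <= F j) -> \sum_i F (h i) <= \sum_j F j.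
Proof.
move=> hi F0; rewrite -(big_imset (h := h) (A := predT) (aop := +%R) F); last by move=> ? ? _ _; exact: hi.
by rewrite [leRHS](bigID (mem [set h x | x in predT])) /= lerDl sumr_ge0.
Qed.

(** * Decoupling the two matchings of rows with columns *)

Section CyclicShift.
Variable K : nat.
Local Notation k := K.+1.

Definition cshift : {perm 'I_k} := perm (@ordS_inj k).

Lemma cshift_iter (t : 'I_k) : (cshift ^+ t)%g ord0 = t.
Proof.
apply: val_inj; rewrite permX; case: t => t /= tk.
have H n : (n < k)%N -> val (iter n cshift ord0) = n.
  elim: n => // n IH nk; rewrite iterS permE /= IH; last exact: ltnW.
  by rewrite modn_small.
exact: H.
Qed.

Lemma cshift_conj_inj (h h' : {perm 'I_k}) :
  (cshift ^ h)%g = (cshift ^ h')%g -> h ord0 = h' ord0 -> h = h'.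
Proof.
move=> e e0; apply/permP => t.
have E (g : {perm 'I_k}) : g t = ((cshift ^ g) ^+ t)%g (g ord0).
  by rewrite -conjXg permJ cshift_iter.
by rewrite E e e0 -E.
Qed.

(* Each permutation is a conjugate of the long cycle in at most [k] ways, since
   the conjugating permutation is determined by the image of one point. *)
Lemma sum_cshift_conj (R : numDomainType) (F : {perm 'I_k} -> R) :
  (forall s, 0 <= F s) ->
  \sum_(h : {perm 'I_k}) F (cshift ^ h)%g <= k%:R * \sum_s F s.
Proof.
move=> F0.
pose g (h : {perm 'I_k}) := ((cshift ^ h)%g, h ord0).
have gi : injective g by move=> h h' [e e0]; exact: cshift_conj_inj.
apply: le_trans (ler_sum_inj (F := fun p => F p.1) gi _) _ => //.
rewrite -(pair_big xpredT xpredT (fun s (_ : 'I_k) => F s)) /= mulr_sumr ler_sum // => s _.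
by rewrite sumr_const card_ord mulr_natl.
Qed.

End CyclicShift.

Section Averaging.
Variables (R : realFieldType) (I J : finType) (K : nat) (mu : nat -> R).
Hypothesis mu_ge0 : forall m, 0 <= mu m.
Local Notation k := K.+1.

(** Step [t] goes from the row [u t] through the column [v t] to the next row, cyclically. This is
    the expected trace of [(A A^T)^k] when the entries of [A] are independent with moments [mu]. *)
Definition closed_walk_sum : R :=
  \sum_(u : {ffun 'I_k -> I}) \sum_(v : {ffun 'I_k -> J})
    cell_weight mu (fun t => (u t, v t)) (fun t => (u (cshift K t), v t)).

Lemma cell_weight_ge0 (C : finType) n (x y : 'I_n -> C) : 0 <= cell_weight mu x y.
Proof. by apply: prodr_ge0 => c _; exact: mu_ge0. Qed.

Definition precomp (C : finType) (s : {perm 'I_k}) (u : {ffun 'I_k -> C}) :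
  {ffun 'I_k -> C} := [ffun t => u (s t)].

Lemma precomp_inj (C : finType) s : injective (@precomp C s).
Proof.
move=> u v e; apply/ffunP => t.
by move/ffunP: e => /(_ (s^-1 t)%g); rewrite !ffunE permKV.
Qed.

(** The weight only sees how often each cell is visited, so the two lists of cells may be reordered
    separately: renaming the positions by [h] conjugates the shift, and [s] then reorders the second
    list alone. *)
Lemma closed_walk_sum_perm (h s : {perm 'I_k}) :
  closed_walk_sum = \sum_(u : {ffun 'I_k -> I}) \sum_(v : {ffun 'I_k -> J})
    cell_weight mu (fun t => (u t, v t))
                   (fun t => (u ((cshift K ^ h)%g (s t)), v (s t))).
Proof.
rewrite /closed_walk_sum (reindex_inj (@precomp_inj I h)); apply: eq_bigr => u _.
rewrite (reindex_inj (@precomp_inj J h)); apply: eq_bigr => v _.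
apply: eq_bigr => c _; congr (mu (_ + _)).
  rewrite -(cnt_perm (fun t => (u t, v t)) h); apply: eq_bigr => t _.
  by rewrite /= !ffunE.
rewrite -(cnt_perm (fun t => (_ (cshift K t), _)) (s * h^-1)%g).
apply: eq_bigr => t _; rewrite /= !ffunE !permM.
by rewrite -(permJ (cshift K)) !permKV.
Qed.

(** Averaging over [h] turns the shift into a uniform long cycle. Long cycles form a proportion
    [1 / k] of all permutations, so letting this cycle run over all of them costs the factor [k] and
    leaves two independent permutations. *)
Lemma closed_walk_sum_average :
  (k`!%:R ^+ 2) * closed_walk_sum <=
  k%:R * \sum_(s : {perm 'I_k}) \sum_(s' : {perm 'I_k})
     \sum_(u : {ffun 'I_k -> I}) \sum_(v : {ffun 'I_k -> J})
    cell_weight mu (fun t => (u t, v t)) (fun t => (u (s t), v (s' t))).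
Proof.
have -> : (k`!%:R ^+ 2) * closed_walk_sum =
    \sum_(s' : {perm 'I_k}) \sum_(h : {perm 'I_k})
     \sum_(u : {ffun 'I_k -> I}) \sum_(v : {ffun 'I_k -> J})
    cell_weight mu (fun t => (u t, v t))
                   (fun t => (u ((cshift K ^ h)%g (s' t)), v (s' t))).
  transitivity (\sum_(s' : {perm 'I_k}) \sum_(h : {perm 'I_k}) closed_walk_sum).
    by rewrite !sumr_const card_Sn -mulrnA -[RHS]mulr_natl natrM expr2.
  by apply: eq_bigr => s' _; apply: eq_bigr => h _; exact: closed_walk_sum_perm.
rewrite [X in _ <= _ * X]exchange_big /= mulr_sumr; apply: ler_sum => s' _.
pose F (s : {perm 'I_k}) := \sum_(u : {ffun 'I_k -> I}) \sum_(v : {ffun 'I_k -> J})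
    cell_weight mu (fun t => (u t, v t)) (fun t => (u (s (s' t)), v (s' t))).
have F0 s : 0 <= F s.
  by apply: sumr_ge0 => u _; apply: sumr_ge0 => v _; exact: cell_weight_ge0.
apply: le_trans (sum_cshift_conj F0) _; rewrite ler_wpM2l //.
rewrite [leRHS](reindex_inj (mulgI s')) /=; apply: ler_sum => s _.
apply: ler_sum => u _; apply: ler_sum => v _; rewrite le_eqVlt; apply/orP; left.
apply/eqP; apply: eq_bigr => c _; congr (mu (_ + _)).
by apply: eq_bigr => t _; rewrite /= permM.
Qed.

End Averaging.

(** * The walk sum with every cell allowed *)

Section DenseBound.
Variables (R : realType) (I J : finType) (K : nat) (mu : nat -> R) (th : R).
Hypothesis mu_ge0 : forall m, 0 <= mu m.
Local Notation k := K.+1.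
Hypothesis th_gt0 : 0 < th.
Hypothesis mu_egf : forall y, 0 <= y ->
  \sum_(m < (k + k).+1) mu m * y ^+ m / m`!%:R <= expR (th * y ^+ 2).

(** Once the injectivity of [s] is forgotten, the position [t] has [cnt u (u1 t)] possible
    images. *)
Lemma card_rearrange (C : finType) (u u1 : {ffun 'I_k -> C}) :
  (\sum_(s : {perm 'I_k}) [forall t, u (s t) == u1 t] <= \prod_t cnt u (u1 t))%N.
Proof.
rewrite /cnt (bigA_distr_bigA (fun t s => (u s == u1 t : nat))) /=.
pose h (s : {perm 'I_k}) : {ffun 'I_k -> 'I_k} := [ffun t => s t].
have hi : injective h by move=> s s' /ffunP e; apply/permP => t; move: (e t); rewrite !ffunE.
pose F (f : {ffun 'I_k -> 'I_k}) : R := (\prod_t (u (f t) == u1 t))%N%:R.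
rewrite -(ler_nat R) !natr_sum.
apply: le_trans (ler_sum_inj (F := F) hi (fun f => ler0n _ _)); apply: ler_sum => s _.
rewrite ler_nat; case: forallP => // e; rewrite big1 // => t _; by rewrite ffunE e.
Qed.

Definition content (C : finType) (u : {ffun 'I_k -> C}) : {ffun C -> 'I_k.+1} :=
  [ffun c => inord (cnt u c)].

Lemma contentE (C : finType) (u : {ffun 'I_k -> C}) c : content u c = cnt u c :> nat.
Proof. by rewrite ffunE inordK // ltnS cnt_le. Qed.

Definition is_content (C : finType) (a : {ffun C -> 'I_k.+1}) := (\sum_c a c == k)%N.

Lemma content_is_content (C : finType) (u : {ffun 'I_k -> C}) : is_content (content u).
Proof.
by apply/eqP; rewrite -[RHS](sum_cnt u); apply: eq_bigr => c _; rewrite contentE.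
Qed.

(** Charging [1/2] per occurrence of a letter gives every content the weight [2 ^- k]. The
    constraint on the total can then be dropped, and the sum factors into geometric sums, each at
    most 2. *)
Lemma card_content (C : finType) :
  \sum_(a : {ffun C -> 'I_k.+1} | is_content a) (1 : R) <= 2 ^+ (k + #|C|).
Proof.
have E (a : {ffun C -> 'I_k.+1}) : is_content a -> (1 : R) = 2 ^+ k * \prod_c 2^-1 ^+ a c.
  by move=> /eqP e; rewrite -expr_sum e -exprMn divff ?expr1n.
rewrite (eq_bigr _ E) -mulr_sumr exprD ler_wpM2l ?exprn_ge0 //.
apply: (@le_trans _ _ (\sum_(a : {ffun C -> 'I_k.+1}) \prod_c (2^-1 : R) ^+ a c)).
  rewrite [leRHS](bigID (@is_content C)) /= lerDl sumr_ge0 // => a _.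
  by rewrite prodr_ge0 // => c _; rewrite exprn_ge0.
rewrite -(bigA_distr_bigA (fun c (i : 'I_k.+1) => (2^-1 : R) ^+ i)) /=.
rewrite -prodr_const; apply: ler_prod => c _; apply/andP; split.
  by rewrite sumr_ge0 // => i _; rewrite exprn_ge0.
have -> : \sum_(i < k.+1) (2^-1 : R) ^+ i = 2 - 2^-1 ^+ k.
  elim: (k) => [|n IH]; first by rewrite big_ord1 !expr0; lra.
  by rewrite big_ord_recr /= IH [_ ^+ n.+1]exprS; lra.
by rewrite lerBlDr lerDl exprn_ge0.
Qed.

Definition rt (C : finType) (a : {ffun C -> 'I_k.+1}) (c : C) : R := Num.sqrt (a c)%:R.

(** If [u1] rearranges [u], the product of the multiplicities is the same along both words and
    splits into a square root along each. This is the product form that [sum_cell_weight_le] can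
    absorb. *)
Lemma card_rearrange_rt (C : finType) (u u1 : {ffun 'I_k -> C}) :
  (\sum_(s : {perm 'I_k}) [forall t, u (s t) == u1 t])%N%:R <=
  \prod_t rt (content u) (u t) * \prod_t rt (content u) (u1 t).
Proof.
have [->|n0] := eqVneq (\sum_(s : {perm 'I_k}) [forall t, u (s t) == u1 t])%N 0%N.
  by rewrite mulr_ge0 // prodr_ge0 // => t _; rewrite sqrtr_ge0.
have [s /forallP es] : exists s : {perm 'I_k}, [forall t, u (s t) == u1 t].
  apply/existsP; apply: contraNT n0; rewrite negb_exists => /forallP n0.
  by rewrite big1 // => s _; rewrite (negbTE (n0 s)).
have -> : \prod_t rt (content u) (u t) = \prod_t rt (content u) (u1 t).
  rewrite (reindex_inj (@perm_inj _ s)); apply: eq_bigr => t _.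
  by rewrite (eqP (es t)).
rewrite -big_split /=; apply: le_trans (_ : (\prod_t cnt u (u1 t))%N%:R <= _).
  by rewrite ler_nat card_rearrange.
by rewrite natr_prod ler_prod // => t _; rewrite ler0n /rt contentE -expr2 sqr_sqrtr /=.
Qed.

Lemma sum_pair_ffun (V : nmodType) (E : {ffun 'I_k -> I * J} -> V) :
  \sum_x E x = \sum_(u : {ffun 'I_k -> I}) \sum_(v : {ffun 'I_k -> J})
    E [ffun t => (u t, v t)].
Proof.
rewrite pair_big /=.
pose g (p : {ffun 'I_k -> I} * {ffun 'I_k -> J}) := [ffun t => (p.1 t, p.2 t)].
rewrite (reindex g) //; exists (fun x : {ffun 'I_k -> I * J} => ([ffun t => (x t).1], [ffun t => (x t).2])).
  by case=> u v _; congr pair; apply/ffunP => t; rewrite !ffunE.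
by move=> x _; apply/ffunP => t; rewrite !ffunE /=; case: (x t).
Qed.

Lemma cell_weight_ext (C : finType) (x0 x1 y0 y1 : 'I_k -> C) :
  x0 =1 y0 -> x1 =1 y1 -> cell_weight mu x0 x1 = cell_weight mu y0 y1.
Proof.
move=> e0 e1; apply: eq_bigr => c _; congr (mu (_ + _)).
  by apply: eq_bigr => t _; rewrite e0.
by apply: eq_bigr => t _; rewrite e1.
Qed.

Definition rt_weight (a : {ffun I -> 'I_k.+1}) (b : {ffun J -> 'I_k.+1})
    (u u1 : {ffun 'I_k -> I}) (v v1 : {ffun 'I_k -> J}) : R :=
  (\prod_t rt a (u t) * \prod_t rt a (u1 t)) *
  (\prod_t rt b (v t) * \prod_t rt b (v1 t)).

Lemma rt_weight_ge0 a b u u1 v v1 : 0 <= rt_weight a b u u1 v v1.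
Proof. by rewrite /rt_weight !mulr_ge0 // prodr_ge0 // => t _; rewrite sqrtr_ge0. Qed.

(* The factor [1 / (th * k)] is the value of [s ^+ 2] that minimises
   [s ^- (k + k) * expR (th * s ^+ 2 * k ^+ 2)]. *)
Lemma sum_rt_weight_le a b : is_content a -> is_content b ->
  \sum_(u : {ffun 'I_k -> I}) \sum_(v : {ffun 'I_k -> J})
  \sum_(u1 : {ffun 'I_k -> I}) \sum_(v1 : {ffun 'I_k -> J})
    cell_weight mu (fun t => (u t, v t)) (fun t => (u1 t, v1 t)) *
    rt_weight a b u u1 v v1 <= (k + k)`!%:R * (th * k%:R) ^+ k * expR k%:R.
Proof.
move=> /eqP ca /eqP cb.
pose z (c : I * J) : R := rt a c.1 * rt b c.2.
have z0 c : 0 <= z c by rewrite mulr_ge0 // sqrtr_ge0.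
have tk0 : 0 < th * k%:R by rewrite mulr_gt0.
pose s := Num.sqrt (th * k%:R)^-1.
have s0 : 0 < s by rewrite sqrtr_gt0 invr_gt0.
have s2 : s ^+ 2 = (th * k%:R)^-1 by rewrite sqr_sqrtr // invr_ge0 ltW.
have := sum_cell_weight_le k mu_ge0 z0 s0.
rewrite [X in X <= _ -> _](_ : _ = \sum_(u : {ffun 'I_k -> I}) \sum_(v : {ffun 'I_k -> J})
  \sum_(u1 : {ffun 'I_k -> I}) \sum_(v1 : {ffun 'I_k -> J})
    cell_weight mu (fun t => (u t, v t)) (fun t => (u1 t, v1 t)) *
    rt_weight a b u u1 v v1); last first.
  rewrite sum_pair_ffun; apply: eq_bigr => u _; apply: eq_bigr => v _.
  rewrite sum_pair_ffun; apply: eq_bigr => u1 _; apply: eq_bigr => v1 _; congr (_ * _).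
    by apply: cell_weight_ext => t; rewrite ffunE.
  rewrite /rt_weight -!big_split /=; apply: eq_bigr => t _.
  by rewrite !ffunE /z /=; ring.
move=> h; apply: le_trans h _; rewrite -!mulrA ler_wpM2l //.
rewrite [X in (s ^+ X)^-1]addnn -mul2n exprM s2 exprVn invrK.
apply: ler_wpM2l; first by rewrite exprn_ge0 // ltW.
apply: (@le_trans _ _ (\prod_c expR (th * (z c * s) ^+ 2))).
  apply: ler_prod => c _; have zs0 : 0 <= z c * s by rewrite mulr_ge0 // ltW.
  rewrite mu_egf // andbT sumr_ge0 // => m _.
  by rewrite divr_ge0 ?mulr_ge0 ?exprn_ge0.
rewrite -expR_sum ler_expR.
(* The squared weights of the cells sum to [k * k], as the multiplicities of either content sum to
   [k]. *)
have zz (c : I * J) : th * (z c * s) ^+ 2 = th * s ^+ 2 * ((a c.1)%:R * (b c.2)%:R).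
  by rewrite /z !exprMn [rt a _ ^+ 2]sqr_sqrtr // [rt b _ ^+ 2]sqr_sqrtr //; ring.
under eq_bigr do rewrite zz; rewrite -mulr_sumr.
rewrite -(pair_big xpredT xpredT (fun i j => (a i)%:R * (b j)%:R)) /=.
under eq_bigr do rewrite -mulr_sumr -natr_sum cb.
rewrite -mulr_suml -natr_sum ca s2 le_eqVlt; apply/orP; left; apply/eqP.
have : (k%:R : R) != 0 by rewrite pnatr_eq0.
by move: (k%:R : R) => kk kk0; field; rewrite kk0 gt_eqF.
Qed.

(** The permutations act only through the rearranged words, whose number is bounded by square roots
    of multiplicities. These depend on the words through their contents, so the words are grouped by
    content; the number of contents is only exponential in [k] and in the sizes of the alphabets. *)
Lemma closed_walk_sum_le :
  closed_walk_sum I J K mu <=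
  k%:R * ((k + k)`!%:R / k`!%:R ^+ 2) * 2 ^+ (k + #|I|) * 2 ^+ (k + #|J|) *
  ((th * k%:R) ^+ k * expR k%:R).
Proof.
have f0 : (0 : R) < k`!%:R ^+ 2 by rewrite exprn_gt0 // ltr0n fact_gt0.
rewrite -(ler_pM2l f0); apply: le_trans (closed_walk_sum_average I J K mu_ge0) _.
set M : R := (k + k)`!%:R * (th * k%:R) ^+ k * expR k%:R.
have -> : k`!%:R ^+ 2 * (k%:R * ((k + k)`!%:R / k`!%:R ^+ 2) * 2 ^+ (k + #|I|) *
    2 ^+ (k + #|J|) * ((th * k%:R) ^+ k * expR k%:R)) =
  k%:R * (2 ^+ (k + #|I|) * 2 ^+ (k + #|J|) * M).
  by rewrite /M; move: f0; set f := _ ^+ 2 => f0; move: (k%:R : R) => kk; field; rewrite gt_eqF.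
rewrite ler_wpM2l //.
apply: (@le_trans _ _ (\sum_(u : {ffun 'I_k -> I}) \sum_(v : {ffun 'I_k -> J})
  \sum_(u1 : {ffun 'I_k -> I}) \sum_(v1 : {ffun 'I_k -> J})
    cell_weight mu (fun t => (u t, v t)) (fun t => (u1 t, v1 t)) *
    rt_weight (content u) (content v) u u1 v v1)).
  under eq_bigr do rewrite exchange_big; rewrite exchange_big /=; apply: ler_sum => u _.
  under eq_bigr do rewrite exchange_big; rewrite exchange_big /=; apply: ler_sum => v _.
  rewrite (eq_bigr (fun s : {perm 'I_k} => \sum_(s' : {perm 'I_k}) \sum_(u1 : {ffun 'I_k -> I})
     \sum_(v1 : {ffun 'I_k -> J})
     cell_weight mu (fun t => (u t, v t)) (fun t => (u1 t, v1 t)) *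
     ([forall t, u (s t) == u1 t]%:R * [forall t, v (s' t) == v1 t]%:R))); last first.
    move=> s _; apply: eq_bigr => s' _.
    rewrite (bigD1 [ffun t => u (s t)]) //= (bigD1 [ffun t => v (s' t)]) //=.
    have -> : [forall t, u (s t) == [ffun t => u (s t)] t].
      by apply/forallP => t; rewrite ffunE.
    have -> : [forall t, v (s' t) == [ffun t => v (s' t)] t].
      by apply/forallP => t; rewrite ffunE.
    rewrite !mulr1.
    rewrite [X in _ + X + _]big1 ?[X in _ + X]big1 ?addr0.
    - by apply: cell_weight_ext => t; rewrite ?ffunE.
    - move=> u1 /eqP ne; rewrite big1 // => v1 _; case: forallP => e; last by rewrite mul0r mulr0.
      by case: ne; apply/ffunP => t; rewrite ffunE (eqP (e t)).
    - move=> v1 /eqP ne; case: [forall t, v _ == _] / forallP => e; last by rewrite !mulr0.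
      by case: ne; apply/ffunP => t; rewrite ffunE (eqP (e t)).
  under eq_bigr do rewrite exchange_big; rewrite exchange_big /=; apply: ler_sum => u1 _.
  under eq_bigr do rewrite exchange_big; rewrite exchange_big /=; apply: ler_sum => v1 _.
  under eq_bigr do rewrite -mulr_sumr -mulr_sumr; rewrite -mulr_sumr -mulr_suml.
  rewrite ler_wpM2l ?cell_weight_ge0 // -!natr_sum.
  by apply: ler_pM => //; exact: card_rearrange_rt.
rewrite (partition_big (@content I) (@is_content I)) /=; last by move=> *; exact: content_is_content.
rewrite -[X in _ <= X * _ * _]mulr1 -mulrA.
apply: (@le_trans _ _ (\sum_(a : {ffun I -> 'I_k.+1} | is_content a)
    \sum_(b : {ffun J -> 'I_k.+1} | is_content b) M)); last first.
  rewrite -[X in \sum_(_ | _) \sum_(_ | _) X](mul1r M) .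
  under eq_bigr do rewrite -mulr_suml.
  rewrite -[X in \sum_(_ | _) X]mul1r -mulr_suml mulr1 ler_pM ?card_content //.
  - exact: sumr_ge0.
  - by rewrite mulr_ge0 ?sumr_ge0 // /M !mulr_ge0 ?expR_ge0 ?exprn_ge0 ?mulr_ge0 ?ltW.
  rewrite ler_wpM2r ?card_content //.
  by rewrite /M !mulr_ge0 ?expR_ge0 ?exprn_ge0 ?mulr_ge0 ?ltW.
apply: ler_sum => a ca.
apply: (@le_trans _ _ (\sum_(u : {ffun 'I_k -> I} | content u == a)
    \sum_(b : {ffun J -> 'I_k.+1} | is_content b) \sum_(v : {ffun 'I_k -> J} | content v == b)
  \sum_(u1 : {ffun 'I_k -> I}) \sum_(v1 : {ffun 'I_k -> J})
    cell_weight mu (fun t => (u t, v t)) (fun t => (u1 t, v1 t)) *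
    rt_weight (content u) (content v) u u1 v v1)).
  apply: ler_sum => u _.
  by rewrite (partition_big (@content J) (@is_content J)) //= => *; exact: content_is_content.
rewrite exchange_big; apply: ler_sum => b cb /=.
apply: le_trans (sum_rt_weight_le ca cb).
rewrite [leRHS](bigID (fun u => content u == a)) /= -[leLHS]addr0; apply: lerD; last first.
  do 4 (apply: sumr_ge0 => ? _); by rewrite mulr_ge0 ?cell_weight_ge0 ?rt_weight_ge0.
apply: ler_sum => u /eqP <-.
rewrite [leRHS](bigID (fun v => content v == b)) /= -[leLHS]addr0; apply: lerD; last first.
  do 3 (apply: sumr_ge0 => ? _); by rewrite mulr_ge0 ?cell_weight_ge0 ?rt_weight_ge0.
by apply: ler_sum => v /eqP <-.
Qed.

End DenseBound.

(** Unvisited cells contribute [mu 0 = 1], so injectivity of [h] matters only on a set containing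
    the visited ones. *)
Lemma cell_weight_relabel (R : realFieldType) (mu : nat -> R) n (C C' : finType)
    (h : C -> C') (D : {set C}) (x0 x1 : 'I_n -> C) :
  mu 0%N = 1 -> {in D &, injective h} ->
  (forall t, x0 t \in D) -> (forall t, x1 t \in D) ->
  cell_weight mu (h \o x0) (h \o x1) = cell_weight mu x0 x1.
Proof.
move=> mu0 hi d0 d1.
have out (B : finType) (E : {set B}) (y : 'I_n -> B) c :
    (forall t, y t \in E) -> c \notin E -> cnt y c = 0%N.
  move=> yE cE; rewrite /cnt big1 // => t _; case: eqP => // e.
  by rewrite -e yE in cE.
have -> : cell_weight mu x0 x1 = \prod_(c in D) mu (cnt x0 c + cnt x1 c)%N.
  rewrite /cell_weight (bigID (mem D)) /= [X in _ * X]big1 ?mulr1 // => c cD.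
  by rewrite !(out _ D).
have hD (y : 'I_n -> C) : (forall t, y t \in D) -> forall t, (h \o y) t \in h @: D.
  by move=> yD t; exact: imset_f.
rewrite /cell_weight (bigID (mem (h @: D))) /= [X in _ * X]big1 ?mulr1; last first.
  by move=> c cD; rewrite !(out _ (h @: D)) //; exact: hD.
rewrite big_imset //; apply: eq_bigr => c cD; congr (mu (_ + _)).
  by apply: eq_bigr => t _ /=; congr nat_of_bool; apply/eqP/eqP => [/hi ->|->].
by apply: eq_bigr => t _ /=; congr nat_of_bool; apply/eqP/eqP => [/hi ->|->].
Qed.

(** * Equality patterns and exploration trees *)

Section Kernel.
Variables (C : finType) (n : nat).

(* The first position at which the letter of [u] at position [t] occurs; two
   words have the same [first_occ] exactly when they have the same equality
   pattern. *)
Definition first_occ (u : 'I_n -> C) : {ffun 'I_n -> 'I_n} :=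
  [ffun t => [arg min_(s < t | u s == u t) (s : nat)]].

Lemma first_occP (u : 'I_n -> C) t :
  u (first_occ u t) = u t /\ forall s, u s = u t -> (first_occ u t <= s)%N.
Proof.
rewrite ffunE; case: arg_minnP => // i /eqP e m; split=> // s /eqP es; exact: m.
Qed.

Lemma first_occK u t : u (first_occ u t) = u t.
Proof. by case: (first_occP u t). Qed.

Lemma first_occ_le u s t : u s = u t -> (first_occ u t <= s)%N.
Proof. by case: (first_occP u t) => _; exact. Qed.

Lemma first_occ_eq u s t : u s = u t -> first_occ u s = first_occ u t.
Proof.
move=> e; apply/val_inj/eqP; rewrite eqn_leq !first_occ_le //.
  by rewrite first_occK.
by rewrite first_occK.
Qed.

End Kernel.

(** This is why the comparison alphabet has [2 k] letters: a pattern with [m <= k] distinct letters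
    is realised by every injective choice of [m] letters, and each of the [m] factors of that
    falling factorial is at least [k]. *)
Lemma card_first_occ k (C : finType) (u0 : 'I_k -> C) :
  (k ^ #|[set t | first_occ u0 t == t]| <=
   #|[set u : {ffun 'I_k -> 'I_(k + k)} | first_occ u == first_occ u0]|)%N.
Proof.
set A := [set t | _].
pose T := {t | t \in A}.
have pA t : first_occ u0 t \in A by rewrite inE (first_occ_eq (first_occK u0 t)).
pose g (f : {ffun T -> 'I_(k + k)}) : {ffun 'I_k -> 'I_(k + k)} :=
  [ffun t => f (Sub (first_occ u0 t) (pA t))].
have cT : #|{: T}| = #|A| by rewrite card_sig.
have gF f t : g f t = f (Sub (first_occ u0 t) (pA t)) by rewrite [LHS]ffunE.
have gE f (x : T) : g f (val x) = f x.
  rewrite gF; congr (f _); apply: val_inj; case: x => t /=.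
  by rewrite inE => /eqP.
have gi : injective g by move=> f f' e; apply/ffunP => x; rewrite -!gE e.
have le1 : (k ^ #|A| <= #|[set f : {ffun T -> 'I_(k + k)} | injectiveb f]|)%N.
  rewrite card_inj_ffuns card_ord cT ffact_prod.
  rewrite -[in leqLHS](card_ord #|A|) -prod_nat_const.
  apply: leq_prod => i _; rewrite leq_subRL; last first.
    apply: leq_trans (ltnW (ltn_ord i)) (leq_trans (max_card _) _).
    by rewrite card_ord leq_addr.
  by rewrite leq_add2r; apply: leq_trans (ltnW (ltn_ord i)) (leq_trans (max_card _) _); rewrite card_ord.
apply: leq_trans le1 _.
rewrite -(card_imset _ gi); apply/subset_leq_card/fintype.subsetP => u /imsetP[f].
rewrite !inE => /injectiveP fi -> {u}; apply/eqP/ffunP => t.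
have [e m] := first_occP (g f) t.
apply/val_inj/eqP; rewrite eqn_leq; apply/andP; split.
  apply: first_occ_le; rewrite !gF; congr (f _); apply: val_inj => /=.
  by rewrite (first_occ_eq (first_occK u0 t)).
move: e; rewrite !gF => /fi/(congr1 val) /= <-.
exact: first_occ_le.
Qed.

Section TreeCount.
Variables (R : realFieldType) (I J : finType) (D : R) (q : I -> J -> R).
Hypothesis q_ge0 : forall i j, 0 <= q i j.
Hypothesis q_row : forall i, \sum_j q i j <= D.
Hypothesis q_col : forall j, \sum_i q i j <= D.
Variables a b : nat -> nat.

Definition respects (C : finType) (a : nat -> nat) n (u : {ffun 'I_n.+1 -> C}) :=
  [forall t : 'I_n.+1, u t == u (inord (a t))].

(** A fixed point of [a] or [b] is the position of a new row or column. A new row at [t + 1] is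
    reached from the column at [t], a new column at [t] from the row at [t]; the product runs over
    these edges of the exploration tree. *)
Definition tree_weight n (u : {ffun 'I_n.+1 -> I}) (v : {ffun 'I_n.+1 -> J}) : R :=
  (respects a u)%:R * (respects b v)%:R *
  (\prod_(t < n | a t.+1 == t.+1) q (u (inord t.+1)) (v (inord t)) *
   \prod_(t < n.+1 | b t == t) q (u t) (v t)).

Lemma ffrcons_inord (C : finType) n (y : {ffun 'I_n.+1 -> C}) c t : (t < n.+1)%N ->
  ffrcons y c (inord t) = y (inord t).
Proof.
move=> tn; rewrite -(ffrcons_lift y c); congr (ffrcons _ _ _).
by apply: val_inj; rewrite /= /bump !inordK ?(leqW tn) // leqNgt tn.
Qed.

Lemma ffrcons_inordT (C : finType) n (y : {ffun 'I_n.+1 -> C}) c :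
  ffrcons y c (inord n.+1) = c.
Proof.
by rewrite -[RHS](ffrcons_max y); congr (ffrcons _ _ _); apply: val_inj; rewrite /= inordK.
Qed.

Lemma respects_ffrcons (C : finType) (f : nat -> nat) n (y : {ffun 'I_n.+1 -> C}) c :
  (forall t, (f t <= t)%N) ->
  respects f (ffrcons y c) =
  respects f y && ((f n.+1 == n.+1) || (c == y (inord (f n.+1)))).
Proof.
move=> fle; apply/forallP/andP => [H|[/forallP H1 H2] t].
  split.
    apply/forallP => t; have := H (lift ord_max t).
    rewrite ffrcons_lift /= /bump leqNgt ltn_ord add0n ffrcons_inord //.
    exact: leq_ltn_trans (fle t) (ltn_ord t).
  have := H ord_max; rewrite ffrcons_max /=; case: (eqVneq (f n.+1) n.+1) => //= ne.
  by rewrite ffrcons_inord // ltn_neqAle ne fle.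
case: (unliftP ord_max t) => [s ->|->].
  rewrite ffrcons_lift /= /bump leqNgt ltn_ord add0n ffrcons_inord ?H1 //.
  exact: leq_ltn_trans (fle s) (ltn_ord s).
rewrite ffrcons_max /=; case: (eqVneq (f n.+1) n.+1) H2 => [-> _|ne /= e]; first by rewrite ffrcons_inordT.
by rewrite ffrcons_inord // ltn_neqAle ne fle.
Qed.

Hypothesis a_le : forall t, (a t <= t)%N.
Hypothesis b_le : forall t, (b t <= t)%N.

Lemma q_step (C : finType) (g : C -> R) (x : C) (e : bool) :
  (forall c, 0 <= g c) -> \sum_c g c <= D ->
  \sum_c (e || (c == x))%:R * (if e then g c else 1) <= D ^+ e.
Proof.
move=> g0 gD; case: e => /=; first by under eq_bigr do rewrite mul1r; rewrite expr1.
rewrite (bigD1 x) //= eqxx mulr1 big1 ?addr0 // => c /negbTE ->.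
by rewrite mul0r.
Qed.

Lemma tree_weight_ffrcons n (u : {ffun 'I_n.+1 -> I}) (v : {ffun 'I_n.+1 -> J}) i j :
  tree_weight (ffrcons u i) (ffrcons v j) = tree_weight u v *
    (((a n.+1 == n.+1) || (i == u (inord (a n.+1))))%:R *
     (if a n.+1 == n.+1 then q i (v ord_max) else 1)) *
    (((b n.+1 == n.+1) || (j == v (inord (b n.+1))))%:R *
     (if b n.+1 == n.+1 then q i j else 1)).
Proof.
rewrite /tree_weight !respects_ffrcons // -!mulnb !natrM.
have -> : \prod_(t < n.+1 | a t.+1 == t.+1)
      q (ffrcons u i (inord t.+1)) (ffrcons v j (inord t)) =
    \prod_(t < n | a t.+1 == t.+1) q (u (inord t.+1)) (v (inord t)) *
    (if a n.+1 == n.+1 then q i (v ord_max) else 1).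
  rewrite [LHS]big_mkcond big_ord_recr /=; congr (_ * _).
    rewrite [RHS]big_mkcond; apply: eq_bigr => t _; case: ifP => // _.
    by rewrite !ffrcons_inord // ltnS // ltnW.
  case: ifP => // _; rewrite ffrcons_inordT ffrcons_inord //.
  by congr (q _ (v _)); apply: val_inj; rewrite /= inordK.
have -> : \prod_(t < n.+2 | b t == t) q (ffrcons u i t) (ffrcons v j t) =
    \prod_(t < n.+1 | b t == t) q (u t) (v t) *
    (if b n.+1 == n.+1 then q i j else 1).
  rewrite [LHS]big_mkcond (bigD1_ord ord_max) //= !ffrcons_max mulrC; congr (_ * _).
  rewrite [RHS]big_mkcond; apply: eq_bigr => t _.
  by rewrite /= /bump leqNgt ltn_ord add0n !ffrcons_lift.
ring.
Qed.

(** Letters are summed out from the last to the first. An old letter is determined by the pattern,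
    and a new one costs a row or column sum of [q], at most [D]. Only the first row has no parent,
    and it costs [#|I|]. *)
Lemma sum_tree_weight n : 0 <= D ->
  \sum_(u : {ffun 'I_n.+1 -> I}) \sum_(v : {ffun 'I_n.+1 -> J}) tree_weight u v <=
  #|I|%:R * D ^+ (\sum_(t < n) (a t.+1 == t.+1) + \sum_(t < n.+1) (b t == t))%N.
Proof.
move=> D0.
have tw0 m (u : {ffun 'I_m.+1 -> I}) (v : {ffun 'I_m.+1 -> J}) : 0 <= tree_weight u v.
  by rewrite /tree_weight !mulr_ge0 // prodr_ge0.
elim: n => [|n IH].
  have [a0 b0] : a 0%N = 0%N /\ b 0%N = 0%N.
    by split; apply/eqP; rewrite -leqn0.
  rewrite big_ord0 big_ord1 b0 eqxx add0n expr1 sum_ffrcons.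
  rewrite exchange_big /= -[#|I|]sum1_card natr_sum mulr_suml; apply: ler_sum => i _.
  rewrite mul1r; apply: le_trans (q_row i).
  have c1 (C : finType) : #|{ffun 'I_0 -> C}| = 1%N by rewrite card_ffun card_ord expn0.
  have S (C : finType) (F : {ffun 'I_0 -> C} -> R) : exists x, \sum_y F y = F x.
    have /card_gt0P[x _] : (0 < #|{ffun 'I_0 -> C}|)%N by rewrite c1.
    exists x; rewrite (bigD1 x) //= big1 ?addr0 // => y /eqP[].
    by apply/ffunP; case.
  have [u ->] := S _ (fun y => \sum_(v : {ffun 'I_1 -> J}) tree_weight (ffrcons y i) v).
  rewrite sum_ffrcons exchange_big /=; apply: ler_sum => j _.
  have [v ->] := S _ (fun y => tree_weight (ffrcons u i) (ffrcons y j)).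
  rewrite /tree_weight big_ord0 mul1r [X in _ * X]big_mkcond big_ord1 b0 eqxx.
  rewrite (_ : ord0 = ord_max); last exact: val_inj.
  rewrite !ffrcons_max.
  by rewrite ler_piMl // -natrM mulnb lern1; case: (_ && _).
rewrite sum_ffrcons.
apply: (@le_trans _ _ (\sum_(u : {ffun 'I_n.+1 -> I}) \sum_(v : {ffun 'I_n.+1 -> J})
   tree_weight u v * (D ^+ (a n.+1 == n.+1) * D ^+ (b n.+1 == n.+1)))).
  apply: ler_sum => u _; under eq_bigr do rewrite sum_ffrcons.
  rewrite exchange_big /=; apply: ler_sum => v _.
  under eq_bigr do under eq_bigr do rewrite tree_weight_ffrcons -mulrA.
  under eq_bigr do rewrite -mulr_sumr -mulr_sumr.
  rewrite -mulr_sumr ler_wpM2l //.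
  (* The last column hangs from the last row, so it is summed first. *)
  apply: (@le_trans _ _ (\sum_i ((a n.+1 == n.+1) || (i == u (inord (a n.+1))))%:R *
     (if a n.+1 == n.+1 then q i (v ord_max) else 1) * D ^+ (b n.+1 == n.+1))).
    apply: ler_sum => i _; apply: ler_wpM2l; first by rewrite mulr_ge0 //; case: ifP.
    exact: (@q_step _ (q i)).
  rewrite -mulr_suml ler_wpM2r ?exprn_ge0 //.
  exact: (@q_step _ (q^~ (v ord_max))).
under eq_bigr do rewrite -mulr_suml; rewrite -mulr_suml.
rewrite -exprD; apply: (le_trans (ler_wpM2r _ IH)); first by rewrite exprn_ge0.
rewrite -mulrA -exprD [in leRHS](big_ord_recr n) [in leRHS](big_ord_recr n.+1) /=.
by rewrite le_eqVlt; apply/orP; left; apply/eqP; congr (_ * _ ^+ _); ring.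
Qed.

End TreeCount.

Section Comparison.
Variables (R : realType) (I J : finType) (K : nat) (mu : nat -> R) (q : I -> J -> R).
Local Notation k := K.+1.
Hypothesis mu_ge0 : forall m, 0 <= mu m.
Hypothesis mu0 : mu 0%N = 1.
Hypothesis q_ge0 : forall i j, 0 <= q i j.
Hypothesis q_le1 : forall i j, q i j <= 1.
Hypothesis q_row : forall i, \sum_j q i j <= k%:R.
Hypothesis q_col : forall j, \sum_i q i j <= k%:R.

Definition walk_cnt (I J : finType) (u : 'I_k -> I) (v : 'I_k -> J) (c : I * J) : nat :=
  (cnt (fun t => (u t, v t)) c + cnt (fun t => (u (cshift K t), v t)) c)%N.

Definition walk_weight (I J : finType) (u : 'I_k -> I) (v : 'I_k -> J) : R :=
  cell_weight mu (fun t => (u t, v t)) (fun t => (u (cshift K t), v t)).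

(** A visited cell is charged once, whatever its multiplicity. *)
Definition walk_mask (u : 'I_k -> I) (v : 'I_k -> J) : R :=
  \prod_c (if (0 < walk_cnt u v c)%N then q c.1 c.2 else 1).

(** Sending a pair of first positions to the cell of their letters is injective, so naming cells by
    such pairs keeps the multiplicities. *)
Lemma walk_weight_first_occ (I0 J0 : finType) (u : 'I_k -> I0) (v : 'I_k -> J0) :
  walk_weight u v = walk_weight (first_occ u) (first_occ v).
Proof.
pose D : {set 'I_k * 'I_k} := [set p | (first_occ u p.1 == p.1) && (first_occ v p.2 == p.2)].
pose h (p : 'I_k * 'I_k) := (u p.1, v p.2).
have idem (C : finType) (w : 'I_k -> C) t : first_occ w (first_occ w t) = first_occ w t.
  exact: first_occ_eq (first_occK w t).
rewrite /walk_weight.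
rewrite -(@cell_weight_relabel R mu k _ _ h D (fun t => (first_occ u t, first_occ v t))) //.
- by apply: cell_weight_ext => t; rewrite /h /= !first_occK.
- case=> [s1 s2] [t1 t2]; rewrite !inE /= => /andP[/eqP e1 /eqP e2] /andP[/eqP e3 /eqP e4] [e5 e6].
  by rewrite -e1 -e2 -e3 -e4 (first_occ_eq e5) (first_occ_eq e6).
- by move=> t; rewrite inE /= !idem !eqxx.
- by move=> t; rewrite inE /= !idem !eqxx.
Qed.

Definition occ_fun (w : {ffun 'I_k -> 'I_k}) (t : nat) : nat := w (inord t).

Lemma occ_fun_le (C : finType) (u : 'I_k -> C) t : (occ_fun (first_occ u) t <= t)%N.
Proof.
have [tk|kt] := ltnP t k.
  by rewrite /occ_fun -[X in (_ <= X)%N](inordK tk); exact: first_occ_le.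
exact: leq_trans (ltnW (ltn_ord _)) kt.
Qed.

Lemma cnt_gt0 n (C : finType) (x : 'I_n -> C) t : (0 < cnt x (x t))%N.
Proof. by rewrite /cnt (bigD1 t) //= eqxx. Qed.

(* The cells through which a row or a column is reached for the first time are
   pairwise distinct, so dropping the other factors can only increase the
   product. *)
Lemma walk_mask_le (u : {ffun 'I_k -> I}) (v : {ffun 'I_k -> J}) :
  walk_mask u v <=
  tree_weight q (occ_fun (first_occ u)) (occ_fun (first_occ v)) u v.
Proof.
rewrite /tree_weight.
have resp (C : finType) (w : {ffun 'I_k -> C}) : respects (occ_fun (first_occ w)) w.
  by apply/forallP => t; rewrite /occ_fun !inord_val first_occK.
rewrite !resp !mul1r.
pose h (s : 'I_K + 'I_k) : I * J :=
  match s with inl t => (u (inord t.+1), v (inord t)) | inr t => (u t, v t) end.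
pose Ap (s : 'I_K + 'I_k) : bool := match s with
   | inl t => occ_fun (first_occ u) t.+1 == t.+1
   | inr t => occ_fun (first_occ v) t == t end.
pose A := [set s | Ap s].
have -> : \prod_(t < K | occ_fun (first_occ u) t.+1 == t.+1)
      q (u (inord t.+1)) (v (inord t)) *
    \prod_(t < k | occ_fun (first_occ v) t == t) q (u t) (v t) =
    \prod_(s in A) q (h s).1 (h s).2.
  by rewrite [RHS]big_sumType /=; congr (_ * _); apply: eq_bigl => t; rewrite inE.
(* A cell discovering a row never discovers a column: equality would give [t + 1 <= t'] because the
   row is new, and [t' <= t] because the column is. *)
have hmix t t' : inl t \in A -> inr t' \in A -> h (inl t) <> h (inr t').
  rewrite !inE /Ap /occ_fun inord_val => /eqP et /eqP et' [eu ev].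
  have tk : (t < k)%N by apply: leqW; exact: ltn_ord.
  have l1 : (t.+1 <= t')%N by rewrite -et; apply: first_occ_le.
  have l2 : (t' <= t)%N.
    rewrite -[X in (_ <= X)%N](inordK tk) -et'; exact: first_occ_le.
  by move: (leq_trans l1 l2); rewrite ltnn.
have hi : {in A &, injective h}.
  move=> [t|t] [t'|t'] tA t'A e; last 1 first.
  - case: e => _ ev; move: tA t'A; rewrite !inE /Ap /occ_fun !inord_val.
    move=> /eqP et /eqP et'; congr inr; apply: val_inj => /=; rewrite -et -et'.
    by rewrite (first_occ_eq ev).
  - case: e => eu _; move: tA t'A; rewrite !inE /Ap /occ_fun.
    move=> /eqP et /eqP et'; congr inl; apply: val_inj; apply: succn_inj => /=.
    by rewrite -et -et' (first_occ_eq eu).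
  - by case: (hmix _ _ tA t'A).
  - by case: (hmix _ _ t'A tA).
rewrite -(big_imset (fun c => q c.1 c.2) hi) /= [leRHS]big_mkcond /=.
apply: ler_prod => c _; apply/andP; split; first by case: ifP.
case: (boolP (c \in h @: A)) => [/imsetP[s sA e]|_]; last first.
  by case: ifP => // _; exact: q_le1.
suff -> : (0 < walk_cnt u v c)%N by [].
rewrite /walk_cnt addn_gt0 e; case: s {e sA} => t /=.
  have tk : (t < k)%N by apply: leqW; exact: ltn_ord.
  have -> : inord t.+1 = cshift K (inord t) :> 'I_k.
    by apply: val_inj; rewrite permE /= (inordK tk) modn_small ?inordK ?ltnS //; exact: ltn_ord.
  by rewrite (cnt_gt0 (fun t => (u (cshift K t), v t))) orbT.
by rewrite (cnt_gt0 (fun t => (u t, v t))).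
Qed.

Lemma card_first_occ_fixed (C : finType) (u : 'I_k -> C) :
  #|[set t | first_occ u t == t]| =
  (\sum_(t < k) (occ_fun (first_occ u) t == t))%N.
Proof.
rewrite -sum1_card big_mkcond; apply: eq_bigr => t _.
by rewrite inE /occ_fun inord_val; case: eqP => [->|e]; [rewrite eqxx|case: eqP => // /val_inj].
Qed.

(** The exploration tree gives [#|I|] times a factor [k] per new letter other than the first row.
    With one more factor [k] for that row, the powers of [k] are at most the number of pairs of
    words over [2 k] letters having these patterns; hence the correction [#|I| / k]. *)
Lemma sum_walk_mask_le (a b : {ffun 'I_k -> 'I_k}) :
  (\sum_(u : {ffun 'I_k -> I} | first_occ u == a)
   \sum_(v : {ffun 'I_k -> J} | first_occ v == b) walk_mask u v) <=
  #|I|%:R / k%:R *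
  (#|[set u : {ffun 'I_k -> 'I_(k + k)} | first_occ u == a]|%:R *
   #|[set v : {ffun 'I_k -> 'I_(k + k)} | first_occ v == b]|%:R).
Proof.
have rhs0 : 0 <= #|I|%:R / k%:R *
  (#|[set u : {ffun 'I_k -> 'I_(k + k)} | first_occ u == a]|%:R *
   #|[set v : {ffun 'I_k -> 'I_(k + k)} | first_occ v == b]|%:R) :> R.
  by rewrite !mulr_ge0.
have [/existsP[u0 /eqP ea]|/existsPn na] := boolP [exists u : {ffun 'I_k -> I}, first_occ u == a]; last first.
  by rewrite big_pred0 // => u; apply/negbTE.
have [/existsP[v0 /eqP eb]|/existsPn nb] := boolP [exists v : {ffun 'I_k -> J}, first_occ v == b]; last first.
  by rewrite big1 // => u _; rewrite big_pred0 // => v; apply/negbTE.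
pose W := tree_weight q (occ_fun a) (occ_fun b) (n := K).
have W0 (u : {ffun 'I_k -> I}) (v : {ffun 'I_k -> J}) : 0 <= W u v.
  by rewrite /W /tree_weight !mulr_ge0 // prodr_ge0.
apply: (@le_trans _ _ (\sum_(u : {ffun 'I_k -> I}) \sum_(v : {ffun 'I_k -> J}) W u v)).
  rewrite big_mkcond; apply: ler_sum => u _; case: eqP => [eu|_]; last exact: sumr_ge0.
  rewrite big_mkcond; apply: ler_sum => v _; case: eqP => [ev|_] //.
  by rewrite /W -eu -ev; exact: walk_mask_le.
have la t : (occ_fun a t <= t)%N by rewrite -ea; exact: occ_fun_le.
have lb t : (occ_fun b t <= t)%N by rewrite -eb; exact: occ_fun_le.
apply: le_trans (sum_tree_weight q_ge0 q_row q_col la lb K (ler0n _ _)) _.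
have -> : (#|I|%:R * k%:R ^+ (\sum_(t < K) (occ_fun a t.+1 == t.+1) +
      \sum_(t < k) (occ_fun b t == t)) : R) =
    #|I|%:R / k%:R * ((k ^ #|[set t | first_occ u0 t == t]|)%N%:R *
      (k ^ #|[set t | first_occ v0 t == t]|)%N%:R).
  rewrite !card_first_occ_fixed ea eb [in RHS]big_ord_recl /=.
  have -> : occ_fun a 0 = 0%N by apply/eqP; rewrite -leqn0.
  by rewrite !natrX exprD exprS; field; rewrite addrC natr1 pnatr_eq0.
rewrite ler_wpM2l ?divr_ge0 // -!natrM ler_nat -ea -eb.
by rewrite leq_mul // card_first_occ.
Qed.

Lemma masked_walk_sum_le :
  \sum_(u : {ffun 'I_k -> I}) \sum_(v : {ffun 'I_k -> J})
    walk_weight u v * walk_mask u v <=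
  #|I|%:R / k%:R * closed_walk_sum 'I_(k + k) 'I_(k + k) K mu.
Proof.
rewrite (partition_big (fun u : {ffun 'I_k -> I} => first_occ u) xpredT) //=.
rewrite /closed_walk_sum (partition_big (fun u : {ffun 'I_k -> 'I_(k + k)} => first_occ u) xpredT) //=.
rewrite mulr_sumr; apply: ler_sum => a _.
rewrite (eq_bigr (fun u : {ffun 'I_k -> I} => \sum_b
  \sum_(v : {ffun 'I_k -> J} | first_occ v == b) walk_weight u v * walk_mask u v)); last first.
  by move=> u _; rewrite (partition_big (fun v : {ffun 'I_k -> J} => first_occ v) xpredT).
rewrite [X in _ <= _ * X](eq_bigr (fun u : {ffun 'I_k -> 'I_(k + k)} => \sum_b
  \sum_(v : {ffun 'I_k -> 'I_(k + k)} | first_occ v == b) walk_weight u v)); last first.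
  by move=> u _; rewrite (partition_big (fun v : {ffun 'I_k -> 'I_(k + k)} => first_occ v) xpredT).
rewrite exchange_big [X in _ <= _ * X]exchange_big mulr_sumr /=; apply: ler_sum => b _.
have -> : \sum_(u : {ffun 'I_k -> 'I_(k + k)} | first_occ u == a)
    \sum_(v : {ffun 'I_k -> 'I_(k + k)} | first_occ v == b) walk_weight u v =
  (#|[set u : {ffun 'I_k -> 'I_(k + k)} | first_occ u == a]|%:R *
   #|[set v : {ffun 'I_k -> 'I_(k + k)} | first_occ v == b]|%:R) * walk_weight a b.
  rewrite -!sum1dep_card !natr_sum -mulrA mulr_suml; apply: eq_bigr => u /eqP eu.
  rewrite mul1r mulr_suml; apply: eq_bigr => v /eqP ev.
  by rewrite mul1r walk_weight_first_occ eu ev.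
have -> : \sum_(u : {ffun 'I_k -> I} | first_occ u == a)
    \sum_(v : {ffun 'I_k -> J} | first_occ v == b) walk_weight u v * walk_mask u v =
  (\sum_(u : {ffun 'I_k -> I} | first_occ u == a)
   \sum_(v : {ffun 'I_k -> J} | first_occ v == b) walk_mask u v) * walk_weight a b.
  rewrite mulr_suml; apply: eq_bigr => u /eqP eu.
  rewrite mulr_suml; apply: eq_bigr => v /eqP ev.
  by rewrite walk_weight_first_occ eu ev mulrC.
rewrite mulrA; apply: ler_wpM2r; last exact: sum_walk_mask_le.
by rewrite /walk_weight cell_weight_ge0.
Qed.

Lemma binomial_le_exp2 n m : ('C(n, m) <= 2 ^ n)%N.
Proof.
have [mn|nm] := leqP m n; last by rewrite bin_small.
rewrite -[2%N]/(1 + 1)%N expnDn.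
rewrite (eq_bigr (fun i : 'I_n.+1 => 'C(n, i))) => [|i _]; last by rewrite !exp1n !muln1.
by rewrite (bigD1 (Ordinal (mn : (m < n.+1)%N))) //= leq_addr.
Qed.

(** The base 256 is [4 * 2^3 * 2^3]: 4 comes from the central binomial coefficient, and each [2^3]
    from the contents of words of length [k] over [2 k] letters. *)
Lemma masked_walk_sum_le_exp (th : R) : 0 < th ->
  (forall y, 0 <= y ->
    \sum_(m < (k + k).+1) mu m * y ^+ m / m`!%:R <= expR (th * y ^+ 2)) ->
  \sum_(u : {ffun 'I_k -> I}) \sum_(v : {ffun 'I_k -> J})
    walk_weight u v * walk_mask u v <=
  #|I|%:R * (256 * th * k%:R * expR 1) ^+ k.
Proof.
move=> th0 egf; apply: le_trans masked_walk_sum_le _.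
have k0 : 0 < k%:R :> R by rewrite ltr0n.
rewrite -mulrA ler_wpM2l // mulrC ler_pdivrMr //.
apply: le_trans (closed_walk_sum_le _ _ mu_ge0 th0 egf) _.
rewrite !card_ord.
have -> : (256 * th * k%:R * expR 1) ^+ k * k%:R =
  k%:R * 4 ^+ k * 2 ^+ (k + (k + k)) * 2 ^+ (k + (k + k)) * ((th * k%:R) ^+ k * expR k%:R).
  have -> : expR k%:R = expR 1 ^+ k :> R by rewrite -expRM_natl mulr1.
  rewrite mulrC -exprMn -!mulrA; congr (_ * _).
  rewrite addnn -mul2n -mulSn !exprM -!exprMn; congr (_ ^+ _); ring.
apply: ler_wpM2r; first by rewrite mulr_ge0 ?expR_ge0 ?exprn_ge0 // mulr_ge0 // ltW.
do 2 (apply: ler_wpM2r; first by rewrite exprn_ge0).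
rewrite ler_pM2l // ler_pdivrMr ?exprn_gt0 ?ltr0n ?fact_gt0 //.
have := bin_fact (leq_addl k k); rewrite addnK => <-.
rewrite -!natrX -natrM ler_nat mulnn leq_mul2r.
apply/orP; right; apply: leq_trans (binomial_le_exp2 _ _) _.
by rewrite addnn -mul2n expnM.
Qed.

End Comparison.

(** * Frobenius and operator norms *)

Section Frobenius.
Variable R : realType.

Lemma innerE m n (X Y : 'M[R]_(m, n)) : inner X Y = \sum_i \sum_j X i j * Y i j.
Proof.
rewrite /inner /mxtrace exchange_big; apply: eq_bigr => j _.
by rewrite mxE; apply: eq_bigr => i _; rewrite mxE.
Qed.

Lemma innerC m n (X Y : 'M[R]_(m, n)) : inner X Y = inner Y X.
Proof. by rewrite !innerE; do 2 (apply: eq_bigr => ? _); rewrite mulrC. Qed.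

Lemma innerDr m n (X Y Z : 'M[R]_(m, n)) : inner X (Y + Z) = inner X Y + inner X Z.
Proof. by rewrite /inner mulmxDr mxtraceD. Qed.

Lemma innerZr m n a (X Y : 'M[R]_(m, n)) : inner X (a *: Y) = a * inner X Y.
Proof. by rewrite /inner -scalemxAr mxtraceZ. Qed.

Lemma innerNr m n (X Y : 'M[R]_(m, n)) : inner X (- Y) = - inner X Y.
Proof. by rewrite -scaleN1r innerZr mulN1r. Qed.

Lemma innerDl m n (X Y Z : 'M[R]_(m, n)) : inner (X + Y) Z = inner X Z + inner Y Z.
Proof. by rewrite innerC innerDr !(innerC Z). Qed.

Lemma innerZl m n a (X Y : 'M[R]_(m, n)) : inner (a *: X) Y = a * inner X Y.
Proof. by rewrite innerC innerZr innerC. Qed.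

Lemma innerNl m n (X Y : 'M[R]_(m, n)) : inner (- X) Y = - inner X Y.
Proof. by rewrite innerC innerNr innerC. Qed.

Lemma innerBr m n (X Y Z : 'M[R]_(m, n)) : inner X (Y - Z) = inner X Y - inner X Z.
Proof. by rewrite innerDr innerNr. Qed.

Lemma innerBl m n (X Y Z : 'M[R]_(m, n)) : inner (X - Y) Z = inner X Z - inner Y Z.
Proof. by rewrite innerDl innerNl. Qed.

Lemma inner_ge0 m n (X : 'M[R]_(m, n)) : 0 <= inner X X.
Proof. by rewrite innerE; do 2 (apply: sumr_ge0 => ? _); rewrite -expr2 sqr_ge0. Qed.

Lemma inner_eq0 m n (X : 'M[R]_(m, n)) : inner X X = 0 -> X = 0.
Proof.
rewrite innerE => /eqP; rewrite psumr_eq0 => [/allP h|i _]; last first.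
  by apply: sumr_ge0 => ? _; rewrite -expr2 sqr_ge0.
apply/matrixP => i j; have /implyP/(_ isT) := h i (mem_index_enum i).
rewrite psumr_eq0 => [/allP/(_ j (mem_index_enum j))|? _]; last by rewrite -expr2 sqr_ge0.
by rewrite -expr2 sqrf_eq0 mxE => /eqP.
Qed.

Lemma inner_CS m n (X Y : 'M[R]_(m, n)) : inner X Y ^+ 2 <= inner X X * inner Y Y.
Proof.
have [/inner_eq0 ->|y0] := eqVneq (inner Y Y) 0.
  by rewrite -(scale0r Y) !innerZr !mul0r mulr0 expr0n.
have yp : 0 < inner Y Y by rewrite lt_def y0 inner_ge0.
have := inner_ge0 (inner Y Y *: X - inner X Y *: Y).
rewrite !innerBl !innerBr !innerZl !innerZr (innerC Y X) => h.
rewrite -subr_ge0 -(pmulr_rge0 _ yp); apply: le_trans h _.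
by rewrite le_eqVlt; apply/orP; left; apply/eqP; ring.
Qed.

Lemma frob_ge0 m n (X : 'M[R]_(m, n)) : 0 <= frob X.
Proof. exact: sqrtr_ge0. Qed.

Lemma frob_sqr m n (X : 'M[R]_(m, n)) : frob X ^+ 2 = inner X X.
Proof. by rewrite sqr_sqrtr // inner_ge0. Qed.

Lemma inner_le_frob m n (X Y : 'M[R]_(m, n)) : inner X Y <= frob X * frob Y.
Proof.
apply: le_trans (ler_norm _) _; rewrite -(@ler_pXn2r _ 2) // ?nnegrE ?mulr_ge0 ?frob_ge0 //.
by rewrite -normrX ger0_norm ?sqr_ge0 // exprMn !frob_sqr inner_CS.
Qed.

Lemma frobD m n (X Y : 'M[R]_(m, n)) : frob (X + Y) <= frob X + frob Y.
Proof.
rewrite -(@ler_pXn2r _ 2) ?nnegrE ?addr_ge0 ?frob_ge0 //.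
rewrite frob_sqr innerDl !innerDr (innerC Y X) sqrrD !frob_sqr.
have := inner_le_frob X Y; lra.
Qed.

Lemma frobZ m n a (X : 'M[R]_(m, n)) : frob (a *: X) = `|a| * frob X.
Proof.
by rewrite /frob innerZl innerZr mulrA -expr2 sqrtrM ?sqr_ge0 // sqrtr_sqr.
Qed.

Lemma frobN m n (X : 'M[R]_(m, n)) : frob (- X) = frob X.
Proof. by rewrite -scaleN1r frobZ normrN1 mul1r. Qed.

Lemma frobB m n (X Y : 'M[R]_(m, n)) : frob (X - Y) <= frob X + frob Y.
Proof. by rewrite -(frobN Y) frobD. Qed.

Lemma frob_distC m n (X Y : 'M[R]_(m, n)) : frob (X - Y) = frob (Y - X).
Proof. by rewrite -frobN opprB. Qed.

Lemma inner_trmx m n (X Y : 'M[R]_(m, n)) : inner X^T Y^T = inner X Y.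
Proof.
rewrite !innerE exchange_big; do 2 (apply: eq_bigr => ? _); by rewrite !mxE.
Qed.

Lemma inner_mull m n p (A : 'M[R]_(m, n)) (X : 'M[R]_(n, p)) (Y : 'M[R]_(m, p)) :
  inner (A *m X) Y = inner X (A^T *m Y).
Proof. by rewrite /inner trmx_mul mulmxA. Qed.

Lemma inner_mulr m n p (A : 'M[R]_(m, n)) (X : 'M[R]_(n, p)) (Y : 'M[R]_(m, p)) :
  inner Y (A *m X) = inner (A^T *m Y) X.
Proof. by rewrite innerC inner_mull innerC. Qed.

Lemma inner_row m n (X Y : 'M[R]_(m, n)) :
  inner X Y = \sum_i inner (row i X) (row i Y).
Proof.
rewrite innerE; apply: eq_bigr => i _.
by rewrite innerE big_ord1; apply: eq_bigr => j _; rewrite !mxE.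
Qed.

Lemma inner_col m n (X Y : 'M[R]_(m, n)) :
  inner X Y = \sum_j inner (col j X) (col j Y).
Proof.
rewrite -inner_trmx inner_row; apply: eq_bigr => j _.
by rewrite -!tr_col inner_trmx.
Qed.

Lemma frob_mulmx m n p (A : 'M[R]_(m, n)) (B : 'M[R]_(n, p)) :
  inner (A *m B) (A *m B) <= inner A A * inner B B.
Proof.
rewrite inner_row (inner_row A) mulr_suml; apply: ler_sum => i _.
rewrite inner_col (inner_col B) mulr_sumr; apply: ler_sum => j _.
have sc (u : 'rV[R]_n) (v : 'cV[R]_n) : inner (u *m v) (u *m v) = inner u^T v ^+ 2.
  by rewrite innerE !big_ord1 -expr2 /inner trmxK /mxtrace big_ord1.
have -> : col j (row i (A *m B)) = row i A *m col j B.
  by rewrite row_mul -[LHS]/(col j _) colE -mulmxA -colE.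
by rewrite sc -[X in _ <= X * _]inner_trmx inner_CS.
Qed.

Lemma inner_orthL m p (Q : 'M[R]_m) (X Y : 'M[R]_(m, p)) :
  Q^T *m Q = 1%:M -> inner (Q *m X) (Q *m Y) = inner X Y.
Proof. by move=> e; rewrite inner_mull mulmxA e mul1mx. Qed.

Lemma inner_orthR m p (Q : 'M[R]_p) (X Y : 'M[R]_(m, p)) :
  Q^T *m Q = 1%:M -> inner (X *m Q) (Y *m Q) = inner X Y.
Proof.
move=> /mulmx1C e; rewrite -inner_trmx !trmx_mul inner_orthL ?inner_trmx //.
by rewrite trmxK.
Qed.

End Frobenius.

(** * Traces of powers as walk sums, and the norm bound they yield *)

Section TraceWalks.
Variable R : comNzRingType.

Lemma expmx_walk n (B : 'M[R]_n) K i j :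
  (B ^+ K.+1) i j = \sum_(u : {ffun 'I_K.+1 -> 'I_n})
    (u ord0 == i)%:R * \prod_(t < K) B (u (inord t)) (u (inord t.+1)) * B (u ord_max) j.
Proof.
elim: K j => [|K IH] j.
  rewrite expr1 (bigD1 [ffun=> i]) //= big_ord0 !ffunE eqxx !mul1r big1 ?addr0 // => u ui.
  case: eqP => [e|]; last by rewrite !mul0r.
  by case/eqP: ui; apply/ffunP => t; rewrite ffunE -e (ord1 t).
rewrite exprSr -[LHS]/((_ *m _) i j) mxE sum_ffrcons exchange_big; apply: eq_bigr => l _ /=.
rewrite IH mulr_suml; apply: eq_bigr => u _.
rewrite ffrcons_max big_ord_recr /= ffrcons_inordT ffrcons_inord //.
have -> : inord K = ord_max :> 'I_K.+1 by apply: val_inj; rewrite /= inordK.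
have -> : ord0 = inord 0 :> 'I_K.+2 by apply: val_inj; rewrite /= inordK.
rewrite ffrcons_inord // (_ : inord 0 = ord0); last by apply: val_inj; rewrite /= inordK.
rewrite !mulrA; do 2 congr (_ * _); congr (_ * _).
by apply: eq_bigr => t _; rewrite !ffrcons_inord // ltnS // ltnW.
Qed.

Lemma mxtrace_expmx_walk n (B : 'M[R]_n) K :
  \tr (B ^+ K.+1) = \sum_(u : {ffun 'I_K.+1 -> 'I_n}) \prod_t B (u t) (u (cshift K t)).
Proof.
rewrite /mxtrace; under eq_bigr do rewrite expmx_walk.
rewrite exchange_big; apply: eq_bigr => u _ /=.
rewrite (bigD1 (u ord0)) //= eqxx mul1r [X in _ + X]big1 ?addr0; last first.
  by move=> i; rewrite eq_sym => /negbTE ->; rewrite !mul0r.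
rewrite big_ord_recr /=; congr (_ * B _ (u _)).
  apply: eq_bigr => t _; congr (B (u _) (u _)); apply: val_inj => /=.
    by rewrite inordK // leqW.
  by rewrite permE /= inordK ?ltnS // modn_small // ltnS.
by apply: val_inj; rewrite permE /= modnn.
Qed.

Lemma mxtrace_gram_walk m n (A : 'M[R]_(m, n)) K :
  \tr ((A *m A^T) ^+ K.+1) =
  \sum_(u : {ffun 'I_K.+1 -> 'I_m}) \sum_(v : {ffun 'I_K.+1 -> 'I_n})
    \prod_t (A (u t) (v t) * A (u (cshift K t)) (v t)).
Proof.
rewrite mxtrace_expmx_walk; apply: eq_bigr => u _.
rewrite -(bigA_distr_bigA (fun t j => A (u t) j * A (u (cshift K t)) j)).
apply: eq_bigr => t _; rewrite mxE; apply: eq_bigr => j _; by rewrite mxE.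
Qed.

End TraceWalks.

Section OperatorBound.
Variable R : realType.

(** An upper bound on the operator norm. It is stated for [Y] of any width because it is applied to
    stacks of blocks; the squared Frobenius norm adds up over columns, so vectors suffice to prove
    it. *)
Definition opbound m n (A : 'M[R]_(m, n)) (t : R) :=
  forall p (Y : 'M[R]_(n, p)), frob (A *m Y) <= t * frob Y.

Lemma opbound_sqr m n (A : 'M[R]_(m, n)) t : 0 <= t ->
  (forall x : 'cV[R]_n, inner (A *m x) (A *m x) <= t ^+ 2 * inner x x) -> opbound A t.
Proof.
move=> t0 h p Y; rewrite -(@ler_pXn2r _ 2) ?nnegrE ?mulr_ge0 ?frob_ge0 //.
rewrite exprMn !frob_sqr inner_col (inner_col Y) mulr_sumr; apply: ler_sum => j _.
by rewrite !colE -mulmxA -!colE.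
Qed.

Lemma opboundT m n (A : 'M[R]_(m, n)) t : 0 <= t -> opbound A t -> opbound A^T t.
Proof.
move=> t0 h p Y.
have : frob (A^T *m Y) ^+ 2 <= t * frob Y * frob (A^T *m Y).
  rewrite frob_sqr inner_mull trmxK; apply: le_trans (inner_le_frob _ _) _.
  by rewrite mulrC mulrAC ler_wpM2r ?frob_ge0.
have [->|n0] := eqVneq (frob (A^T *m Y)) 0; first by rewrite mulr_ge0 ?frob_ge0.
by rewrite expr2 ler_pM2r // lt_def n0 frob_ge0.
Qed.

Lemma opboundD m n (A B : 'M[R]_(m, n)) a b :
  opbound A a -> opbound B b -> opbound (A + B) (a + b).
Proof.
move=> ha hb p Y; rewrite mulmxDl mulrDl; apply: le_trans (frobD _ _) _.
by rewrite lerD.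
Qed.

(** Repeated squaring keeps a power in Gram form, hence symmetric and positive semidefinite. This
    takes the place of the spectral theorem and is the reason for moment orders that are powers of
    two. *)
Lemma gram_exp2 m n (A : 'M[R]_(m, n)) j :
  exists p (U : 'M[R]_(m, p)), (A *m A^T) ^+ (2 ^ j) = U *m U^T.
Proof.
elim: j => [|j [p [U e]]]; first by exists n, A; rewrite expr1.
exists m, (U *m U^T); rewrite trmx_mul trmxK expnS mulnC exprM e.
by rewrite expr2.
Qed.

Lemma opbound_trace m n (A : 'M[R]_(m, n)) j t : 0 <= t ->
  \tr ((A *m A^T) ^+ (2 ^ j)) <= t ^+ (2 * 2 ^ j) -> opbound A t.
Proof.
move=> t0 ht; rewrite -[A]trmxK; apply: opboundT => //; apply: opbound_sqr => // x.
have psd i : 0 <= inner x ((A *m A^T) ^+ (2 ^ i) *m x).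
  have [p [U ->]] := gram_exp2 A i.
  by rewrite -mulmxA inner_mulr inner_ge0.
(* Repeated Cauchy-Schwarz: with [B = A *m A^T], the Rayleigh quotient of [B] raised to [2 ^ i] is
   at most that of [B ^+ (2 ^ i)], here with denominators cleared. *)
have H i : inner x (A *m A^T *m x) ^+ (2 ^ i) * inner x x <=
    inner x x ^+ (2 ^ i) * inner x ((A *m A^T) ^+ (2 ^ i) *m x).
  elim: i => [|i IH]; first by rewrite !expr1 mulrC.
  have [x0|x0] := eqVneq (inner x x) 0.
    by rewrite x0 mulr0 mulr_ge0 // expr0n.
  have xp : 0 < inner x x by rewrite lt_def x0 inner_ge0.
  rewrite -(ler_pM2r xp) expnS mulnC !exprM -mulrA -expr2 -exprMn.
  have a0 : 0 <= inner x (A *m A^T *m x) by have := psd 0%N; rewrite expr1.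
  apply: (@le_trans _ _ ((inner x x ^+ (2 ^ i) *
       inner x ((A *m A^T) ^+ (2 ^ i) *m x)) ^+ 2)).
    by rewrite ler_pXn2r ?nnegrE ?mulr_ge0 ?exprn_ge0 ?inner_ge0 ?psd.
  rewrite exprMn -[leRHS]mulrA ler_wpM2l ?exprn_ge0 ?inner_ge0 //.
  apply: le_trans (inner_CS _ _) _; rewrite mulrC ler_wpM2r ?inner_ge0 //.
  set S := (A *m A^T) ^+ (2 ^ i).
  have ST : S^T = S.
    by have [p [U e]] := gram_exp2 A i; rewrite /S e trmx_mul trmxK.
  by rewrite inner_mull ST mulmxA expr2.
have [x0|x0] := eqVneq (inner x x) 0.
  by rewrite (inner_eq0 x0) mulmx0 -(scale0r (0 : 'cV_n)) -(scale0r (0 : 'cV_m)) !innerZr !mul0r mulr0.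
have xp : 0 < inner x x by rewrite lt_def x0 inner_ge0.
have last : inner x ((A *m A^T) ^+ (2 ^ j) *m x) <= t ^+ (2 * 2 ^ j) * inner x x.
  have [p [U e]] := gram_exp2 A j; rewrite e in ht *.
  rewrite -mulmxA inner_mulr; apply: le_trans (frob_mulmx _ _) _.
  rewrite ler_wpM2r ?inner_ge0 //; apply: le_trans ht.
  by rewrite /inner trmxK.
have a0 : 0 <= inner x (A *m A^T *m x) by have := psd 0%N; rewrite expr1.
have : inner x (A *m A^T *m x) ^+ (2 ^ j) <= (t ^+ 2 * inner x x) ^+ (2 ^ j).
  rewrite -(ler_pM2r xp); apply: le_trans (H j) _.
  apply: le_trans (ler_wpM2l (exprn_ge0 _ (ltW xp)) last) _.
  by rewrite exprMn -exprM le_eqVlt mulrA [X in X * _]mulrC eqxx.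
rewrite ler_pXn2r ?expn_gt0 ?nnegrE ?mulr_ge0 ?sqr_ge0 ?inner_ge0 // => h.
by rewrite inner_mull trmxK mulmxA.
Qed.

End OperatorBound.

Local Open Scope classical_set_scope.

(** * Error of the estimator for a given perturbation *)

Section Blocks.
Variables (R : realType) (n d : nat).
Implicit Types Y Z : blockcol R n d.

Lemma trmx_mul_block m k (X : 'M[R]_(\sum_(i < n) d, m)) (X' : 'M[R]_(\sum_(i < n) d, k)) :
  X^T *m X' = \sum_i (block X i)^T *m block X' i.
Proof.
by rewrite -{1}(submxcolK X) -{1}(submxcolK X') tr_mxcol mul_mxrow_mxcol.
Qed.

Lemma inner_block m (X X' : 'M[R]_(\sum_(i < n) d, m)) :
  inner X X' = \sum_i inner (block X i) (block X' i).
Proof. by rewrite /inner trmx_mul_block raddf_sum. Qed.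

Lemma inner_Gn (G : set 'M[R]_d) Y :
  G `<=` @Orth R d -> in_Gn G Y -> inner Y Y = n%:R * d%:R.
Proof.
move=> GO hY; rewrite inner_block (eq_bigr (fun=> d%:R)) => [|i _].
  by rewrite sumr_const card_ord mulr_natl.
by rewrite /inner (GO _ (hY i)) mxtrace1.
Qed.

Lemma convex_mean (M : lmodType R) (A : set (convex_lmodType M)) m (x : 'I_m.+1 -> M) :
  convex_set A -> (forall i, A (x i)) -> A ((m.+1%:R)^-1 *: \sum_i x i).
Proof.
move=> cA; elim: m x => [|m IH] x Ax; first by rewrite big_ord1 invr1 scale1r.
have l0 : 0 <= m.+1%:R / m.+2%:R :> R by rewrite divr_ge0.
have l1 : m.+1%:R / m.+2%:R <= 1 :> R by rewrite ler_pdivrMr // mul1r ler_nat.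
have /set_mem := cA _ _ (Itv01 l0 l1) (mem_set (IH _ (fun i => Ax (lift ord_max i))))
   (mem_set (Ax ord_max)).
rewrite /conv /= => h; rewrite big_ord_recr /= scalerDr.
suff -> : (m.+2%:R^-1 *: \sum_(i < m.+1) x (widen_ord (leqnSn m.+1) i) +
   m.+2%:R^-1 *: x ord_max) = (m.+1%:R / m.+2%:R) *:
    ((m.+1%:R)^-1 *: (\sum_i x (lift ord_max i) : M)) + (1 - m.+1%:R / m.+2%:R) *: x ord_max by [].
rewrite scalerA mulrAC divff ?pnatr_eq0 // mul1r; congr (_ *: _ + _ *: _).
  apply: eq_bigr => i _; congr x; apply: val_inj => /=.
  by rewrite /bump leqNgt ltn_ord.
have m2 : m.+2%:R != 0 :> R by rewrite pnatr_eq0.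
move: m2; rewrite -(natr1 m.+1); move: (m.+1%:R : R) => a a1.
by field.
Qed.

End Blocks.

Lemma opnorm_le (R : realType) m k (A : 'M[R]_(m, k)) t : 0 <= t -> opbound A t -> opnorm A <= t.
Proof.
move=> t0 h; apply: ge_sup.
  exists (frob (A *m (0 : 'cV_k))); exists 0 => //=.
  by rewrite /frob /inner mulmx0 mxtrace0 sqrtr0.
move=> _ [x /= x1 <-]; apply: le_trans (h _ x) _.
by rewrite -[leRHS]mulr1 ler_wpM2l.
Qed.

Section Deterministic.
Variables (R : realType) (n d : nat).
Hypothesis hn : (0 < n)%N.
Variables (G : set 'M[R]_d) (Pi : 'M[R]_d -> 'M[R]_d) (alpha beta : R).
Hypotheses (hG : closed_subgroup_Orth G) (hPi : forall X, is_proj G X (Pi X)).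
Hypotheses (ha : 1 <= alpha) (hb : 0 < beta <= 1).
Hypothesis heb : error_bound_conv G Pi alpha beta.
Variables (Gstar : blockcol R n d) (C : blocksq R n d) (p b : R).
Implicit Types (Y Z W H : blockcol R n d) (Q : 'M[R]_d).
Hypothesis hGs : in_Gn G Gstar.
Hypothesis hp : 0 < p.
Let Delta := C - p *: (Gstar *m Gstar^T).
Hypothesis hD : opbound Delta b.

Let GO : G `<=` @Orth R d. Proof. by case: hG. Qed.
Let n0 : 0 < n%:R :> R. Proof. by rewrite ltr0n. Qed.

Let GV Q : G Q -> G Q^T.
Proof.
move=> GQ; have e : Q^T *m Q = 1%:M := GO GQ.
have uQ : Q \in unitmx by case: (mulmx1_unit e).
have -> : Q^T = invmx Q by rewrite -[Q^T]mulmx1 -(mulmxV uQ) mulmxA e mul1mx.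
by case: hG => _ _ _ _; exact.
Qed.

Let GM Q Q' : G Q -> G Q' -> G (Q *m Q').
Proof. by case: hG => _ _ _ h _; exact: h. Qed.

Let in_GnM Y Q : in_Gn G Y -> G Q -> in_Gn G (Y *m Q).
Proof. by move=> hY GQ i; rewrite -submxcol_mul; exact: GM. Qed.

Let frob_Gn Y : in_Gn G Y -> frob Y = Num.sqrt (n%:R * d%:R).
Proof. by move=> hY; rewrite /frob (inner_Gn GO hY). Qed.

(* The minimiser of the distance to elements of fixed norm does not change when
   the projected matrix is rescaled. *)
Lemma projn_near Y Z W (c : R) : 0 <= c -> is_projn G Y Z -> in_Gn G W ->
  frob (Z - W) <= 2 * frob (c *: Y - W).
Proof.
move=> c0 pZ hW.
have hZ : in_Gn G Z by move=> i; case: (pZ i).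
have le : inner Y W <= inner Y Z.
  rewrite !inner_block; apply: ler_sum => i _; have [_ /(_ _ (hW i)) h] := pZ i.
  have eO Q : G Q -> inner Q Q = d%:R by move=> GQ; rewrite /inner (GO GQ) mxtrace1.
  have : frob (block Y i - block Z i) ^+ 2 <= frob (block Y i - block W i) ^+ 2.
    by rewrite ler_pXn2r ?nnegrE ?frob_ge0.
  rewrite !frob_sqr.
  rewrite !innerBl !innerBr (eO _ (hW i)) (eO _ (hZ i)).
  rewrite (innerC (block Z i)) (innerC (block W i)); lra.
have le2 : frob (c *: Y - Z) <= frob (c *: Y - W).
  rewrite -(@ler_pXn2r _ 2) ?nnegrE ?frob_ge0 // !frob_sqr !innerBl !innerBr.
  rewrite (inner_Gn GO hZ) (inner_Gn GO hW) (innerC Z) (innerC W) !innerZl.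
  have := ler_wpM2l c0 le; lra.
have -> : Z - W = (c *: Y - W) - (c *: Y - Z) by rewrite opprB addrC -addrA addrCA subrK addrC addrNK || (apply/matrixP => i j; rewrite !mxE; ring).
apply: le_trans (frobB _ _) _; lra.
Qed.

Lemma psi_expand Y : inner (C *m Y) Y =
  p * frob (Gstar^T *m Y) ^+ 2 + inner (Delta *m Y) Y.
Proof.
rewrite /Delta mulmxBl innerBl -scalemxAl innerZl -mulmxA (inner_mull Gstar) frob_sqr.
by rewrite addrC subrK.
Qed.

Lemma inner_Delta_close Y Z : in_Gn G Y -> in_Gn G Z ->
  inner (Delta *m Y) Y - inner (Delta *m Z) Z <=
  2 * b * Num.sqrt (n%:R * d%:R) * frob (Y - Z).
Proof.
move=> hY hZ.
have -> : inner (Delta *m Y) Y - inner (Delta *m Z) Z =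
    inner (Delta *m (Y - Z)) Y + inner (Delta *m Z) (Y - Z).
  by rewrite mulmxBr innerBl innerBr; ring.
have h1 := inner_le_frob (Delta *m (Y - Z)) Y.
have h2 := inner_le_frob (Delta *m Z) (Y - Z).
have h3 : frob (Delta *m (Y - Z)) * frob Y <= b * frob (Y - Z) * frob Y.
  by rewrite ler_wpM2r ?frob_ge0.
have h4 : frob (Delta *m Z) * frob (Y - Z) <= b * frob Z * frob (Y - Z).
  by rewrite ler_wpM2r ?frob_ge0.
rewrite (frob_Gn hY) in h1 h3; rewrite (frob_Gn hZ) in h4.
move: h1 h2 h3 h4; set s := Num.sqrt _; lra.
Qed.

Let inner_Delta_rot Y Q : G Q -> inner (Delta *m (Y *m Q)) (Y *m Q) = inner (Delta *m Y) Y.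
Proof. by move=> GQ; rewrite mulmxA inner_orthR //; exact: GO. Qed.

Let frob2_diff Y Z : in_Gn G Y -> in_Gn G Z ->
  frob (Y - Z) ^+ 2 = 2 * (n%:R * d%:R) - 2 * inner Y Z.
Proof.
move=> hY hZ; rewrite frob_sqr innerBl !innerBr (inner_Gn GO hY) (inner_Gn GO hZ).
by rewrite (innerC Z); ring.
Qed.

Lemma mean_gram_conv H : in_Gn G H -> Defs.conv G (n%:R^-1 *: (Gstar^T *m H)).
Proof.
move=> hH; rewrite trmx_mul_block => M [cM GM_].
case: n hn Gstar hGs H hH => // m _ Gs hGs' H hH.
apply: (convex_mean cM) => i; apply: GM_; apply: GM => //; exact: GV.
Qed.

(* [dl] is the relative size of the perturbation and [tau] the relative accuracy
   of the best candidate [G0]. *)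
Lemma est_err_maximizer (G0 H : blockcol R n d) (Q' : 'M[R]_d) (dl tau : R) :
  in_Gn G G0 -> in_Gn G H -> G Q' ->
  b * Num.sqrt d%:R = dl * (p * n%:R) ->
  0 <= dl <= beta / (1000 * alpha) ->
  0 <= tau <= Num.sqrt beta / (20 * alpha) ->
  frob (G0 - Gstar *m Q') <= Num.sqrt n%:R * tau ->
  inner (C *m G0) G0 <= inner (C *m H) H ->
  est_err G Gstar H <= Num.sqrt n%:R / (2 * alpha).
Proof.
move=> hG0 hH GQ' hdl /andP[dl0 hdlb] /andP[tau0 htau] h0 hmax.
have a0 : 0 < alpha by apply: lt_le_trans ha.
have /andP[b0 b1] := hb.
pose X := n%:R^-1 *: (Gstar^T *m H).
have [GQ _] := hPi X; set Q := Pi X in GQ *.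
have [_] := heb (mean_gram_conv hH); rewrite -/X -/Q => hX.
set t := \tr (1%:M - X^T *m Q) in hX.
have trE : t = d%:R - inner X Q by rewrite /t raddfB /= mxtrace1.
have sn : Num.sqrt n%:R ^+ 2 = n%:R :> R by rewrite sqr_sqrtr // ltW.
have sn0 : 0 < Num.sqrt n%:R :> R by rewrite sqrtr_gt0.
have hHF : frob (H - Gstar *m Q) ^+ 2 = 2 * n%:R * t.
  rewrite frob2_diff //; last exact: in_GnM.
  rewrite trE /X innerZl inner_mull trmxK; field; exact: lt0r_neq0.
have t0 : 0 <= t.
  by have := sqr_ge0 (frob (H - Gstar *m Q)); rewrite hHF pmulr_rge0 // mulr_gt0.
pose st := Num.sqrt t.
have st0 : 0 <= st := sqrtr_ge0 _.
have st2 : st ^+ 2 = t by rewrite sqr_sqrtr.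
(* [3/2] is a rational bound for the square root of 2. *)
have hHF1 : frob (H - Gstar *m Q) <= Num.sqrt n%:R * (3/2 * st).
  have r0 : 0 <= Num.sqrt n%:R * (3/2 * st) by rewrite mulr_ge0 ?sqrtr_ge0 // mulr_ge0.
  rewrite -(@ler_pXn2r _ 2) ?nnegrE ?frob_ge0 //.
  have := mulr_ge0 (ltW n0) t0; rewrite hHF exprMn sn exprMn st2; lra.
(* The quadratic form of [Delta] takes the same value at [Gstar *m Q] and [Gstar *m Q'], orthogonal
   factors on the right being isometries. The perturbation thus enters only through the distances
   from [H] and [G0] to these two points. *)
have E1 := inner_Delta_close hH (in_GnM hGs GQ).
have E2 := inner_Delta_close (in_GnM hGs GQ') hG0.
rewrite !inner_Delta_rot // in E1 E2.
rewrite !psi_expand in hmax.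
have ssn : Num.sqrt (n%:R * d%:R) = Num.sqrt n%:R * Num.sqrt d%:R :> R.
  by rewrite sqrtrM // ltW.
(* Expanding the square of [Gstar^T *m G0 - n Q'] bounds the norm from below by the inner product
   with [Q'], which is close to its maximal value [n d]. *)
have M0 : n%:R ^+ 2 * (d%:R - tau ^+ 2) <= frob (Gstar^T *m G0) ^+ 2.
  have i1 : n%:R * (d%:R - tau ^+ 2 / 2) <= inner (Gstar^T *m G0) Q'.
    rewrite inner_mull trmxK.
    have := frob2_diff hG0 (in_GnM hGs GQ').
    have : frob (G0 - Gstar *m Q') ^+ 2 <= n%:R * tau ^+ 2.
      by rewrite -sn -exprMn ler_pXn2r ?nnegrE ?frob_ge0 // mulr_ge0 // ltW.
    lra.
  have := inner_ge0 (Gstar^T *m G0 - n%:R *: Q').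
  rewrite innerBl !innerBr !innerZl !innerZr (innerC Q') -!frob_sqr.
  have -> : frob Q' ^+ 2 = d%:R by rewrite frob_sqr /inner (GO GQ') mxtrace1.
  move: i1; set A := inner _ _; set B := frob _ ^+ 2.
  move=> /(ler_wpM2l (ltW n0)); lra.
have XE : frob (Gstar^T *m H) ^+ 2 = n%:R ^+ 2 * frob X ^+ 2.
  by rewrite /X frobZ ger0_norm ?invr_ge0 ?ltW // exprMn mulrA -exprMn divff ?expr1n ?mul1r // lt0r_neq0.
have key : d%:R - tau ^+ 2 - 2 * dl * (3/2 * st + tau) <= frob X ^+ 2.
  rewrite -(ler_pM2l (exprn_gt0 2 n0)) -(ler_pM2l hp).
  have bs : 2 * b * Num.sqrt (n%:R * d%:R) = 2 * dl * (p * n%:R) * Num.sqrt n%:R.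
    transitivity (2 * (b * Num.sqrt d%:R) * Num.sqrt n%:R); first by rewrite ssn; ring.
    by rewrite hdl; ring.
  rewrite bs in E1 E2.
  have c0 : 0 <= 2 * dl * (p * n%:R) * Num.sqrt n%:R.
    by rewrite !mulr_ge0 // ltW.
  have := ler_wpM2l c0 hHF1; have := ler_wpM2l c0 h0.
  rewrite frob_distC in E2.
  have r1 : 2 * dl * (p * n%:R) * Num.sqrt n%:R * (Num.sqrt n%:R * (3/2 * st)) =
      2 * dl * p * n%:R ^+ 2 * (3/2 * st).
    transitivity (2 * dl * p * n%:R * (Num.sqrt n%:R ^+ 2) * (3/2 * st)); first by ring.
    by rewrite sn; ring.
  have r2 : 2 * dl * (p * n%:R) * Num.sqrt n%:R * (Num.sqrt n%:R * tau) =
      2 * dl * p * n%:R ^+ 2 * tau.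
    transitivity (2 * dl * p * n%:R * (Num.sqrt n%:R ^+ 2) * tau); first by ring.
    by rewrite sn; ring.
  rewrite r1 r2 -XE; have := ler_wpM2l (ltW hp) M0; lra.
have bt : beta * t <= tau ^+ 2 + 2 * dl * (3/2 * st + tau) by lra.
(* This threshold makes [3/2 * st] at most [1 / (2 * alpha)]. If it failed, [1 / alpha < 3 * st]
   would turn the bounds on [tau] and [dl] into multiples of [st], and [bt] would bound [beta * t]
   by less than a twentieth of itself. *)
have stb : st <= (3 * alpha)^-1.
  rewrite leNgt; apply/negP => hlt.
  pose sb := Num.sqrt beta.
  have sb0 : 0 < sb by rewrite sqrtr_gt0.
  have sb2 : sb ^+ 2 = beta by rewrite sqr_sqrtr // ltW.
  have sb1 : sb <= 1 by rewrite -sqrtr1 ler_wsqrtr.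
  have ia : alpha^-1 < 3 * st by move: hlt; rewrite invfM; lra.
  have tau1 : tau <= 3/20 * sb * st.
    apply: le_trans htau _; rewrite -/sb invfM.
    have := ler_wpM2l (ltW sb0) (ltW ia); lra.
  have dl1 : dl <= 3/1000 * (sb ^+ 2 * st).
    apply: le_trans hdlb _; rewrite -sb2 invfM.
    have := ler_wpM2l (ltW (exprn_gt0 2 sb0)) (ltW ia); lra.
  have sp : 0 < st by apply: lt_trans hlt; rewrite invr_gt0 mulr_gt0.
  have X1 : tau ^+ 2 <= (3/20 * sb * st) ^+ 2.
    by rewrite ler_pXn2r ?nnegrE // !mulr_ge0 // ltW.
  have X2 : dl * (3/2 * st + tau) <= 3/1000 * (sb ^+ 2 * st) * (3/2 * st + 3/20 * st).
    apply: ler_pM => //; first by rewrite addr_ge0 // mulr_ge0.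
    rewrite lerD2l; apply: le_trans tau1 _; rewrite -mulrA ler_wpM2l //.
    by rewrite -[leRHS]mul1r ler_wpM2r.
  have pos : 0 < sb ^+ 2 * st ^+ 2 by rewrite mulr_gt0 // exprn_gt0.
  move: bt; rewrite -st2 -sb2; nra.
apply: (@le_trans _ _ (frob (H - Gstar *m Q))).
  apply: ge_inf; last by exists Q.
  by exists 0 => _ [? _ <-]; exact: frob_ge0.
apply: le_trans hHF1 _; rewrite ler_pM2l //.
move: stb; rewrite !invfM; lra.
Qed.

End Deterministic.

Section EntropicOutput.
Variables (R : realType) (n d : nat).
Hypothesis hn : (0 < n)%N.
Variables (G : set 'M[R]_d) (Pi : 'M[R]_d -> 'M[R]_d) (alpha beta : R).
Hypotheses (hG : closed_subgroup_Orth G) (hPi : forall X, is_proj G X (Pi X)).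
Hypotheses (ha : 1 <= alpha) (hb : 0 < beta <= 1).
Hypothesis heb : error_bound_conv G Pi alpha beta.
Variables (Gstar : blockcol R n d) (C : blocksq R n d) (p b dl eps : R).
Hypothesis hGs : in_Gn G Gstar.
Hypothesis hp : 0 < p.
Hypothesis b_ge0 : 0 <= b.
Hypothesis hD : opbound (C - p *: (Gstar *m Gstar^T)) b.

Lemma entropic_output_est_err V Qs QQ Ghat :
  b * Num.sqrt d%:R = dl * (p * n%:R) ->
  0 <= dl <= beta / (1000 * alpha) ->
  eps <= Num.sqrt beta / (100 * alpha) ->
  top_eigvecs C V -> is_Qstar p Gstar C V Qs ->
  admissible_cosets G eps Qs QQ -> entropic_spectral_output G C V QQ Ghat ->
  est_err G Gstar Ghat <= Num.sqrt n%:R / (2 * alpha).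
Proof.
move=> hdl hdlb heps [VV _] [Qs_orth hQs] [_ _ [Q0 [Q0_orth QQ0 dist0]]].
case=> PV [Qh] /= [[projPV _] [Qh_orth _] maxi ->].
have GO : G `<=` @Orth R d by case: hG.
have a0 : 0 < alpha by apply: lt_le_trans ha.
have /andP[b0 b1] := hb.
have /andP[dl0 dl1] := hdlb.
have n0 : 0 < n%:R :> R by rewrite ltr0n.
have sb0 : 0 < Num.sqrt beta by rewrite sqrtr_gt0.
have sbb : beta <= Num.sqrt beta.
  rewrite -[X in X <= _](sqr_sqrtr (ltW b0)) expr2 ler_piMr ?sqrtr_ge0 //.
  by rewrite -sqrtr1 ler_wsqrtr.
have sl0 : 0 < Num.sqrt beta / (200 * alpha) by rewrite divr_gt0 // mulr_gt0.
(* [coset_dist] is an infimum, so a representative is chosen up to a small slack. *)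
have [_ [Q' GQ' <-] hQ'] : exists2 e, [set frob (Q0 - Qs *m Q') | Q' in G] e &
    e < coset_dist G Q0 Qs + Num.sqrt beta / (200 * alpha).
  apply: inf_adherent => //; split.
    by exists (frob (Q0 - Qs *m 1%:M)), 1%:M => //; case: hG.
  by exists 0 => _ [? _ <-]; exact: frob_ge0.
(* The summands are the bound on [eps], the slack above and the error of [Qs], for which
   [2 * sqrt 2 <= 3] is used; the factor 2 is lost in projecting. With
   [dl <= sqrt beta / (1000 * alpha)] the total is at most [36/1000 * sqrt beta / alpha]. *)
pose tau := 2 * (Num.sqrt beta / (100 * alpha) + Num.sqrt beta / (200 * alpha) + 3 * dl).
have htau : 0 <= tau <= Num.sqrt beta / (20 * alpha).
  have ia : 0 < alpha^-1 by rewrite invr_gt0.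
  have q0 : 0 < Num.sqrt beta * alpha^-1 by rewrite mulr_gt0.
  have q1 : beta * alpha^-1 <= Num.sqrt beta * alpha^-1 by rewrite ler_pM2r.
  move: dl1; rewrite /tau !invfM => dl1; apply/andP; split; lra.
have hH Q : @Orth R d Q -> in_Gn G (PV Q) by move=> oQ i; case: (projPV _ oQ i).
have close : frob (PV Q0 - Gstar *m Q') <= Num.sqrt n%:R * tau.
  have hW : in_Gn G (Gstar *m Q').
    by move=> i; rewrite -submxcol_mul; case: hG => _ _ _ GM _; exact: GM.
  apply: le_trans (projn_near hG (sqrtr_ge0 n%:R) (projPV _ Q0_orth) hW) _.
  rewrite /tau mulrCA ler_pM2l //.
  have sn : Num.sqrt n%:R != 0 :> R by rewrite sqrtr_eq0 -ltNge.
  have -> : Num.sqrt n%:R *: (V *m Q0) - Gstar *m Q' =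
     Num.sqrt n%:R *: (V *m (Q0 - Qs *m Q') + (V *m Qs - (Num.sqrt n%:R)^-1 *: Gstar) *m Q').
    rewrite mulmxBr mulmxBl !mulmxA addrA subrK scalerBr -scalemxAl scalerA divff //.
    by rewrite scale1r.
  rewrite frobZ ger0_norm ?sqrtr_ge0 // ler_wpM2l ?sqrtr_ge0 //.
  apply: le_trans (frobD _ _) _.
  have -> : frob (V *m (Q0 - Qs *m Q')) = frob (Q0 - Qs *m Q').
    by rewrite /frob inner_mull mulmxA VV mul1mx.
  have -> : frob ((V *m Qs - (Num.sqrt n%:R)^-1 *: Gstar) *m Q') =
      frob (V *m Qs - (Num.sqrt n%:R)^-1 *: Gstar).
    by rewrite /frob inner_orthR //; exact: GO.
  have h1 : frob (V *m Qs - (Num.sqrt n%:R)^-1 *: Gstar) <= 3 * dl.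
    apply: le_trans hQs _; rewrite ler_pdivrMr ?mulr_gt0 //.
    rewrite -[X in _ <= X]mulrA -hdl.
    have s2 : Num.sqrt 2 <= 3/2 :> R.
      rewrite -[leRHS]ger0_norm ?divr_ge0 // -sqrtr_sqr ler_wsqrtr //; lra.
    have sd0 : 0 <= Num.sqrt d%:R :> R by exact: sqrtr_ge0.
    apply: le_trans (ler_wpM2l _ (opnorm_le b_ge0 hD)) _.
      by rewrite mulr_ge0 // sqrtr_ge0.
    rewrite sqrtrM // (_ : 2 * (_ * _) * b = 2 * (b * Num.sqrt d%:R) * Num.sqrt 2); last by ring.
    have := ler_wpM2l (mulr_ge0 b_ge0 sd0) s2; lra.
  have := ltW hQ'; lra.
exact: (est_err_maximizer hn hG hPi ha hb heb hGs hp hD (hH _ Q0_orth)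
  (hH _ Qh_orth) GQ' hdl hdlb htau close (maxi _ Q0_orth QQ0)).
Qed.

End EntropicOutput.

(** * The observation matrix as signal plus noise *)

Section Decomposition.
Variables (R : realType) (n d : nat).
Variables (G : set 'M[R]_d) (Gstar : blockcol R n d) (p : R).
Hypothesis GO : (G `<=` @Orth R d)%classic.
Hypothesis hGs : in_Gn G Gstar.
Variables (w : 'I_n -> 'I_n -> bool) (Theta : 'I_n -> 'I_n -> 'M[R]_d).

Definition centered_adj : 'M[R]_n :=
  \matrix_(i, j) (if (i < j)%N then (w i j)%:R - p else 0).

Definition upper_block (B : 'I_n -> 'I_n -> 'M[R]_d) : blocksq R n d :=
  \mxblock_(i < n, j < n) (if (i < j)%N then B i j else 0).

Definition masked_noise : blocksq R n d :=
  upper_block (fun i j => if w i j then Theta i j else 0).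

Definition signal_part : blocksq R n d :=
  upper_block (fun i j => centered_adj i j *: (block Gstar i *m (block Gstar j)^T)).

Let sub (A : blocksq R n d) i j : 'M[R]_d := @submxblock R n n (fun=> d) (fun=> d) A i j.

Lemma sub_scalar i j : sub 1%:M i j = (i == j)%:R *: 1%:M.
Proof.
apply/matrixP => k l; rewrite !mxE /tagnat.Rank (inj_eq (@tagnat.rank_inj _ _)).
case: (eqVneq i j) => [ij|ne] /=; last by rewrite -tag_eqE /tag_eq /= (negbTE ne) mul0r.
by subst j; rewrite eq_Tagged mul1r.
Qed.

Lemma sub_gram i j : sub (Gstar *m Gstar^T) i j = block Gstar i *m (block Gstar j)^T.
Proof.
by rewrite -{1 2}(submxcolK Gstar) tr_mxcol mul_mxcol_mxrow /sub mxblockK.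
Qed.

Lemma sub_upper B i j : sub (upper_block B) i j = if (i < j)%N then B i j else 0.
Proof. by rewrite /sub /upper_block mxblockK. Qed.

Lemma sub_upperT B i j : sub (upper_block B)^T i j = if (j < i)%N then (B j i)^T else 0.
Proof.
by rewrite /sub /upper_block tr_mxblock mxblockK; case: ifP => // _; rewrite trmx0.
Qed.

(** The middle term comes from the diagonal, where [C] has identity blocks and
    [p *: (Gstar *m Gstar^T)] has [p] times the identity. *)
Lemma obs_mx_decomp :
  obs_mx Gstar w Theta - p *: (Gstar *m Gstar^T) =
  (signal_part + signal_part^T) + (1 - p) *: 1%:M + (masked_noise + masked_noise^T).
Proof.
have GG i : block Gstar i *m (block Gstar i)^T = 1%:M.
  by apply: mulmx1C; exact: GO (hGs i).
have subD A B i j : sub (A + B) i j = sub A i j + sub B i j by apply: submxblockD.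
have subN A i j : sub (- A) i j = - sub A i j by apply: submxblockN.
have subZ c A i j : sub (c *: A) i j = c *: sub A i j by apply/matrixP => k l; rewrite !mxE.
have tZ c (M : 'M[R]_d) : (c *: M)^T = c *: M^T by apply/matrixP => k l; rewrite !mxE.
have tD (M N : 'M[R]_d) : (M + N)^T = M^T + N^T by apply/matrixP => k l; rewrite !mxE.
apply/mxblockP => i j; rewrite -!/(sub _ i j).
rewrite !subD subN !subZ !sub_upper !sub_upperT sub_scalar sub_gram.
have -> : sub (obs_mx Gstar w Theta) i j = obs_block Gstar w Theta i j.
  by rewrite /sub /obs_mx mxblockK.
rewrite /obs_block; case: (ltngtP i j) => [ij|ji|/val_inj ij].
- have -> : (i == j) = false by apply/eqP => e; rewrite e ltnn in ij.
  rewrite scale0r scaler0 !addr0 mxE ij scalerBl.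
  case: (w i j); rewrite /= ?mulr1n ?scale1r ?scale0r ?addr0.
    by rewrite addrAC.
  by [].
- have -> : (i == j) = false by apply/eqP => e; rewrite e ltnn in ji.
  rewrite scale0r scaler0 !add0r addr0 mxE ji tZ trmx_mul trmxK scalerBl.
  case: (w j i); rewrite /= ?mulr1n ?scale1r ?scale0r ?trmx0 ?addr0.
    by rewrite tD trmx_mul trmxK addrAC.
  by [].
- rewrite ij eqxx GG !addr0 add0r scale1r scalerBl scale1r //.
Qed.

(** [signal_part] is [centered_adj] tensored with the identity, between block diagonal matrices made
    of the orthogonal blocks of [Gstar]. Rotating the blocks of [x] and storing them as the rows of
    [Y] leaves [centered_adj *m Y]. *)
Lemma opbound_signal a : 0 <= a -> opbound centered_adj a -> opbound signal_part a.
Proof.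
move=> a0 hA; apply: opbound_sqr => // x.
pose Y : 'M[R]_(n, d) := \matrix_(j, k) ((block Gstar j)^T *m block x j) k ord0.
have rowY j : row j Y = ((block Gstar j)^T *m block x j)^T.
  by apply/matrixP => k l; rewrite !mxE !(ord1 k).
have -> : inner x x = inner Y Y.
  rewrite inner_block inner_row; apply: eq_bigr => j _.
  rewrite rowY inner_trmx inner_orthL // trmxK.
  by apply: mulmx1C; exact: GO (hGs j).
have -> : inner (signal_part *m x) (signal_part *m x) =
    inner (centered_adj *m Y) (centered_adj *m Y).
  rewrite inner_block inner_row; apply: eq_bigr => i _.
  suff -> : block (signal_part *m x) i = block Gstar i *m (row i (centered_adj *m Y))^T.
    by rewrite inner_orthL ?inner_trmx //; exact: GO (hGs i).
  rewrite -{1}(submxcolK x) /signal_part /upper_block mul_mxblock_mxrow mxcolK.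
  rewrite row_mul mulmx_sum_row raddf_sum mulmx_sumr; apply: eq_bigr => j _.
  rewrite [X in _ = _ *m X](_ : _ = row i centered_adj 0 j *: (row j Y)^T); last first.
    by apply/matrixP => k l; rewrite !mxE.
  rewrite rowY trmxK -scalemxAr mulmxA [row i _ _ _]mxE.
  case: ifP => ij; first by rewrite -scalemxAl.
  by rewrite mul0mx [centered_adj i j]mxE ij scale0r.
by rewrite -!frob_sqr -exprMn ler_pXn2r ?nnegrE ?frob_ge0 ?mulr_ge0 ?frob_ge0.
Qed.

Lemma opbound_obs_mx a t : 0 <= a -> 0 <= t -> 0 <= p <= 1 ->
  opbound centered_adj a -> opbound masked_noise t ->
  opbound (obs_mx Gstar w Theta - p *: (Gstar *m Gstar^T)) (a + a + 1 + (t + t)).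
Proof.
move=> a0 t0 /andP[p0 p1] hA hB; rewrite obs_mx_decomp.
have hL := opbound_signal a0 hA.
apply: opboundD; last by apply: opboundD => //; exact: opboundT.
apply: opboundD; first by apply: opboundD => //; exact: opboundT.
move=> m Y; rewrite -scalemxAl mul1mx frobZ mul1r ler_piMl ?frob_ge0 //.
by rewrite ger0_norm ?subr_ge0 // lerBlDr lerDl.
Qed.

End Decomposition.

(** * Expectations of independent products *)

Section IndependentProducts.
Import HBNNSimple.
Context (R : realType) (dsp : measure_display) (T : measurableType dsp)
  (P : probability T R).
Local Open Scope ereal_scope.

(** The factorisation is given for events of [Z] only. It passes to simple functions of [Z] by
    linearity and to [Z] by monotone convergence. *)
Lemma integral_mul_indep_ge0 (g Z : T -> R) :
  measurable_fun [set: T] g -> (forall x, (0 <= g x)%R) ->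
  measurable_fun [set: T] Z -> (forall x, (0 <= Z x)%R) ->
  \int[P]_x (g x)%:E < +oo ->
  (forall B : set R, measurable B ->
    \int[P]_x (g x * \1_(Z @^-1` B) x)%:E = \int[P]_x (g x)%:E * P (Z @^-1` B)) ->
  \int[P]_x (g x * Z x)%:E = \int[P]_x (g x)%:E * \int[P]_x (Z x)%:E.
Proof.
move=> mg g0 mZ Z0 gfin hB.
have gf : \int[P]_x (g x)%:E \is a fin_num.
  by rewrite ge0_fin_numE // integral_ge0 // => x _; rewrite lee_fin.
(* Simple functions increasing to the absolute value are composed with [Z]; on the values of [Z],
   which are nonnegative, the limit is the identity. *)
pose absE (y : R) : \bar R := (`|y|)%:E.
have mabs : measurable_fun [set: R] absE.
  by apply/measurable_EFinP; exact: normr_measurable.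
pose h := nnsfun_approx measurableT mabs.
have hcvg y : EFin \o h ^~ y @ \oo --> absE y.
  by apply: (cvg_nnsfun_approx measurableT mabs) => // ? _; rewrite lee_fin.
have hnd y : {homo (fun n => h n y) : n m / (n <= m)%N >-> (n <= m)%R}.
  move=> n m nm; have /lefP := nd_nnsfun_approx measurableT mabs nm; exact.
have mhZ n : measurable_fun [set: T] (fun x => h n (Z x)).
  by apply: (measurableT_comp (measurable_funPT (h n))).
have step n : \int[P]_x (g x * h n (Z x))%:E =
    \int[P]_x (g x)%:E * \int[P]_x (h n (Z x))%:E.
  have r0 (r : R) : range (h n) r -> (0 <= r)%R by move=> [y _ <-].
  have msub (r : R) : measurable (Z @^-1` (h n @^-1` [set r])).
    by rewrite -[X in measurable X]setTI; apply: mZ => //; exact: measurable_sfunP.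
  have split1 (c : T -> R) : (forall x, (0 <= c x)%R) -> measurable_fun [set: T] c ->
     \int[P]_x (c x * h n (Z x))%:E =
     \sum_(r \in range (h n)) r%:E * \int[P]_x (c x * \1_(Z @^-1` (h n @^-1` [set r])) x)%:E.
    move=> c0 mc.
    transitivity (\int[P]_x (\sum_(r \in range (h n))
        (`|r| * (c x * \1_(Z @^-1` (h n @^-1` [set r])) x))%:E)).
      apply: eq_integral => x _; rewrite [in LHS](fimfunE (h n)) fsumEFin //.
      rewrite mulr_fsumr.
      congr EFin; apply: eq_fsbigr => r; rewrite inE => rr.
      by rewrite ger0_norm ?r0 // mulrCA.
    rewrite ge0_integral_fsum //; last 2 first.
      move=> r; apply/measurable_EFinP; apply: measurable_funM => //.
      by apply: measurable_funM => //; exact: measurable_indic.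
      by move=> r x _; rewrite lee_fin !mulr_ge0.
    apply: eq_fsbigr => r; rewrite inE => rr.
    under eq_integral do rewrite EFinM.
    rewrite ge0_integralZl_EFin //.
    + by rewrite ger0_norm ?r0.
    + by move=> x _; rewrite lee_fin mulr_ge0.
    + by apply/measurable_EFinP; apply: measurable_funM => //; exact: measurable_indic.
  rewrite (split1 g) //.
  have -> : \int[P]_x (h n (Z x))%:E =
    \sum_(r \in range (h n)) r%:E * P (Z @^-1` (h n @^-1` [set r])).
    under eq_integral do rewrite -[h n _]mul1r.
    rewrite (split1 (cst 1%R)) //; apply: eq_fsbigr => r _; congr (_ * _).
    under eq_integral do rewrite mul1r.
    by rewrite integral_indic // setIT.
  rewrite -(fineK gf) ge0_mule_fsumr; last first.
    move=> r; have [rr|rr] := pselect (range (h n) r).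
      by rewrite mule_ge0 // lee_fin r0.
    rewrite (_ : _ @^-1` _ = set0) ?measure0 ?mule0 //.
    rewrite -subset0 => x /= e; apply: rr; exists (Z x) => //.
  apply: eq_fsbigr => r _; rewrite fineK // hB; last exact: measurable_sfunP.
  by rewrite muleCA.
have lim1 : \int[P]_x (g x * h n (Z x))%:E @[n --> \oo] --> \int[P]_x (g x * Z x)%:E.
  have -> : \int[P]_x (g x * Z x)%:E =
      \int[P]_x limn (fun n => (g x * h n (Z x))%:E).
    apply: eq_integral => x _; apply/esym/cvg_lim => //.
    under eq_fun do rewrite EFinM; rewrite EFinM; apply: cvgeZl => //.
    by rewrite -{2}[Z x]ger0_norm //; exact: hcvg.
  apply: cvg_monotone_convergence => //.
  - by move=> n; apply/measurable_EFinP; apply: measurable_funM.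
  - by move=> n x _; rewrite lee_fin mulr_ge0.
  - by move=> x _ n m nm; rewrite lee_fin ler_wpM2l // hnd.
have lim2 : \int[P]_x (h n (Z x))%:E @[n --> \oo] --> \int[P]_x (Z x)%:E.
  have -> : \int[P]_x (Z x)%:E = \int[P]_x limn (fun n => (h n (Z x))%:E).
    apply: eq_integral => x _; apply/esym/cvg_lim => //.
    by rewrite -{2}[Z x]ger0_norm //; exact: hcvg.
  apply: cvg_monotone_convergence => //.
  - by move=> n; apply/measurable_EFinP.
  - by move=> n x _; rewrite lee_fin.
  - by move=> x _ n m nm; rewrite lee_fin hnd.
have lim3 := cvgeZl gf lim2.
have e : (fun n => \int[P]_x (g x * h n (Z x))%:E) =
   (fun n => \int[P]_x (g x)%:E * \int[P]_x (h n (Z x))%:E).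
  by apply/funext => n; exact: step.
rewrite e in lim1.
have := cvg_unique _ lim1 lim3; exact.
Qed.

End IndependentProducts.

Section IndependentFamily.
Context (R : realType) (dsp : measure_display) (T : measurableType dsp)
  (P : probability T R) (I : finType) (D : {set I}) (F : I -> set (set T)).
Hypothesis indF : mutually_independent P D F.
Hypothesis mF : forall i A, i \in D -> F i A -> measurable A.
Local Open Scope ereal_scope.

Definition adapted (i : I) (Z : T -> R) :=
  forall B : set R, measurable B -> F i (Z @^-1` B).

Lemma adapted_measurable i Z : i \in D -> adapted i Z -> measurable_fun [set: T] Z.
Proof.
by move=> iD aZ _ B mB; rewrite setTI; apply: mF iD _; exact: aZ.
Qed.

Lemma prod_indic (S : {set I}) (A : I -> set T) x :
  (\prod_(i in S) \1_(A i) x)%R = \1_(\bigcap_(i in [set` S]) A i) x :> R.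
Proof.
have [h|h] := pselect ((\bigcap_(i in [set` S]) A i) x).
  rewrite [RHS]indicE mem_set // big1 // => i iS.
  by rewrite indicE mem_set //; exact: h.
rewrite [RHS]indicE memNset //.
have [i iS nA] : exists2 i, i \in S & ~ A i x.
  apply: contra_notP h => h i /= iS.
  by apply: contra_notP h => nA; exists i.
by rewrite (bigD1 i) //= indicE memNset // mul0r.
Qed.

(** The events indexed by [S] make the induction work: that the remaining product factors against
    each event of [Z j] is the induction hypothesis with [j] added to [S]. *)
Lemma integral_prod_indep_events (Z : I -> T -> R) (s : seq I) :
  uniq s -> {in s, forall i, i \in D} ->
  (forall i, i \in s -> adapted i (Z i)) -> (forall i x, (0 <= Z i x)%R) ->
  (forall i, i \in s -> \int[P]_x (Z i x)%:E < +oo) ->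
  forall (S : {set I}) (A : I -> set T), S \subset D ->
  {in s, forall i, i \notin S} -> (forall i, i \in S -> F i (A i)) ->
  \int[P]_x (\prod_(i <- s) Z i x * \prod_(i in S) \1_(A i) x)%:E =
  \prod_(i <- s) \int[P]_x (Z i x)%:E * \prod_(i in S) P (A i).
Proof.
elim: s => [|j s IH] /=.
  move=> _ _ _ _ _ S A SD _ FA; rewrite big_nil mul1e -indF //.
  under eq_integral do rewrite big_nil mul1r prod_indic.
  rewrite integral_indic // ?setIT //.
  apply: fin_bigcap_measurable; first exact: finite_finset.
  by move=> i /= iS; apply: mF (FA _ iS); exact: (fintype.subsetP SD).
case/andP=> js us sD aZ Z0 Zfin S A SD sS FA.
have jD : j \in D by apply: sD; rewrite mem_head.
have jS : j \notin S by apply: sS; rewrite mem_head.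
have sD' : {in s, forall i, i \in D} by move=> i si; apply: sD; rewrite inE si orbT.
have aZ' i : i \in s -> adapted i (Z i) by move=> si; apply: aZ; rewrite inE si orbT.
have Zfin' i : i \in s -> \int[P]_x (Z i x)%:E < +oo.
  by move=> si; apply: Zfin; rewrite inE si orbT.
have sS' : {in s, forall i, i \notin S} by move=> i si; apply: sS; rewrite inE si orbT.
pose g x := (\prod_(i <- s) Z i x * \prod_(i in S) \1_(A i) x)%R.
have g0 x : (0 <= g x)%R by rewrite /g mulr_ge0 // prodr_ge0.
have IHg := IH us sD' aZ' Z0 Zfin' S A SD sS' FA.
have mg : measurable_fun [set: T] g.
  apply: measurable_funM.
    apply: measurable_prod => i si.
    by apply: (adapted_measurable (sD' _ si)); exact: aZ'.
  rewrite (_ : (fun x => _) = \1_(\bigcap_(i in [set` S]) A i) :> (T -> R)).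
    apply: measurable_indic; apply: fin_bigcap_measurable; first exact: finite_finset.
    by move=> i /= iS; apply: mF (FA _ iS); exact: (fintype.subsetP SD).
  by apply/funext => x; rewrite prod_indic.
have gfin : \int[P]_x (g x)%:E < +oo.
  rewrite IHg -ge0_fin_numE; last first.
    rewrite mule_ge0 // prode_ge0 // => i _; apply: integral_ge0 => x _; by rewrite lee_fin.
  rewrite fin_numM //; last first.
    by apply: prode_fin_num => i iS; apply: fin_num_measure; apply: mF (FA _ iS); exact: (fintype.subsetP SD).
  rewrite big_seq; apply: prode_fin_num => i si; rewrite ge0_fin_numE ?Zfin' //.
  by apply: integral_ge0 => x _; rewrite lee_fin.
have mul : \int[P]_x (g x * Z j x)%:E = \int[P]_x (g x)%:E * \int[P]_x (Z j x)%:E.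
  apply: integral_mul_indep_ge0 => //.
    by apply: (adapted_measurable jD); apply: aZ; rewrite mem_head.
  move=> B mB; pose A' i := if i == j then Z j @^-1` B else A i.
  have A'S i : i \in S -> A' i = A i.
    by move=> iS; rewrite /A'; case: eqP => // e; rewrite -e iS in jS.
  have A'j : A' j = Z j @^-1` B by rewrite /A' eqxx.
  have := IH us sD' aZ' Z0 Zfin' (j |: S)%SET A'.
  have eP : \prod_(i in S) P (A' i) = \prod_(i in S) P (A i).
    by apply: eq_bigr => i iS; rewrite A'S.
  rewrite big_setU1 // A'j eP => H.
  rewrite IHg -muleA [X in _ * X]muleC -H.
  - apply: eq_integral => x _; congr EFin.
    rewrite big_setU1 //= A'j /g.
    have -> : (\prod_(i in S) \1_(A' i) x = \prod_(i in S) \1_(A i) x :> R)%R.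
      by apply: eq_bigr => i iS; rewrite A'S.
    by ring.
  - by apply/fintype.subsetP => i; rewrite !inE => /orP[/eqP ->//|]; exact: (fintype.subsetP SD).
  - move=> i si; rewrite !inE negb_or sS' // andbT.
    by apply: contra js => /eqP <-.
  - move=> i; rewrite !inE => /orP[/eqP ->|iS]; last by rewrite A'S //; exact: FA.
    by rewrite A'j; apply: aZ => //; rewrite mem_head.
transitivity (\int[P]_x (g x * Z j x)%:E).
  by apply: eq_integral => x _; rewrite big_cons /g; congr EFin; ring.
by rewrite mul IHg big_cons muleC muleA.
Qed.

Lemma integral_prod_indep_ge0 (Z : I -> T -> R) (s : seq I) :
  uniq s -> {in s, forall i, i \in D} ->
  (forall i, i \in s -> adapted i (Z i)) -> (forall i x, (0 <= Z i x)%R) ->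
  (forall i, i \in s -> \int[P]_x (Z i x)%:E < +oo) ->
  \int[P]_x (\prod_(i <- s) Z i x)%:E = \prod_(i <- s) \int[P]_x (Z i x)%:E.
Proof.
move=> us sD aZ Z0 Zfin.
have := integral_prod_indep_events us sD aZ Z0 Zfin (S := finset.set0) (A := fun=> setT).
rewrite big_set0 mule1 => <- //.
- by apply: eq_integral => x _; rewrite big_set0 mulr1.
- by apply/fintype.subsetP => i; rewrite inE.
- by move=> i _; rewrite inE.
- by move=> i; rewrite inE.
Qed.

Definition integrable_rv (Z : T -> R) := P.-integrable [set: T] (EFin \o Z).

Lemma adapted_pos i (Z : T -> R) (f : R -> R) :
  measurable_fun [set: R] f -> adapted i Z -> adapted i (f \o Z).
Proof.
move=> mf aZ B mB; rewrite comp_preimage; apply: aZ.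
by rewrite -[X in measurable X]setTI; exact: mf.
Qed.

(** The signed factors of [s1] are split one at a time into positive and negative parts, which join
    the nonnegative factors of [s2]; being functions of the original factor, both parts stay
    adapted. *)
Lemma integral_prod_indep_mixed (Z W : I -> T -> R) (s1 s2 : seq I) :
  uniq (s1 ++ s2) -> {in s1 ++ s2, forall i, i \in D} ->
  (forall i, i \in s1 -> adapted i (Z i) /\ integrable_rv (Z i)) ->
  (forall i, i \in s2 -> adapted i (W i) /\ integrable_rv (W i)) ->
  (forall i x, (0 <= W i x)%R) ->
  integrable_rv (fun x => \prod_(i <- s1) Z i x * \prod_(i <- s2) W i x)%R /\
  \int[P]_x (\prod_(i <- s1) Z i x * \prod_(i <- s2) W i x)%:E =
  \prod_(i <- s1) \int[P]_x (Z i x)%:E * \prod_(i <- s2) \int[P]_x (W i x)%:E.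
Proof.
elim: s1 s2 W => [|j s1 IH] s2 W us sD hZ hW W0.
  have Wfin i : i \in s2 -> \int[P]_x (W i x)%:E < +oo.
    move=> si; have /integrableP[_] := (hW i si).2.
    by under eq_integral do rewrite /= ger0_norm //.
  have E := integral_prod_indep_ge0 us sD (fun i si => (hW i si).1) W0 Wfin.
  have m : measurable_fun [set: T] (fun x => \prod_(i <- s2) W i x)%R.
    apply: measurable_prod => i si; apply: (adapted_measurable (sD _ si)).
    by case: (hW i si).
  split; last first.
    by rewrite big_nil mul1e -E; apply: eq_integral => x _; rewrite big_nil mul1r.
  apply/integrableP; split.
    by apply/measurable_EFinP; under eq_fun do rewrite big_nil mul1r.
  have -> : \int[P]_x `|(EFin \o (fun x => \prod_(i <- [::]) Z i x * \prod_(i <- s2) W i x)%R) x| =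
     \int[P]_x (\prod_(i <- s2) W i x)%:E.
    apply: eq_integral => x _; rewrite /= big_nil mul1r ger0_norm //.
    by apply: prodr_ge0 => i _.
  rewrite E -ge0_fin_numE; last by apply: prode_ge0 => i _; apply: integral_ge0 => x _; rewrite lee_fin.
  rewrite big_seq; apply: prode_fin_num => i si; rewrite ge0_fin_numE ?Wfin //.
  by apply: integral_ge0 => x _; rewrite lee_fin.
have jD : j \in D by apply: sD; rewrite mem_head.
have [aj ij] := hZ j (mem_head _ _).
have jn : j \notin s1 ++ s2 by move: us; rewrite cat_cons cons_uniq => /andP[].
have us' : uniq (s1 ++ j :: s2).
  by rewrite -cat1s uniq_catCA cat1s.
have sD' : {in s1 ++ j :: s2, forall i, i \in D}.
  move=> i; rewrite mem_cat inE orbCA -mem_cat => h; apply: sD.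
  by rewrite cat_cons inE.
have hZ' i : i \in s1 -> adapted i (Z i) /\ integrable_rv (Z i).
  by move=> si; apply: hZ; rewrite inE si orbT.
pose W' (b : bool) i := if i == j then (if b then (Z j)^\+ else (Z j)^\-)%R else W i.
have W'j b : W' b j = (if b then (Z j)^\+ else (Z j)^\-)%R by rewrite /W' eqxx.
have W's b i : i \in s2 -> W' b i = W i.
  move=> si; rewrite /W'; case: eqP => // e; move: jn.
  by rewrite mem_cat negb_or -e si andbF.
have W'0 b i x : (0 <= W' b i x)%R.
  rewrite /W'; case: eqP => // _; case: b; [exact: funrpos_ge0|exact: funrneg_ge0].
have hW' b i : i \in j :: s2 -> adapted i (W' b i) /\ integrable_rv (W' b i).
  rewrite inE => /predU1P[->|si]; last by rewrite W's //; exact: hW.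
  rewrite W'j; split.
    case: b.
      have m : measurable_fun [set: R] (fun y : R => Num.max y 0%R) by exact: measurable_maxr.
      exact: adapted_pos m aj.
    have m : measurable_fun [set: R] (fun y : R => Num.max (- y)%R 0%R).
      by apply: measurable_maxr => //; exact: oppr_measurable.
    exact: adapted_pos m aj.
  by case: b; [exact: integrable_funrpos|exact: integrable_funrneg].
have [i1 E1] := IH _ _ us' sD' hZ' (hW' true) (W'0 true).
have [i2 E2] := IH _ _ us' sD' hZ' (hW' false) (W'0 false).
have W'prod b x : (\prod_(i <- j :: s2) W' b i x =
    (if b then (Z j)^\+ else (Z j)^\-) x * \prod_(i <- s2) W i x)%R.
  by rewrite big_cons W'j; congr (_ * _)%R; apply: eq_big_seq => i si; rewrite W's.
have W'int b : \prod_(i <- j :: s2) \int[P]_x (W' b i x)%:E =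
    \int[P]_x ((if b then (Z j)^\+ else (Z j)^\-)%R x)%:E * \prod_(i <- s2) \int[P]_x (W i x)%:E.
  by rewrite big_cons W'j; congr (_ * _); apply: eq_big_seq => i si; rewrite W's.
have ZE x : (Z j x = (Z j)^\+ x - (Z j)^\- x)%R by rewrite -[in LHS](funrposBneg (Z j)).
have fE : (fun x => \prod_(i <- j :: s1) Z i x * \prod_(i <- s2) W i x)%R =
   (fun x => \prod_(i <- s1) Z i x * \prod_(i <- j :: s2) W' true i x -
             \prod_(i <- s1) Z i x * \prod_(i <- j :: s2) W' false i x)%R.
  apply/funext => x; rewrite !W'prod big_cons.
  by rewrite ZE; ring.
have intfin (f : T -> R) : integrable_rv f -> \int[P]_x (f x)%:E \is a fin_num.
  by move=> fi; exact: integrable_fin_num.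
have s1fin : \prod_(i <- s1) \int[P]_x (Z i x)%:E \is a fin_num.
  by rewrite big_seq; apply: prode_fin_num => i si; apply: intfin; case: (hZ' i si).
have s2fin : \prod_(i <- s2) \int[P]_x (W i x)%:E \is a fin_num.
  by rewrite big_seq; apply: prode_fin_num => i si; apply: intfin; case: (hW i si).
have jpfin : \int[P]_x ((Z j)^\+%R x)%:E \is a fin_num.
  by apply: intfin; exact: integrable_funrpos.
have jnfin : \int[P]_x ((Z j)^\-%R x)%:E \is a fin_num.
  by apply: intfin; exact: integrable_funrneg.
split.
  rewrite /integrable_rv fE; exact: (integrableB measurableT i1 i2).
transitivity (\int[P]_x ((\prod_(i <- s1) Z i x * \prod_(i <- j :: s2) W' true i x)%:E -
             (\prod_(i <- s1) Z i x * \prod_(i <- j :: s2) W' false i x)%:E)).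
  by apply: eq_integral => x _; rewrite -EFinB; congr EFin; exact: (congr1 (fun f => f x) fE).
rewrite integralB_EFin // E1 E2 !W'int big_cons.
have -> : \int[P]_x (Z j x)%:E = \int[P]_x ((Z j)^\+%R x)%:E - \int[P]_x ((Z j)^\-%R x)%:E.
  rewrite -integralB_EFin //; [|exact: integrable_funrpos|exact: integrable_funrneg].
  by apply: eq_integral => x _; rewrite -EFinB; congr EFin; exact: ZE.
rewrite -(fineK s1fin) -(fineK s2fin) -(fineK jpfin) -(fineK jnfin).
by rewrite -!(EFinM, EFinB); congr EFin; ring.
Qed.

Lemma integral_prod_indep (Z : I -> T -> R) (S : {set I}) :
  S \subset D -> (forall i, i \in S -> adapted i (Z i) /\ integrable_rv (Z i)) ->
  integrable_rv (fun x => \prod_(i in S) Z i x)%R /\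
  \int[P]_x (\prod_(i in S) Z i x)%:E = \prod_(i in S) \int[P]_x (Z i x)%:E.
Proof.
move=> /fintype.subsetP SD hZ.
have [|||||i1 E1] := @integral_prod_indep_mixed Z (fun _ _ => 0%R) (enum S) [::].
- by rewrite cats0 enum_uniq.
- by move=> i; rewrite cats0 mem_enum; exact: SD.
- by move=> i; rewrite mem_enum; exact: hZ.
- by [].
- by [].
have E x : (\prod_(i <- enum S) Z i x * \prod_(i <- [::]) 0 = \prod_(i in S) Z i x :> R)%R.
  by rewrite big_nil mulr1 big_enum.
split.
  by move: i1; rewrite /integrable_rv; under eq_fun do rewrite E.
rewrite -[RHS]big_enum /= -[RHS]mule1; move: E1; rewrite [X in _ = _ * X]big_nil => <-.
by apply: eq_integral => x _; rewrite E.
Qed.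

End IndependentFamily.

(** * Moment bounds *)

Section TraceMoment.
Context (R : realType) (dsp : measure_display) (T : measurableType dsp)
  (P : probability T R) (N K : nat).
Local Notation k := K.+1.
Variables (A : T -> 'M[R]_N) (Y : T -> R) (y0 : R) (q : 'I_N -> 'I_N -> R)
  (mu : nat -> R) (th : R).
Hypothesis mu_ge0 : forall m, 0 <= mu m.
Hypothesis mu0 : mu 0%N = 1.
Hypothesis q_ge0 : forall i j, 0 <= q i j.
Hypothesis q_le1 : forall i j, q i j <= 1.
Hypothesis q_row : forall i, \sum_j q i j <= k%:R.
Hypothesis q_col : forall j, \sum_i q i j <= k%:R.
Hypothesis th_gt0 : 0 < th.
Hypothesis mu_egf : forall y, 0 <= y ->
  \sum_(m < (k + k).+1) mu m * y ^+ m / m`!%:R <= expR (th * y ^+ 2).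
Hypothesis y0_ge0 : 0 <= y0.
Hypothesis Y_ge0 : forall x, 0 <= Y x.
Hypothesis moments : forall e : 'I_N * 'I_N -> nat,
  integrable_rv P (fun x => Y x * \prod_c A x c.1 c.2 ^+ e c) /\
  (\int[P]_x (Y x * \prod_c A x c.1 c.2 ^+ e c)%:E <=
   (y0 * \prod_c (mu (e c) * (if (0 < e c)%N then q c.1 c.2 else 1)))%:E)%E.

Let E (u v : {ffun 'I_k -> 'I_N}) x := Y x * \prod_c A x c.1 c.2 ^+ walk_cnt u v c.

Let trE x : Y x * \tr ((A x *m (A x)^T) ^+ k) = \sum_u \sum_v E u v x.
Proof.
rewrite mxtrace_gram_walk mulr_sumr; apply: eq_bigr => u _.
rewrite mulr_sumr; apply: eq_bigr => v _; rewrite /E; congr (_ * _).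
rewrite big_split /= (prod_cnt (fun t => (u t, v t)) (fun c => A x c.1 c.2)).
rewrite (prod_cnt (fun t => (u (cshift K t), v t)) (fun c => A x c.1 c.2)) -big_split /=.
by apply: eq_bigr => c _; rewrite -exprD.
Qed.

Lemma integrable_trace : integrable_rv P (fun x => Y x * \tr ((A x *m (A x)^T) ^+ k)).
Proof.
rewrite /integrable_rv; under eq_fun do rewrite trE.
have -> : EFin \o (fun x => \sum_u \sum_v E u v x) =
    (fun x => (\sum_u \sum_v (E u v x)%:E)%E).
  by apply/funext => x /=; rewrite -sumEFin; apply: eq_bigr => u _; rewrite -sumEFin.
apply: integrable_sum => // u _; apply: integrable_sum => // v _.
exact: (moments (walk_cnt u v)).1.
Qed.

(** [Y] is 1 for the adjacency matrix and, for the noise, the indicator of one realisation of the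
    graph, whose probability is [y0]. In [moments], [mu] measures the size of the entries and [q]
    the price of visiting a cell at all. *)
Lemma integral_trace_le :
  (\int[P]_x (Y x * \tr ((A x *m (A x)^T) ^+ k))%:E <=
   (y0 * (N%:R * (256 * th * k%:R * expR 1) ^+ k))%:E)%E.
Proof.
under eq_integral do rewrite trE -sumEFin.
rewrite integral_sum //; last first.
  move=> u; under eq_fun do rewrite -sumEFin; apply: integrable_sum => // v _.
  exact: (moments (walk_cnt u v)).1.
apply: (@le_trans _ _ (\sum_(u : {ffun 'I_k -> 'I_N}) \sum_(v : {ffun 'I_k -> 'I_N}) (y0 * (walk_weight mu u v * walk_mask q u v))%:E)%E).
  apply: lee_sum => u _; under eq_integral do rewrite -sumEFin.
  rewrite integral_sum //; last by move=> v; exact: (moments (walk_cnt u v)).1.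
  apply: lee_sum => v _; rewrite /walk_weight /cell_weight /walk_mask -big_split /=.
  exact: (moments (walk_cnt u v)).2.
under eq_bigr do rewrite sumEFin; rewrite sumEFin lee_fin.
under eq_bigr do rewrite -mulr_sumr; rewrite -mulr_sumr.
apply: ler_wpM2l => //.
have := masked_walk_sum_le_exp mu_ge0 mu0 q_ge0 q_le1 q_row q_col th_gt0 mu_egf.
by rewrite card_ord.
Qed.

Definition trace_excess (tau : R) : set T :=
  [set x | tau <= Y x * \tr ((A x *m (A x)^T) ^+ k)].

Lemma measurable_trace_excess tau : measurable (trace_excess tau).
Proof.
have /integrableP[m _] := integrable_trace.
have /measurable_EFinP mf := m.
rewrite -[trace_excess _]setTI.
have -> : [set: T] `&` trace_excess tau = [set: T] `&`
    (fun x => Y x * \tr ((A x *m (A x)^T) ^+ k)) @^-1` `[tau, +oo[.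
  by congr (_ `&` _); apply/seteqP; split => x /=; rewrite in_itv /= andbT.
exact: mf.
Qed.

Lemma trace_tail (tau : R) j : k = (2 ^ j)%N -> 0 < tau ->
  (P (trace_excess tau) <=
   (y0 * (N%:R * (256 * th * k%:R * expR 1) ^+ k) / tau)%:E)%E.
Proof.
move=> kj tau0.
have tr0 x : 0 <= \tr ((A x *m (A x)^T) ^+ k).
  have [p [U e]] := gram_exp2 (A x) j; rewrite kj e.
  by have := inner_ge0 U^T; rewrite /inner trmxK.
have mB := measurable_trace_excess tau.
have m1 : measurable_fun [set: T] (fun x => \1_(trace_excess tau) x : R).
  exact: measurable_indic.
have : (\int[P]_x (tau * \1_(trace_excess tau) x)%:E <=
        \int[P]_x (Y x * \tr ((A x *m (A x)^T) ^+ k))%:E)%E.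
  apply: ge0_le_integral => //.
  - by move=> x _; rewrite lee_fin mulr_ge0 // ltW.
  - by apply/measurable_EFinP; apply: measurable_funM.
  - by case/integrableP: integrable_trace.
  - move=> x _; rewrite lee_fin indicE; have [xB|xB] := boolP (x \in _); last first.
      by rewrite mulr0 mulr_ge0.
    by rewrite mulr1; exact: set_mem xB.
move=> h; have := le_trans h integral_trace_le.
under eq_integral do rewrite EFinM.
rewrite ge0_integralZl_EFin //; [|exact/measurable_EFinP|exact: ltW].
rewrite integral_indic // setIT => {}h.
by rewrite -lee_pdivlMl // in h; rewrite mulrC EFinM.
Qed.

End TraceMoment.

(** * Exponential moments of the entries *)

Section ExpBounds.
Variable R : realType.

Lemma expR_partial_le (x : R) n : 0 <= x -> \sum_(m < n) x ^+ m / m`!%:R <= expR x.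
Proof.
move=> x0; have -> : \sum_(m < n) x ^+ m / m`!%:R = series (exp_coeff x) n.
  by rewrite /series /= big_mkord.
apply: nondecreasing_cvgn_le; last exact: is_cvg_series_exp_coeff.
by apply: nondecreasing_series => i _ _; exact: exp_coeff_ge0.
Qed.

Lemma expR_partial_sub_le (x : R) n : 0 <= x -> (1 < n)%N ->
  \sum_(m < n) (nat_of_ord m != 1%N)%:R * x ^+ m / m`!%:R <= expR x - x.
Proof.
move=> x0 n1; rewrite lerBrDr; apply: le_trans (expR_partial_le n x0).
rewrite (bigD1 (Ordinal n1)) //= mul0r mul0r add0r [leRHS](bigD1 (Ordinal n1)) //=.
rewrite expr1 divr1 [leRHS]addrC lerD2r le_eqVlt; apply/orP; left; apply/eqP.
apply: eq_bigr => m; rewrite -val_eqE /= => ->; by rewrite mul1r.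
Qed.

Lemma expR_le_inv (x : R) : x < 1 -> expR x <= (1 - x)^-1.
Proof.
move=> x1; rewrite -[x in expR x]opprK expRN lef_pV2 ?posrE ?subr_gt0 ?expR_gt0 //.
exact: expR_ge1Dx.
Qed.

Lemma expR_le_1D2x (x : R) : 0 <= x <= 2^-1 -> expR x <= 1 + 2 * x.
Proof.
move=> /andP[x0 x2]; apply: le_trans (expR_le_inv _) _; first by lra.
by rewrite -[leLHS]mul1r ler_pdivrMr; nra.
Qed.

(** Deleting the linear term makes the exponent quadratic. Up to [1/2] this is
    [1 / (1 - x) <= 1 + x + 2 x^2]; beyond, [x <= 2 x^2] is enough. *)
Lemma expR_sub_le (x : R) : 0 <= x -> expR x - x <= expR (2 * x ^+ 2).
Proof.
move=> x0; have [x1|x1] := leP x 2^-1; last first.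
  have : expR x <= expR (2 * x ^+ 2) by rewrite ler_expR; nra.
  lra.
have h := expR_ge1Dx (2 * x ^+ 2).
suff : expR x <= 1 + x + 2 * x ^+ 2 by lra.
apply: le_trans (expR_le_inv _) _; first by lra.
by rewrite -[leLHS]mul1r ler_pdivrMr; nra.
Qed.

Lemma expR_norm_sub_le (x : R) : expR `|x| - `|x| <= expR x + expR (- x) - 1.
Proof.
have [x0|x0] := leP 0 x.
  by rewrite ger0_norm //; have := expR_ge1Dx (- x); lra.
by rewrite ltr0_norm // ?opprK; have := expR_ge1Dx x; lra.
Qed.

Lemma expR_egf_unit (y : R) n : 0 <= y -> (1 < n)%N ->
  \sum_(m < n) (nat_of_ord m != 1%N)%:R * y ^+ m / m`!%:R <= expR (2 * y ^+ 2).
Proof.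
by move=> y0 n1; apply: le_trans (expR_partial_sub_le y0 n1) _; exact: expR_sub_le.
Qed.

End ExpBounds.

Section IntegrableRV.
Context (R : realType) (dsp : measure_display) (T : measurableType dsp)
  (P : probability T R).

Lemma integrable_rv_cst r : integrable_rv P (fun=> r).
Proof. exact: finite_measure_integrable_cst. Qed.

Lemma integrable_rvD f g : integrable_rv P f -> integrable_rv P g ->
  integrable_rv P (fun x => f x + g x).
Proof.
move=> hf hg; have := integrableD measurableT hf hg.
by apply: eq_integrable => // x _; rewrite /= EFinD.
Qed.

Lemma integrable_rvZ r f : integrable_rv P f -> integrable_rv P (fun x => r * f x).
Proof.
move=> hf; have := integrableZl measurableT r hf.
by apply: eq_integrable => // x _; rewrite /= EFinM.
Qed.

Lemma integrable_rv_sum (I : Type) (s : seq I) (f : I -> T -> R) :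
  (forall i, integrable_rv P (f i)) -> integrable_rv P (fun x => \sum_(i <- s) f i x).
Proof.
move=> hf; have := integrable_sum measurableT s (fun i (_ : xpredT i) => hf i).
by apply: eq_integrable => // x _; rewrite /= sumEFin.
Qed.

Lemma integral_rvD f g : integrable_rv P f -> integrable_rv P g ->
  (\int[P]_x (f x + g x)%:E = \int[P]_x (f x)%:E + \int[P]_x (g x)%:E)%E.
Proof. by move=> hf hg; rewrite -integralD_EFin. Qed.

Lemma integral_rvZ r f : integrable_rv P f ->
  (\int[P]_x (r * f x)%:E = r%:E * \int[P]_x (f x)%:E)%E.
Proof.
by move=> hf; under eq_integral do rewrite EFinM; rewrite integralZl.
Qed.

Lemma integral_rv_cst r : (\int[P]_x r%:E = r%:E)%E.
Proof.
rewrite integral_cst // [X in (_ * X)%E](_ : _ = 1%E) ?mule1 //.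
exact: probability_setT.
Qed.

Lemma integral_rv_sum (I : Type) (s : seq I) (f : I -> T -> R) :
  (forall i, integrable_rv P (f i)) ->
  (\int[P]_x (\sum_(i <- s) f i x)%:E = \sum_(i <- s) \int[P]_x (f i x)%:E)%E.
Proof.
move=> hf; under eq_integral do rewrite -sumEFin.
by rewrite integral_sum.
Qed.

End IntegrableRV.

Section SubGaussian.
Context (R : realType) (dsp : measure_display) (T : measurableType dsp)
  (P : probability T R) (X : {RV P >-> measurableTypeR R}) (s : R).
Hypothesis s_gt0 : 0 < s.
Hypothesis sgX : sub_gaussian X s.

Let mX : measurable_fun [set: T] (X : T -> R) := measurable_funPT X.

Let mexp t : measurable_fun [set: T] (fun x => expR (t * X x) : R).
Proof. by apply: measurableT_comp => //; exact: measurable_funM. Qed.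

Lemma sub_gaussian_mgf t :
  (\int[P]_x (expR (t * X x))%:E <= (expR (t ^+ 2 * s ^+ 2 / 2))%:E)%E.
Proof.
have := sgX t; rewrite /mmt_gen_fun unlock.
by under eq_integral do rewrite /= mulrC.
Qed.

Lemma integrable_mgf t : integrable_rv P (fun x => expR (t * X x)).
Proof.
apply/integrableP; split; first exact/measurable_EFinP.
under eq_integral do rewrite /= ger0_norm ?expR_ge0 //.
by apply: le_lt_trans (sub_gaussian_mgf t) _; rewrite ltry.
Qed.

Lemma integrable_le (f g : T -> R) : measurable_fun [set: T] f ->
  (forall x, `|f x| <= g x) -> integrable_rv P g -> integrable_rv P f.
Proof.
move=> mf fg ig; apply: (le_integrable measurableT _ _ ig).
  exact/measurable_EFinP.
move=> x _; rewrite lee_fin /=; apply: le_trans (fg x) _; exact: ler_norm.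
Qed.

Lemma integrable_normX m : integrable_rv P (fun x => `|X x| ^+ m).
Proof.
apply: (@integrable_le _ (fun x => m`!%:R * (expR (1 * X x) + expR (-1 * X x)))).
- by apply: measurable_funX; apply: measurableT_comp.
- move=> x; rewrite ger0_norm ?exprn_ge0 // mulrC -ler_pdivrMr ?ltr0n ?fact_gt0 //.
  apply: (@le_trans _ _ (expR `|X x|)).
    have := expR_partial_le m.+1 (normr_ge0 (X x)); rewrite big_ord_recr /=.
    by apply: le_trans; rewrite lerDr sumr_ge0 // => i _; rewrite divr_ge0 ?exprn_ge0.
  rewrite mul1r mulN1r; have [x0|x0] := leP 0 (X x).
    by rewrite ger0_norm // lerDl expR_ge0.
  by rewrite ltr0_norm // lerDr expR_ge0.
- exact: integrable_rvZ (integrable_rvD (integrable_mgf 1) (integrable_mgf (-1))).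
Qed.

Lemma integrable_powX m : integrable_rv P (fun x => X x ^+ m).
Proof.
apply: (integrable_le _ _ (integrable_normX m)); first exact: measurable_funX.
by move=> x; rewrite normrX.
Qed.

Definition abs_moment m : R := fine (\int[P]_x (`|X x| ^+ m)%:E)%E.

Lemma abs_momentE m : (\int[P]_x (`|X x| ^+ m)%:E = (abs_moment m)%:E)%E.
Proof.
by rewrite /abs_moment fineK //; apply: integrable_fin_num => //; exact: integrable_normX.
Qed.

Lemma abs_moment_ge0 m : 0 <= abs_moment m.
Proof.
rewrite -lee_fin -abs_momentE; apply: integral_ge0 => x _.
by rewrite lee_fin exprn_ge0.
Qed.

Lemma powX_le_abs_moment m : (`|\int[P]_x (X x ^+ m)%:E| <= (abs_moment m)%:E)%E.
Proof.
rewrite -abs_momentE; apply: le_trans (le_abse_integral _ _ _) _ => //.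
  by have /integrableP[] := integrable_powX m.
by rewrite le_eqVlt; apply/orP; left; apply/eqP; apply: eq_integral => x _; rewrite /= normrX.
Qed.

(** The line [1 + t m] lies below [e^(t^2 s^2 / 2)], which is flat at [t = 0], so its slope [m]
    vanishes. *)
Lemma sub_gaussian_mean0 : (\int[P]_x (X x)%:E = 0)%E.
Proof.
have iX : integrable_rv P (X : T -> R).
  by have := integrable_powX 1; rewrite /integrable_rv; under eq_fun do rewrite expr1.
have fX : (\int[P]_x (X x)%:E)%E \is a fin_num by exact: integrable_fin_num.
pose m := fine (\int[P]_x (X x)%:E)%E.
have mE : (\int[P]_x (X x)%:E)%E = m%:E by rewrite fineK.
rewrite mE; congr EFin.
have key t : 1 + t * m <= expR (t ^+ 2 * s ^+ 2 / 2).
  rewrite -lee_fin; apply: le_trans (sub_gaussian_mgf t).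
  have -> : ((1 + t * m)%:E = \int[P]_x (1 + t * X x)%:E)%E.
    rewrite integral_rvD ?integral_rv_cst ?integral_rvZ ?mE ?EFinD ?EFinM //.
    - exact: integrable_rv_cst.
    - exact: integrable_rvZ.
  apply: le_integral => //.
  - exact: integrable_rvD (integrable_rv_cst P 1) (integrable_rvZ t iX).
  - exact: integrable_mgf.
  - by move=> x _; rewrite lee_fin; exact: expR_ge1Dx.
pose v := s ^+ 2 / 2.
have v0 : 0 < v by rewrite divr_gt0 ?exprn_gt0.
have H (e : R) : e = 1 \/ e = -1 -> ~ 0 < e * m.
  (* The first bound gives [2 t^2 v <= t * (e * m) / 2]; the second keeps [t^2 v <= 1/2], where the
     exponential is at most [1 + 2 t^2 v]. *)
  move=> e1 em; pose t := Num.min (e * m / (4 * v)) (2 * (v + 1))^-1.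
  have t0 : 0 < t.
    rewrite lt_min; apply/andP; split; first by rewrite divr_gt0 // mulr_gt0.
    by rewrite invr_gt0; lra.
  have t1 : t * (4 * v) <= e * m by rewrite -ler_pdivlMr ?mulr_gt0 // ge_min lexx.
  have t2 : t * (2 * (v + 1)) <= 1.
    by rewrite -ler_pdivlMr ?mulr_gt0 ?addr_gt0 // div1r ge_min lexx orbT.
  have := key (e * t).
  have -> : (e * t) ^+ 2 * s ^+ 2 / 2 = t ^+ 2 * v.
    by rewrite /v; case: e1 => ->; ring.
  have tv : 0 <= t ^+ 2 * v <= 2^-1 by apply/andP; split; nra.
  have := expR_le_1D2x tv; nra.
apply/eqP; rewrite eq_le !leNgt; apply/andP; split; apply/negP => hm.
  by apply: (H 1) => //; [left|rewrite mul1r].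
by apply: (H (-1)) => //; [right|rewrite mulN1r oppr_gt0].
Qed.

(* By [cosh]-type symmetrisation, [e^|z| - |z| <= e^z + e^-z - 1], whose mean is
   at most [2 e^(u/2) - 1 <= e^u] with [u = y^2 s^2]. *)
Lemma abs_moment_egf y n : 0 <= y -> (1 < n)%N ->
  \sum_(m < n) (nat_of_ord m != 1%N)%:R * abs_moment m * y ^+ m / m`!%:R <=
  expR (s ^+ 2 * y ^+ 2).
Proof.
move=> y0 n1.
pose c m : R := (m != 1%N)%:R * y ^+ m / m`!%:R.
have iE m : integrable_rv P (fun x => c m * `|X x| ^+ m).
  by apply: integrable_rvZ; exact: integrable_normX.
have E : ((\sum_(m < n) (nat_of_ord m != 1%N)%:R * abs_moment m * y ^+ m / m`!%:R)%:E =
    \int[P]_x (\sum_(m < n) c m * `|X x| ^+ m)%:E)%E.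
  rewrite integral_rv_sum; last by move=> m; exact: iE.
  rewrite -sumEFin; apply: eq_bigr => m _.
  rewrite integral_rvZ; last exact: integrable_normX.
  by rewrite abs_momentE -EFinM /c; congr EFin; ring.
rewrite -lee_fin E.
have ie := integrable_rvD (integrable_mgf y) (integrable_mgf (- y)).
apply: (@le_trans _ _ (\int[P]_x (expR (y * X x) + expR (- y * X x) + -1)%:E)%E).
  apply: le_integral => //.
  - by apply: integrable_rv_sum => m; exact: iE.
  - exact: integrable_rvD ie (integrable_rv_cst P (-1)).
  - move=> x _; rewrite lee_fin mulNr; apply: le_trans (expR_norm_sub_le (y * X x)).
    apply: le_trans (expR_partial_sub_le (normr_ge0 (y * X x)) n1).
    apply: ler_sum => m _; rewrite /c normrM ger0_norm // exprMn le_eqVlt.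
    by apply/orP; left; apply/eqP; ring.
rewrite integral_rvD //; last exact: integrable_rv_cst.
rewrite integral_rvD ?integral_rv_cst; [|exact: integrable_mgf|exact: integrable_mgf].
have h1 := sub_gaussian_mgf y; have h2 := sub_gaussian_mgf (- y).
rewrite sqrrN in h2.
apply: le_trans (leeD (leeD h1 h2) (lexx _)) _; rewrite -!EFinD lee_fin.
set u := y ^+ 2 * s ^+ 2 / 2.
have -> : s ^+ 2 * y ^+ 2 = u + u by rewrite /u; lra.
rewrite expRD; have := sqr_ge0 (expR u - 1); lra.
Qed.

End SubGaussian.

Lemma prod_EFin (R : realType) (I : finType) (A : {set I}) (f : I -> R) :
  (\prod_(i in A) (f i)%:E = (\prod_(i in A) f i)%:E)%E.
Proof. by rewrite (big_morph EFin (id1 := 1%E) (op1 := *%E)) //; exact: EFinM. Qed.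

Section ModelLaws.
Context (R : realType) (dsp : measure_display) (T : measurableType dsp)
  (P : probability T R) (n d : nat).
Variables (w : 'I_n -> 'I_n -> {RV P >-> bool})
  (Theta : 'I_n -> 'I_n -> 'I_d -> 'I_d -> {RV P >-> measurableTypeR R}).

Lemma model_events_measurable a A : model_events w Theta a A -> measurable A.
Proof.
case: a => [[i j]|[[i j] [k l]]] /= [B mB <-]; rewrite setTI.
  exact: measurable_funPTI.
exact: measurable_funPTI.
Qed.

Lemma adapted_edge i j (f : bool -> R) :
  adapted (model_events w Theta) (inl (i, j)) (fun x => f (w i j x)).
Proof. by move=> B mB /=; exists (f @^-1` B) => //; rewrite setTI. Qed.

Lemma adapted_noise i j k l (f : R -> R) : measurable_fun [set: R] f ->
  adapted (model_events w Theta) (inr (i, j, (k, l))) (fun x => f (Theta i j k l x)).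
Proof.
move=> mf B mB /=; exists (f @^-1` B); last by rewrite setTI.
by rewrite -[X in measurable X]setTI; exact: mf.
Qed.

Variable p : R.
Hypothesis hp : 0 < p <= 1.
Hypothesis hw : edges_bernoulli w p.

Lemma edge_law (i j : 'I_n) (b : bool) : (i < j)%N ->
  P (w i j @^-1` [set b]) = (if b then p else 1 - p)%:E.
Proof.
move=> ij; have := hw ij (A := [set b]) I; rewrite /distribution /pushforward => ->.
have p01 : 0 <= p <= 1 by case/andP: hp => p0 ->; rewrite ltW.
rewrite bernoulli_probE // !diracE; case: b.
  by rewrite mem_set // memNset // mule1 mule0 adde0.
by rewrite memNset // mem_set // mule1 mule0 add0e.
Qed.

Lemma edge_expectation (i j : 'I_n) (f : bool -> R) : (i < j)%N ->
  integrable_rv P (fun x => f (w i j x)) /\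
  (\int[P]_x (f (w i j x))%:E = (p * f true + (1 - p) * f false)%:E)%E.
Proof.
move=> ij.
have mB b : measurable (w i j @^-1` [set b]) by exact: measurable_funPTI.
pose g b x : R := f b * \1_(w i j @^-1` [set b]) x.
have fE x : f (w i j x) = g true x + g false x.
  rewrite /g !indicE; case e : (w i j x).
    by rewrite mem_set // memNset ?mulr1 ?mulr0 ?addr0 //= e.
  by rewrite memNset ?mem_set ?mulr1 ?mulr0 ?add0r //= e.
have ig b : integrable_rv P (fun x => \1_(w i j @^-1` [set b]) x).
  exact: integrable_indic.
split.
  rewrite (_ : (fun x => _) = (fun x => g true x + g false x)); last exact/funext.
  by apply: integrable_rvD; exact: integrable_rvZ.
under eq_integral do rewrite fE.
rewrite integral_rvD; [|exact: integrable_rvZ|exact: integrable_rvZ].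
have EL b : (\int[P]_x (\1_(w i j @^-1` [set b]) x)%:E = (if b then p else 1 - p)%:E)%E.
  by rewrite integral_indic // setIT; exact: edge_law.
rewrite /g !integral_rvZ // !EL.
by rewrite -!EFinM -EFinD; congr EFin; ring.
Qed.

End ModelLaws.

(** * Tail of the centred adjacency matrix *)

Section AdjacencyTail.
Context (R : realType) (dsp : measure_display) (T : measurableType dsp)
  (P : probability T R) (n d K : nat).
Local Notation k := K.+1.
Variables (w : 'I_n -> 'I_n -> {RV P >-> bool})
  (Theta : 'I_n -> 'I_n -> 'I_d -> 'I_d -> {RV P >-> measurableTypeR R}).
Variable p : R.
Hypothesis hp : 0 < p <= 1.
Hypothesis hw : edges_bernoulli w p.
Hypothesis ind : model_independent w Theta.
Hypothesis npk : n%:R * p <= k%:R.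

Definition adj_mx (x : T) : 'M[R]_n := centered_adj p (fun i j => w i j x).

(** From order 2 on, the moment is at most [p (1 - p) + (1 - p) p^2], hence at most [p]: one factor
    [p] per visited cell, whatever the multiplicity. *)
Lemma centered_bernoulli_moment m :
  `|p * (1 - p) ^+ m + (1 - p) * (0 - p) ^+ m| <=
  (m != 1%N)%:R * (if (0 < m)%N then p else 1).
Proof.
have /andP[p0 p1] := hp; have q0 : 0 <= 1 - p by rewrite subr_ge0.
case: m => [|[|m]] /=.
- by rewrite !expr0 !mulr1 addrC subrK normr1.
- have -> : p * (1 - p) ^+ 1 + (1 - p) * (0 - p) ^+ 1 = 0 by ring.
  by rewrite normr0 mul0r.
rewrite mul1r; apply: le_trans (ler_normD _ _) _.
rewrite (normrM p ((1 - p) ^+ _)) (normrM (1 - p) ((0 - p) ^+ _)) !normrX sub0r normrN !ger0_norm ?(ltW p0) //.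
have h1 : (1 - p) ^+ m.+2 <= 1 - p.
  by rewrite exprS ler_piMr // exprn_ile1 // lerBlDr lerDl ltW.
have h2 : p ^+ m.+2 <= p by rewrite exprS ler_piMr ?(ltW p0) // exprn_ile1 // ltW.
have h3 : p ^+ m.+2 <= p ^+ 2.
  by rewrite !exprS expr0 mulr1 ler_wpM2l ?(ltW p0) // ler_piMr ?(ltW p0) // exprn_ile1 // ltW.
have a1 := ler_wpM2l (ltW p0) h1; have a2 := ler_wpM2l q0 h3; nra.
Qed.

(** If a cell outside the strict upper triangle has a positive exponent, the product vanishes.
    Otherwise it involves independent edges only, and its expectation factors. *)
Lemma adj_moments (e : 'I_n * 'I_n -> nat) :
  integrable_rv P (fun x => 1 * \prod_c adj_mx x c.1 c.2 ^+ e c) /\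
  (\int[P]_x (1 * \prod_c adj_mx x c.1 c.2 ^+ e c)%:E <=
   (1 * \prod_c ((e c != 1%N)%:R * (if (0 < e c)%N then p else 1)))%:E)%E.
Proof.
have /andP[p0 p1] := hp.
have rhs0 c : 0 <= (e c != 1%N)%:R * (if (0 < e c)%N then p else 1).
  by rewrite mulr_ge0 //; case: ifP => // _; exact: ltW.
have [/existsP[c /andP[ec nc]]|/existsPn h] :=
    boolP [exists c : 'I_n * 'I_n, (0 < e c)%N && ~~ (c.1 < c.2)%N].
  have E x : 1 * \prod_c adj_mx x c.1 c.2 ^+ e c = 0.
    rewrite (bigD1 c) //= mxE (negbTE nc) expr0n.
    by rewrite eqn0Ngt ec mul0r mulr0.
  split; first by rewrite (_ : (fun x => _) = (fun=> 0)); [exact: integrable_rv_cst|exact/funext].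
  under eq_integral do rewrite E.
  by rewrite integral_rv_cst lee_fin mul1r prodr_ge0.
have hc (c : 'I_n * 'I_n) : ~~ (c.1 < c.2)%N -> e c = 0%N.
  by move=> nc; apply/eqP; have := h c; rewrite nc andbT -leqNgt leqn0.
pose Z (a : model_index n d) x : R :=
  match a with inl c => ((w c.1 c.2 x)%:R - p) ^+ e c | inr _ => 1 end.
pose isE (a : model_index n d) : bool :=
  match a with inl c => (c.1 < c.2)%N | inr _ => false end.
pose S : {set model_index n d} := [set a | isE a]%SET.
have SE (V : comNzRingType) (F : model_index n d -> V) : \prod_(a in S) F a =
    \prod_(c : 'I_n * 'I_n | (c.1 < c.2)%N) F (inl c).
  rewrite big_sumType /= [X in _ * X]big_pred0 ?mulr1; last by move=> a; rewrite inE.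
  by apply: eq_bigl => c; rewrite inE.
have AE x : 1 * \prod_c adj_mx x c.1 c.2 ^+ e c = \prod_(a in S) Z a x.
  rewrite mul1r SE [LHS](bigID (fun c : 'I_n * 'I_n => (c.1 < c.2)%N)) /=.
  rewrite [X in _ * X]big1 ?mulr1; last by move=> c nc; rewrite hc // expr0.
  by apply: eq_bigr => c cc; rewrite mxE cc.
have SD : S \subset upper_index n d.
  by apply/fintype.subsetP => -[c|a]; rewrite !inE.
have hZ a : a \in S -> adapted (model_events w Theta) a (Z a) /\ integrable_rv P (Z a).
  case: a => [[i j]|a]; rewrite inE //= => ij; split.
    exact: (adapted_edge w Theta i j (fun b => (b%:R - p) ^+ e (i, j))).
  by have [] := edge_expectation hp hw (fun b => (b%:R - p) ^+ e (i, j)) ij.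
have [iZ EZ] := integral_prod_indep ind
  (fun a A _ => @model_events_measurable _ _ _ P _ _ w Theta a A) SD hZ.
have fE : (fun x => 1 * \prod_c adj_mx x c.1 c.2 ^+ e c) = (fun x => \prod_(a in S) Z a x).
  by apply/funext.
rewrite fE; split => //; under eq_integral do rewrite AE.
rewrite EZ.
pose z (a : model_index n d) : R :=
  match a with inl c => p * (1 - p) ^+ e c + (1 - p) * (0 - p) ^+ e c | inr _ => 1 end.
rewrite (eq_bigr (fun a => (z a)%:E)); last first.
  move=> [[i j]|a]; rewrite inE // => ij.
  by have [_] := edge_expectation hp hw (fun b => (b%:R - p) ^+ e (i, j)) ij.
rewrite prod_EFin lee_fin SE mul1r; apply: le_trans (ler_norm _) _; rewrite normr_prod.
rewrite [leRHS](bigID (fun c : 'I_n * 'I_n => (c.1 < c.2)%N)) /=.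
rewrite [X in _ <= _ * X]big1 ?mulr1; last by move=> c nc; rewrite hc // mulr1.
by apply: ler_prod => c _; rewrite normr_ge0 /=; exact: centered_bernoulli_moment.
Qed.

Let p_ge0 : 0 <= p. Proof. by case/andP: hp => /ltW. Qed.

Let p_row (i : 'I_n) : \sum_(j < n) p <= k%:R.
Proof. by rewrite sumr_const card_ord -[leLHS]mulr_natl. Qed.

Let egf2 (y : R) : 0 <= y ->
  \sum_(m < (k + k).+1) (nat_of_ord m != 1%N)%:R * y ^+ m / m`!%:R <= expR (2 * y ^+ 2) :> R.
Proof. by move=> y0; apply: expR_egf_unit; rewrite // addSn. Qed.

Definition adj_excess tau : set T := trace_excess K adj_mx (fun=> 1) tau.

Lemma measurable_adj_excess tau : measurable (adj_excess tau).
Proof.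
exact: (@measurable_trace_excess _ _ _ P n K adj_mx (fun=> 1) 1 (fun _ _ => p)
  (fun m => (m != 1%N)%:R) adj_moments).
Qed.

Lemma adj_tail tau j : k = (2 ^ j)%N -> 0 < tau ->
  (P (adj_excess tau) <= (n%:R * (512 * k%:R * expR 1) ^+ k / tau)%:E)%E.
Proof.
move=> kj tau0.
have p1 : p <= 1 by case/andP: hp.
have := @trace_tail _ _ _ P n K adj_mx (fun=> 1) 1 (fun _ _ => p) (fun m => (m != 1%N)%:R) 2
  (fun m => ler0n _ _) erefl (fun _ _ => p_ge0) (fun _ _ => p1) p_row p_row
  (ltr0n _ _) egf2 ler01 (fun=> ler01) adj_moments tau j kj tau0.
by rewrite mul1r (_ : 256 * 2 = 512) //; ring.
Qed.

End AdjacencyTail.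

(** * Tail of the noise on a fixed graph *)

Section BlockIndex.
Variables n d : nat.
Local Notation N := (\sum_(i < n) d)%N.

Definition block_row (s : 'I_N) : 'I_n := @tagnat.sig1 n (fun=> d) s.
Definition block_off (s : 'I_N) : 'I_d := @tagnat.sig2 n (fun=> d) s.
Definition block_idx (i : 'I_n) (k : 'I_d) : 'I_N := @tagnat.Rank n (fun=> d) i k.

Lemma block_idxK i k :
  block_row (block_idx i k) = i /\ block_off (block_idx i k) = k.
Proof.
have e : (fun u : {i : 'I_n & 'I_d} => (tag u, tagged u))
     (tagnat.sig (block_idx i k)) = (i, k).
  by rewrite /block_idx /tagnat.Rank tagnat.rankK.
by case: e.
Qed.

Lemma block_rowK i k : block_row (block_idx i k) = i. Proof. by case: (block_idxK i k). Qed.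
Lemma block_offK i k : block_off (block_idx i k) = k. Proof. by case: (block_idxK i k). Qed.

Lemma block_rowoffK s : block_idx (block_row s) (block_off s) = s.
Proof. exact: tagnat.sig2K. Qed.

Definition cell_idx (a : 'I_n * 'I_n * ('I_d * 'I_d)) : 'I_N * 'I_N :=
  (block_idx a.1.1 a.2.1, block_idx a.1.2 a.2.2).

Lemma cell_idx_bij : bijective cell_idx.
Proof.
exists (fun c => (block_row c.1, block_row c.2, (block_off c.1, block_off c.2))).
  by case=> [[i j] [k l]]; rewrite /cell_idx /= !block_rowK !block_offK.
by case=> s t; rewrite /cell_idx /= !block_rowoffK.
Qed.

Lemma sum_block (V : nmodType) (F : 'I_N -> V) :
  \sum_s F s = \sum_(i < n) \sum_(k < d) F (block_idx i k).
Proof.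
rewrite pair_big /= (reindex (fun a : 'I_n * 'I_d => block_idx a.1 a.2)) //.
apply: onW_bij; exists (fun s => (block_row s, block_off s)).
  by case=> i k /=; rewrite block_rowK block_offK.
by move=> s /=; rewrite block_rowoffK.
Qed.

Lemma masked_noiseE (R : realType) (om : 'I_n -> 'I_n -> bool) (Th : 'I_n -> 'I_n -> 'M[R]_d) a :
  masked_noise om Th (cell_idx a).1 (cell_idx a).2 =
  if (a.1.1 < a.1.2)%N && om a.1.1 a.1.2 then Th a.1.1 a.1.2 a.2.1 a.2.2 else 0.
Proof.
case: a => [[i j] [k l]] /=; rewrite mxE.
rewrite -/(block_row (block_idx i k)) -/(block_row (block_idx j l)).
rewrite -/(block_off (block_idx i k)) -/(block_off (block_idx j l)).
rewrite !block_rowK !block_offK.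
by case: (i < j)%N => /=; [case: (om i j) => //; rewrite mxE|rewrite mxE].
Qed.

End BlockIndex.

Section NoiseTail.
Context (R : realType) (dsp : measure_display) (T : measurableType dsp)
  (P : probability T R) (n d K : nat).
Local Notation k := K.+1.
Local Notation N := (\sum_(i < n) d)%N.
Variables (w : 'I_n -> 'I_n -> {RV P >-> bool})
  (Theta : 'I_n -> 'I_n -> 'I_d -> 'I_d -> {RV P >-> measurableTypeR R}).
Variables (p sigma : R) (Mm : nat -> R).
Hypothesis hp : 0 < p <= 1.
Hypothesis hw : edges_bernoulli w p.
Hypothesis hs : 0 < sigma.
Hypothesis hsg : noise_sub_gaussian Theta sigma.
Hypothesis ind : model_independent w Theta.
Hypothesis hM : forall (i j : 'I_n) k l m, (i < j)%N -> abs_moment (Theta i j k l) m = Mm m.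
Hypothesis Mm_ge0 : forall m, 0 <= Mm m.
Hypothesis Mm0 : Mm 0%N = 1.
Variable om : {ffun 'I_n * 'I_n -> bool}.

Definition noise_part (x : T) : 'M[R]_N :=
  masked_noise (fun i j => om (i, j)) (noise_mx Theta x).

(** Requiring [om] to be false outside the strict upper triangle makes exactly one [om] correspond
    to each graph, so that the [mask_prob] sum to 1. *)
Definition mask_indicator (x : T) : R :=
  \prod_(c : 'I_n * 'I_n)
    (if (c.1 < c.2)%N then (w c.1 c.2 x == om c)%:R else (~~ om c)%:R).

Definition mask_prob : R :=
  \prod_(c : 'I_n * 'I_n)
    (if (c.1 < c.2)%N then (if om c then p else 1 - p) else (~~ om c)%:R).

Definition cell_mask (s t : 'I_N) : R :=
  ((block_row s < block_row t)%N && om (block_row s, block_row t))%:R.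

Let mu m : R := (m != 1%N)%:R * Mm m.

(** Multiplying by the indicator of the graph, instead of conditioning, keeps a single product of
    independent factors, edges and noise entries together. Absolute moments dominate the signed
    ones, and order 1 contributes 0 because the entries are centred. *)
Lemma noise_moments (e : 'I_N * 'I_N -> nat) :
  integrable_rv P (fun x => mask_indicator x * \prod_c noise_part x c.1 c.2 ^+ e c) /\
  (\int[P]_x (mask_indicator x * \prod_c noise_part x c.1 c.2 ^+ e c)%:E <=
   (mask_prob * \prod_c (mu (e c) * (if (0 < e c)%N then cell_mask c.1 c.2 else 1)))%:E)%E.
Proof.
have /andP[p0 p1] := hp; have q0 : 0 <= 1 - p by rewrite subr_ge0.
have mp0 : 0 <= mask_prob.
  by apply: prodr_ge0 => c _; case: ifP => // _; case: ifP => // _; exact: ltW.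
have re (F : 'I_N * 'I_N -> R) : \prod_c F c = \prod_a F (cell_idx a).
  exact: reindex (onW_bij _ (cell_idx_bij n d)).
pose ea a := e (cell_idx a).
pose act (a : 'I_n * 'I_n * ('I_d * 'I_d)) := (a.1.1 < a.1.2)%N && om a.1.
have npE x a : noise_part x (cell_idx a).1 (cell_idx a).2 =
    if act a then Theta a.1.1 a.1.2 a.2.1 a.2.2 x else 0.
  rewrite /noise_part masked_noiseE /act; case: a => [[i j] [s t]] /=.
  by case: ifP => // _; rewrite mxE.
have cmE a : cell_mask (cell_idx a).1 (cell_idx a).2 = (act a)%:R.
  by rewrite /cell_mask /cell_idx /= !block_rowK /act -surjective_pairing.
have mu0 m : 0 <= mu m by rewrite mulr_ge0.
have rhs0 a : 0 <= mu (ea a) * (if (0 < ea a)%N then (act a)%:R else 1).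
  by rewrite mulr_ge0 //; case: ifP.
rewrite re; under [X in (_ <= (_ * X)%:E)%E]eq_bigr do rewrite cmE -/(ea _).
have [/existsP[a /andP[ea0 na]]|/existsPn h] :=
    boolP [exists a, (0 < ea a)%N && ~~ act a].
  have E x : mask_indicator x * \prod_c noise_part x c.1 c.2 ^+ e c = 0.
    rewrite re (bigD1 a) //= npE (negbTE na) expr0n.
    by rewrite -/(ea a) eqn0Ngt ea0 mul0r mulr0.
  split; first by rewrite (_ : (fun x => _) = (fun=> 0)); [exact: integrable_rv_cst|exact/funext].
  under eq_integral do rewrite E.
  by rewrite integral_rv_cst lee_fin mulr_ge0 // prodr_ge0.
have hc a : ~~ act a -> ea a = 0%N.
  by move=> nc; apply/eqP; have := h a; rewrite nc andbT -leqNgt leqn0.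
pose Z (a : model_index n d) x : R :=
  match a with
  | inl c => (w c.1 c.2 x == om c)%:R
  | inr (i, j, (s, t)) => Theta i j s t x ^+ ea (i, j, (s, t))
  end.
pose up (c : 'I_n * 'I_n) := (c.1 < c.2)%N.
have SE (F : model_index n d -> R) : \prod_(a in upper_index n d) F a =
    \prod_(c | up c) F (inl c) * \prod_(a : 'I_n * 'I_n * ('I_d * 'I_d) | up a.1) F (inr a).
  rewrite big_sumType /=; congr (_ * _); apply: eq_bigl => -[a b]; by rewrite inE.
pose cst : R := \prod_(c | ~~ up c) (~~ om c)%:R.
have cst0 : 0 <= cst by apply: prodr_ge0.
have AE x : mask_indicator x * \prod_c noise_part x c.1 c.2 ^+ e c =
    cst * \prod_(a in upper_index n d) Z a x.
  rewrite SE /mask_indicator (bigID up) /= mulrA; congr (_ * _).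
    rewrite mulrC; congr (_ * _).
      by apply: eq_bigr => c /negbTE; rewrite /up => ->.
    by apply: eq_bigr => c; rewrite /up => ->.
  rewrite re (bigID (fun a : 'I_n * 'I_n * ('I_d * 'I_d) => up a.1)) /= [X in _ * X]big1 ?mulr1.
    apply: eq_bigr => a ua; rewrite npE -/(ea a).
    case: ifP => [_|/negbT na]; first by case: a ua => [[i j] [s t]].
    by rewrite (hc _ na) expr0; case: a ua na => [[i j] [s t]] ua na; rewrite /Z (hc _ na) expr0.
  move=> a ua; rewrite -/(ea a) hc ?expr0 // /act.
  by move: ua; rewrite /up => /negbTE ->.
have hZ a : a \in upper_index n d ->
    adapted (model_events w Theta) a (Z a) /\ integrable_rv P (Z a).
  case: a => [[i j]|[[i j] [s t]]]; rewrite inE /= => ij; split.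
  - exact: (adapted_edge w Theta i j (fun b => (b == om (i, j))%:R)).
  - by have [] := edge_expectation hp hw (fun b => (b == om (i, j))%:R) ij.
  - apply: (adapted_noise w Theta i j s t (f := fun y => y ^+ ea (i, j, (s, t)))).
    exact: measurable_funX.
  - exact: (integrable_powX (hsg s t ij)).
have [iZ EZ] := integral_prod_indep ind
  (fun a A _ => @model_events_measurable _ _ _ P _ _ w Theta a A) (fintype.subxx _) hZ.
split.
  rewrite (_ : (fun x => _) = (fun x => cst * \prod_(a in upper_index n d) Z a x)).
    exact: integrable_rvZ.
  exact/funext.
under eq_integral do rewrite AE.
rewrite integral_rvZ // EZ.
pose z (a : model_index n d) : R :=
  match a with
  | inl c => if om c then p else 1 - p
  | inr (i, j, (s, t)) => fine (\int[P]_x (Theta i j s t x ^+ ea (i, j, (s, t)))%:E)%E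
  end.
rewrite (eq_bigr (fun a => (z a)%:E)); last first.
  move=> [[i j]|[[i j] [s t]]]; rewrite inE /= => ij.
    have [_ ->] := edge_expectation hp hw (fun b => (b == om (i, j))%:R) ij.
    by case: (om (i, j)); rewrite /= ?mulr1 ?mulr0 ?addr0 ?add0r.
  rewrite fineK //; apply: integrable_fin_num => //.
  exact: (integrable_powX (hsg s t ij)).
rewrite prod_EFin -EFinM lee_fin SE mulrA.
have -> : cst * \prod_(c | up c) z (inl c) = mask_prob.
  rewrite /mask_prob [RHS](bigID up) /= mulrC; congr (_ * _).
    by apply: eq_bigr => c; rewrite /up => ->.
  by apply: eq_bigr => c /negbTE; rewrite /up => ->.
apply: ler_wpM2l => //.
apply: le_trans (ler_norm _) _; rewrite normr_prod.
rewrite [leRHS](bigID (fun a : 'I_n * 'I_n * ('I_d * 'I_d) => up a.1)) /=.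
rewrite [X in _ <= _ * X]big1 ?mulr1; last first.
  move=> a ua; rewrite hc; first by rewrite /mu Mm0 !mulr1.
  by rewrite /act; move: ua; rewrite /up => /negbTE ->.
apply: ler_prod => -[[i j] [s t]] ij; rewrite normr_ge0 /=.
have XI := integrable_powX (hsg s t ij).
have h1 : `|fine (\int[P]_x (Theta i j s t x ^+ ea (i, j, (s, t)))%:E)%E| <= Mm (ea (i, j, (s, t))).
  rewrite -(hM s t _ ij) -lee_fin; apply: le_trans (powX_le_abs_moment (hsg s t ij) _).
  rewrite le_eqVlt; apply/orP; left; apply/eqP.
  by rewrite -[in RHS](fineK (integrable_fin_num measurableT (XI _))).
have -> : (if (0 < ea (i, j, (s, t)))%N then (act (i, j, (s, t)))%:R else 1) = 1 :> R.
  case: posnP => // e0; have := h (i, j, (s, t)); rewrite e0 /= negbK => ->.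
  by [].
rewrite mulr1 /mu; have [e1|_] := eqVneq (ea (i, j, (s, t))) 1%N; last by rewrite mul1r.
rewrite mul0r e1; under eq_integral do rewrite expr1.
by rewrite (sub_gaussian_mean0 hs (hsg s t ij)) normr0.
Qed.

End NoiseTail.

(** * Concentration of the observation matrix *)

Section NoiseTailBound.
Context (R : realType) (dsp : measure_display) (T : measurableType dsp)
  (P : probability T R) (n d K : nat).
Local Notation k := K.+1.
Local Notation N := (\sum_(i < n) d)%N.
Variables (w : 'I_n -> 'I_n -> {RV P >-> bool})
  (Theta : 'I_n -> 'I_n -> 'I_d -> 'I_d -> {RV P >-> measurableTypeR R}).
Variables (p sigma : R) (Mm : nat -> R).
Hypothesis hp : 0 < p <= 1.
Hypothesis hw : edges_bernoulli w p.
Hypothesis hs : 0 < sigma.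
Hypothesis hsg : noise_sub_gaussian Theta sigma.
Hypothesis ind : model_independent w Theta.
Hypothesis hM : forall (i j : 'I_n) k l m, (i < j)%N -> abs_moment (Theta i j k l) m = Mm m.
Hypothesis Mm_ge0 : forall m, 0 <= Mm m.
Hypothesis Mm0 : Mm 0%N = 1.
Hypothesis Mm_egf : forall y, 0 <= y ->
  \sum_(m < (k + k).+1) (nat_of_ord m != 1%N)%:R * Mm m * y ^+ m / m`!%:R <=
  expR (sigma ^+ 2 * y ^+ 2).

(** An edge is a block with [d] cells in each row and column, so the factor [d] turns degrees into
    row and column sums of [cell_mask]. *)
Definition sparse_mask (om : {ffun 'I_n * 'I_n -> bool}) : Prop :=
  (forall i : 'I_n, d%:R * \sum_(j < n) ((i < j)%N && om (i, j))%:R <= k%:R :> R) /\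
  (forall j : 'I_n, d%:R * \sum_(i < n) ((i < j)%N && om (i, j))%:R <= k%:R :> R).

Definition noise_excess om tau : set T :=
  trace_excess K (noise_part Theta om) (mask_indicator w om) tau.

Lemma measurable_noise_excess om tau : measurable (noise_excess om tau).
Proof.
exact: (@measurable_trace_excess _ _ _ P N K (noise_part Theta om) (mask_indicator w om)
  (mask_prob p om) (cell_mask R om) (fun m => (m != 1%N)%:R * Mm m)
  (noise_moments hp hw hs hsg ind hM Mm_ge0 Mm0 om)).
Qed.

Lemma mask_prob_ge0 (om : {ffun 'I_n * 'I_n -> bool}) : 0 <= mask_prob p om.
Proof.
have /andP[p0 p1] := hp.
apply: prodr_ge0 => c _; case: ifP => // _.
by case: ifP => // _; [exact: ltW|rewrite subr_ge0].
Qed.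

Lemma sum_mask_prob : \sum_(om : {ffun 'I_n * 'I_n -> bool}) mask_prob p om = 1.
Proof.
rewrite -(bigA_distr_bigA (fun (c : 'I_n * 'I_n) (b : bool) =>
   if (c.1 < c.2)%N then (if b then p else 1 - p) else (~~ b)%:R)) /=.
rewrite big1 // => c _; rewrite big_bool /=.
by case: ifP => _; rewrite ?add0r // addrC subrK.
Qed.

Lemma noise_tail om tau j : sparse_mask om -> k = (2 ^ j)%N -> 0 < tau ->
  (P (noise_excess om tau) <=
   (mask_prob p om * (N%:R * (256 * sigma ^+ 2 * k%:R * expR 1) ^+ k) / tau)%:E)%E.
Proof.
move=> [om_row om_col] kj tau0.
have mu_ge0 m : 0 <= (m != 1%N)%:R * Mm m by rewrite mulr_ge0.
have mu0 : (0 != 1%N)%:R * Mm 0%N = 1 by rewrite Mm0 mulr1.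
have q0 (s t : 'I_N) : 0 <= cell_mask R om s t :> R by [].
have q1 (s t : 'I_N) : cell_mask R om s t <= 1 :> R by rewrite /cell_mask; case: (_ && _).
have qr (s : 'I_N) : \sum_t cell_mask R om s t <= k%:R :> R.
  apply: le_trans (om_row (block_row s)); rewrite sum_block mulr_sumr.
  apply: ler_sum => i _; under eq_bigr do rewrite /cell_mask block_rowK.
  by rewrite sumr_const card_ord -[leLHS]mulr_natl.
have qc (t : 'I_N) : \sum_s cell_mask R om s t <= k%:R :> R.
  apply: le_trans (om_col (block_row t)); rewrite sum_block mulr_sumr.
  apply: ler_sum => i _; under eq_bigr do rewrite /cell_mask block_rowK.
  by rewrite sumr_const card_ord -[leLHS]mulr_natl.
have Y0 x : 0 <= mask_indicator w om x :> R.
  by apply: prodr_ge0 => c _; case: ifP.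
exact: (@trace_tail _ _ _ P N K (noise_part Theta om) (mask_indicator w om)
  (mask_prob p om) (cell_mask R om) (fun m => (m != 1%N)%:R * Mm m) (sigma ^+ 2)
  mu_ge0 mu0 q0 q1 qr qc (exprn_gt0 2 hs) Mm_egf (mask_prob_ge0 om) Y0
  (noise_moments hp hw hs hsg ind hM Mm_ge0 Mm0 om) tau j kj tau0).
Qed.

Lemma measure_bigsetU_le (I : Type) (s : seq I) (A : I -> set T) :
  (forall i, measurable (A i)) ->
  (P (\big[setU/set0]_(i <- s) A i) <= \sum_(i <- s) P (A i))%E.
Proof.
move=> mA; elim: s => [|i s IH]; first by rewrite !big_nil measure0.
rewrite !big_cons; apply: le_trans (measureU2 _ _ _) _ => //.
  by apply: bigsetU_measurable => j _; exact: mA.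
exact: leeD2l.
Qed.

Definition any_noise_excess tau : set T :=
  \big[setU/set0]_(om : {ffun 'I_n * 'I_n -> bool})
    (if `[< sparse_mask om >] then noise_excess om tau else set0).

Lemma measurable_any_noise_excess tau : measurable (any_noise_excess tau).
Proof.
apply: bigsetU_measurable => om _; case: ifP => // _; exact: measurable_noise_excess.
Qed.

(** The bound for each graph carries the probability of that graph as a factor, so the union over
    all sparse graphs costs nothing. *)
Lemma any_noise_tail tau j : k = (2 ^ j)%N -> 0 < tau ->
  (P (any_noise_excess tau) <=
   (N%:R * (256 * sigma ^+ 2 * k%:R * expR 1) ^+ k / tau)%:E)%E.
Proof.
move=> kj tau0; set M := N%:R * _ / tau.
apply: le_trans (measure_bigsetU_le _ _) _.
  by move=> om; case: ifP => // _; exact: measurable_noise_excess.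
have -> : (M%:E = \sum_(om : {ffun 'I_n * 'I_n -> bool}) (mask_prob p om * M)%:E)%E.
  by rewrite sumEFin -mulr_suml sum_mask_prob mul1r.
have M0 : 0 <= M.
  by rewrite /M divr_ge0 ?mulr_ge0 ?exprn_ge0 ?mulr_ge0 ?expR_ge0 ?sqr_ge0 // ltW.
apply: lee_sum => om _; case: ifPn => [/asboolP g|_]; last first.
  by rewrite measure0 lee_fin mulr_ge0 // mask_prob_ge0.
by apply: le_trans (noise_tail g kj tau0) _; rewrite /M lee_fin !mulrA.
Qed.

End NoiseTailBound.

Section GoodEvent.
Context (R : realType) (dsp : measure_display) (T : measurableType dsp)
  (P : probability T R) (n d KA KB : nat).
Variables (w : 'I_n -> 'I_n -> {RV P >-> bool})
  (Theta : 'I_n -> 'I_n -> 'I_d -> 'I_d -> {RV P >-> measurableTypeR R}).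
Variables (p tA tB : R) (jA jB : nat).
Hypothesis hp : 0 < p <= 1.
Hypothesis kA : KA.+1 = (2 ^ jA)%N.
Hypothesis kB : KB.+1 = (2 ^ jB)%N.
Hypothesis tA_ge0 : 0 <= tA.
Hypothesis tB_ge0 : 0 <= tB.
Hypothesis deg_le : d%:R * (tA + Num.sqrt (p * n%:R)) ^+ 2 <= KB.+1%:R.

Lemma opbound_adj x : ~ adj_excess KA w p (tA ^+ (2 * KA.+1)) x ->
  opbound (adj_mx w p x) tA.
Proof.
move=> h; apply: (@opbound_trace _ _ _ _ jA) => //.
rewrite -kA leNgt; apply/negP => lt; apply: h.
by rewrite /adj_excess /trace_excess /= mul1r ltW.
Qed.

(** The 0-1 row is the centred row plus [p] on the positions allowed by [c]. Its squared norm is the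
    degree, and [p * sqrt n <= sqrt (p * n)] since [p <= 1]. *)
Let card_le (v : 'rV[R]_n) (u : 'I_n -> bool) (c : 'I_n -> bool) :
  (forall j, v ord0 j = if c j then (u j)%:R - p else 0) -> frob v <= tA ->
  \sum_j (c j && u j)%:R <= (tA + Num.sqrt (p * n%:R)) ^+ 2.
Proof.
have /andP[p0 p1] := hp.
move=> hv fv; pose V : 'rV[R]_n := \row_j (c j && u j)%:R.
pose U : 'rV[R]_n := \row_j (c j)%:R.
have VE : V = v + p *: U.
  apply/rowP => j; rewrite !mxE hv; case: (c j) => /=; last by rewrite mulr0 addr0.
  by rewrite mulr1 subrK.
have -> : \sum_j (c j && u j)%:R = frob V ^+ 2.
  rewrite frob_sqr innerE big_ord1; apply: eq_bigr => j _; rewrite mxE.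
  by case: (_ && _); rewrite ?mulr1 ?mulr0.
have fU : frob U <= Num.sqrt n%:R.
  rewrite ler_sqrt // innerE big_ord1.
  apply: (@le_trans _ _ (\sum_(j < n) 1)); last by rewrite sumr_const card_ord.
  by apply: ler_sum => j _; rewrite mxE; case: (c j); rewrite ?mulr1 ?mulr0.
rewrite ler_pXn2r ?nnegrE ?frob_ge0 ?addr_ge0 ?sqrtr_ge0 //.
rewrite VE; apply: le_trans (frobD _ _) _; apply: lerD => //.
rewrite frobZ ger0_norm ?(ltW p0) // sqrtrM ?(ltW p0) //.
apply: ler_pM => //; [exact: ltW|exact: frob_ge0|].
rewrite -[leLHS](sqr_sqrtr (ltW p0)) expr2 ler_piMr ?sqrtr_ge0 //.
by rewrite -sqrtr1 ler_wsqrtr.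
Qed.

Let frob_delta (m : nat) (i : 'I_m) : frob (delta_mx i ord0 : 'cV[R]_m) = 1.
Proof.
rewrite /frob innerE (bigD1 i) //= big_ord1 !mxE !eqxx mulr1 big1 ?addr0 ?sqrtr1 //.
by move=> j ji; rewrite big_ord1 mxE (negbTE ji) mul0r.
Qed.

Definition upper_mask (x : T) : {ffun 'I_n * 'I_n -> bool} :=
  [ffun c : 'I_n * 'I_n => (c.1 < c.2)%N && w c.1 c.2 x].

(* The degrees are read off from the action of the centered adjacency matrix on
   the basis vectors. *)
Lemma sparse_upper_mask x : opbound (adj_mx w p x) tA -> sparse_mask R d KB (upper_mask x).
Proof.
move=> hA; split=> i; apply: le_trans deg_le; apply: ler_wpM2l => //.
  under eq_bigr do rewrite ffunE /= andbA andbb.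
  apply: (card_le (v := row i (adj_mx w p x))).
    by move=> j; rewrite !mxE.
  have := opboundT tA_ge0 hA (delta_mx i ord0 : 'cV[R]_n).
  rewrite frob_delta mulr1 -colE -tr_row; apply: le_trans.
  by rewrite /frob inner_trmx.
under eq_bigr do rewrite ffunE /= andbA andbb.
apply: (card_le (v := (col i (adj_mx w p x))^T)).
  by move=> j; rewrite !mxE.
have := hA _ (delta_mx i ord0 : 'cV[R]_n).
rewrite frob_delta mulr1 -colE; apply: le_trans.
by rewrite /frob inner_trmx.
Qed.

Lemma opbound_noise x : opbound (adj_mx w p x) tA ->
  ~ any_noise_excess KB w Theta (tB ^+ (2 * KB.+1)) x ->
  opbound (masked_noise (fun i j => w i j x) (noise_mx Theta x)) tB.
Proof.
move=> hA h.
have -> : masked_noise (fun i j => w i j x) (noise_mx Theta x) =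
    noise_part Theta (upper_mask x) x.
  rewrite /noise_part /masked_noise /upper_block.
  congr mxblock; apply/funext => i; apply/funext => j.
  by rewrite ffunE /=; case: (i < j)%N.
apply: (@opbound_trace _ _ _ _ jB) => //.
rewrite -kB leNgt; apply/negP => lt; apply: h.
(* Of the union only the realised graph is used: it is sparse, and its indicator is 1 at [x]. *)
rewrite /any_noise_excess (bigD1 (upper_mask x)) //=; left.
rewrite (asboolT (sparse_upper_mask hA)) /noise_excess /trace_excess /=.
have -> : mask_indicator w (upper_mask x) x = 1.
  by apply: big1 => c _; rewrite ffunE; case: ifP => cc; rewrite cc ?eqxx.
by rewrite mul1r ltW.
Qed.

End GoodEvent.

Lemma exists_exp2_between (R : realType) (y : R) : 1 <= y ->
  exists K j, [/\ K.+1 = (2 ^ j)%N, y <= K.+1%:R & K.+1%:R <= 2 * y].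
Proof.
move=> y1; have y0 : 0 <= y := le_trans ler01 y1.
have /andP[my ym] := truncn_itv y0.
have m0 : (0 < Num.truncn y)%N by rewrite truncn_gt0.
have [j /andP[j1 j2]] := unstable.leq_ltn_expn (Num.truncn y).-1.
rewrite prednK // in j1 j2.
exists (2 ^ j.+1).-1, j.+1; rewrite prednK ?expn_gt0 //; split=> //.
  by apply: ltW; apply: lt_le_trans ym _; rewrite ler_nat.
by rewrite expnS natrM ler_wpM2l // (le_trans _ my) // ler_nat.
Qed.

Lemma expR1_le4 (R : realType) : expR 1 <= 4 :> R.
Proof.
have h : expR 2^-1 <= 2 :> R.
  have /expR_le_inv : (2^-1 : R) < 1 by lra.
  by rewrite (_ : 1 - 2^-1 = 2^-1 :> R) ?invrK //; lra.
rewrite (_ : expR 1 = expR (2^-1 + 2^-1) :> R); last by congr expR; lra.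
by rewrite expRD; have := expR_gt0 (2^-1 : R); nra.
Qed.

(* The factor 64 bounds [expR 3]. *)
Lemma moment_ratio_le (R : realType) (k : nat) (c M m : R) : (0 < k)%N -> 0 < c -> 0 <= M ->
  0 < m -> M * m <= expR (2 * k%:R) ->
  M * (c * k%:R * expR 1) ^+ k / Num.sqrt (64 * c * k%:R) ^+ (2 * k) <= m^-1.
Proof.
move=> k0 c0 M0 m0 h; have kR : 0 < k%:R :> R by rewrite ltr0n.
have ck : 0 < c * k%:R by rewrite mulr_gt0.
rewrite exprM sqr_sqrtr; last by rewrite -mulrA mulr_ge0 // ltW.
rewrite -mulrA -expr_div_n.
have -> : c * k%:R * expR 1 / (64 * c * k%:R) = expR 1 / 64.
  by field; rewrite !gt_eqF.
have e2 : expR 1 / 64 <= expR (- 2) :> R.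
  rewrite expRN ler_pdivrMr // [leRHS]mulrC ler_pdivlMr ?expR_gt0 //.
  rewrite -[2]/(1 + 1) expRD.
  have e0 := expR_gt0 (1 : R); have e4 := expR1_le4 R.
  have e16 : expR 1 * expR 1 <= 16 :> R by nra.
  by nra.
have : (expR 1 / 64) ^+ k <= expR (- (2 * k%:R)) :> R.
  by rewrite -mulNr expRM_natr ler_pXn2r ?nnegrE ?mulr_ge0 ?expR_ge0.
rewrite expRN => hk; rewrite -[leRHS]mul1r ler_pdivlMr //.
apply: (@le_trans _ _ (M * (expR (2 * k%:R))^-1 * m)).
  by rewrite ler_wpM2r ?(ltW m0) // ler_wpM2l.
by rewrite mulrAC ler_pdivrMr ?expR_gt0 // mul1r.
Qed.

Lemma abs_moment_eq_law (R : realType) (dsp : measure_display) (T : measurableType dsp)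
    (P : probability T R) (X Y : {RV P >-> measurableTypeR R}) m :
  (forall A, measurable A -> distribution P X A = distribution P Y A) ->
  abs_moment X m = abs_moment Y m.
Proof.
move=> h; rewrite /abs_moment; congr fine.
have E (Z : {RV P >-> measurableTypeR R}) : (\int[P]_x (`|Z x| ^+ m)%:E =
    \int[distribution P Z]_y (`|y| ^+ m)%:E)%E.
  rewrite ge0_integral_distribution //.
  by apply/measurable_EFinP; apply: measurable_funX; exact: normr_measurable.
rewrite (E X) (E Y); apply: eq_measure_integral => A mA _; exact: h.
Qed.

Lemma measure_setC_ge (R : realType) (dsp : measure_display) (T : measurableType dsp)
    (P : probability T R) (A B : set T) (a b : R) : measurable A -> measurable B ->
  (P A <= a%:E)%E -> (P B <= b%:E)%E -> ((1 - (a + b))%:E <= P (~` (A `|` B)))%E.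
Proof.
move=> mA mB hA hB; have mAB := measurableU _ _ mA mB.
rewrite probability_setC // EFinB; apply: leeB => //.
by apply: le_trans (measureU2 _ mA mB) _; rewrite EFinD; exact: leeD.
Qed.

Lemma sqrt_le_scale (R : realType) (c x y : R) : 0 <= c -> x <= c ^+ 2 * y ->
  Num.sqrt x <= c * Num.sqrt y.
Proof.
by move=> c0 xy; rewrite -[c](ger0_norm c0) -sqrtr_sqr -sqrtrM ?sqr_ge0 // ler_wsqrtr.
Qed.

Lemma exponent_le (R : realType) (l d a b k : R) : l <= a -> a <= b -> d <= b ->
  300 * 300 * b <= k -> 0 <= b -> l + d + l <= 2 * k.
Proof. by move=> *; lra. Qed.

Lemma adj_constant_gt0 (R : realType) (k : R) : 0 < k -> 0 < 64 * 512 * k.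
Proof. by move=> k0; lra. Qed.

Lemma noise_constant_gt0 (R : realType) (s k : R) : 0 < s -> 0 < k ->
  0 < 64 * (256 * s) * k.
Proof. by move=> s0 k0; have := mulr_gt0 s0 k0; lra. Qed.

(** [2 * 64 * 512 = 256 ^ 2] is the origin of the constant 256. *)
Lemma adj_constant_le (R : realType) (k a : R) : k <= 2 * a -> 64 * 512 * k <= 256 ^+ 2 * a.
Proof. by move=> ka; lra. Qed.

(** [2 * 64 * 256 * 300 ^ 2] is just below [(60 * 1000) ^ 2]. *)
Lemma noise_constant_le (R : realType) (s k a : R) : 0 <= a -> k <= 2 * (300 * 300 * a) ->
  64 * (256 * s ^+ 2) * k <= (60 * 1000 * s) ^+ 2 * a.
Proof.
move=> a0 ka; rewrite exprMn; have s2 := sqr_ge0 s.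
have := ler_wpM2l s2 ka; have := mulr_ge0 s2 a0.
by move: (s ^+ 2) => c; lra.
Qed.

(** The constant 300 only has to exceed [256 + 1]. *)
Lemma degree_constant_le (R : realType) (d a t k : R) : 0 <= d -> 0 <= a -> 0 <= t ->
  t <= 256 * Num.sqrt a -> 300 * 300 * (a * d) <= k -> d * (t + Num.sqrt a) ^+ 2 <= k.
Proof.
move=> d0 a0 t0 ta; apply: le_trans; have L0 := sqrtr_ge0 a.
have h : (t + Num.sqrt a) ^+ 2 <= (300 * Num.sqrt a) ^+ 2.
  by rewrite ler_pXn2r ?nnegrE ?ltn0Sn; lra.
apply: le_trans (ler_wpM2l d0 h) _.
by rewrite exprMn sqr_sqrtr // -[300 * 300]/(300 ^+ 2) mulrCA [d * a]mulrC.
Qed.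

Section HighProbability.
Context (R : realType) (dsp : measure_display) (T : measurableType dsp)
  (P : probability T R) (n d : nat).
Variables (w : 'I_n -> 'I_n -> {RV P >-> bool})
  (Theta : 'I_n -> 'I_n -> 'I_d -> 'I_d -> {RV P >-> measurableTypeR R}).
Variables (p sigma : R).
Hypothesis hd : (0 < d)%N.
Hypothesis hn : (1 < n)%N.
Hypothesis hp : 0 < p <= 1.
Hypothesis hw : edges_bernoulli w p.
Hypothesis hs : 0 < sigma.
Hypothesis hid : noise_identically_distributed Theta.
Hypothesis hsg : noise_sub_gaussian Theta sigma.
Hypothesis ind : model_independent w Theta.
Hypothesis hpn : d%:R <= p * n%:R.
Hypothesis hln : ln n%:R <= p * n%:R.

Lemma noise_common_moments : exists Mm : nat -> R,
  [/\ forall (i j : 'I_n) k l m, (i < j)%N -> abs_moment (Theta i j k l) m = Mm m,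
      forall m, 0 <= Mm m, Mm 0%N = 1
    & forall y N, 0 <= y -> (1 < N)%N ->
      \sum_(m < N) (nat_of_ord m != 1%N)%:R * Mm m * y ^+ m / m`!%:R <=
      expR (sigma ^+ 2 * y ^+ 2)].
Proof.
pose k0 : 'I_d := Ordinal hd.
pose i0 : 'I_n := Ordinal (ltnW hn); pose j0 : 'I_n := Ordinal hn.
have ij0 : (i0 < j0)%N by [].
exists (abs_moment (Theta i0 j0 k0 k0)); split.
- move=> i j k l m ij; apply: abs_moment_eq_law => A mA; exact: hid.
- exact: abs_moment_ge0 (hsg k0 k0 ij0).
- rewrite /abs_moment; under eq_integral do rewrite expr0.
  by rewrite integral_rv_cst.
- move=> y N y0 N1; have H := abs_moment_egf (hsg k0 k0 ij0) y0 N1; exact: H.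
Qed.

(* With [k >= p n] the walk count bounds the centered adjacency matrix by
   [sqrt (2^15 k)], and with [k >= 300^2 d p n], which exceeds [d] times the
   degrees, the masked noise by [sigma * sqrt (2^14 k)]. *)
Lemma high_probability_opbound : exists A : set T, [/\ measurable A,
  ((1 - (n%:R^-1 + n%:R^-1))%:E <= P A)%E
  & forall x, A x ->
    opbound (centered_adj p (fun i j => w i j x)) (256 * Num.sqrt (p * n%:R)) /\
    opbound (masked_noise (fun i j => w i j x) (noise_mx Theta x))
      (60 * 1000 * sigma * Num.sqrt (p * n%:R * d%:R))].
Proof.
have /andP[p0 p1] := hp.
have d1 : 1 <= d%:R :> R by rewrite ler1n.
have n0 : 0 < n%:R :> R by rewrite ltr0n ltnW.
have pn0 : 0 < p * n%:R by rewrite mulr_gt0.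
have [Mm [hM Mm_ge0 Mm0 Mm_egf]] := noise_common_moments.
have [KA [jA [kA KA_ge KA_le]]] := exists_exp2_between (le_trans d1 hpn).
have pn1 : 1 <= p * n%:R := le_trans d1 hpn.
have pnd : p * n%:R <= p * n%:R * d%:R by rewrite ler_peMr // ltW.
have pnd' : d%:R <= p * n%:R * d%:R by rewrite ler_peMl // ler0n.
have pnd1 : 1 <= 300 * 300 * (p * n%:R * d%:R) by lra.
have [KB [jB [kB KB_ge KB_le]]] := exists_exp2_between pnd1.
pose tA : R := Num.sqrt (64 * 512 * KA.+1%:R).
pose tB : R := Num.sqrt (64 * (256 * sigma ^+ 2) * KB.+1%:R).
have tA0 : 0 <= tA := sqrtr_ge0 _.
have tB0 : 0 <= tB := sqrtr_ge0 _.
have s2 : 0 < sigma ^+ 2 by rewrite exprn_gt0.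
have KA0 : 0 < KA.+1%:R :> R by rewrite ltr0n.
have KB0 : 0 < KB.+1%:R :> R by rewrite ltr0n.
have tA_gt0 : 0 < tA by rewrite sqrtr_gt0 adj_constant_gt0.
have tB_gt0 : 0 < tB by rewrite sqrtr_gt0 noise_constant_gt0.
have tA_le : tA <= 256 * Num.sqrt (p * n%:R).
  by apply: sqrt_le_scale; [exact: ler0n|exact: adj_constant_le].
have tB_le : tB <= 60 * 1000 * sigma * Num.sqrt (p * n%:R * d%:R).
  apply: sqrt_le_scale; first by rewrite !mulr_ge0 ?ler0n // ltW.
  by apply: noise_constant_le => //; rewrite mulr_ge0 // ltW.
have deg_le : d%:R * (tA + Num.sqrt (p * n%:R)) ^+ 2 <= KB.+1%:R.
  exact: degree_constant_le (ler0n _ _) (ltW pn0) tA0 tA_le KB_ge.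
have nln : n%:R = expR (ln n%:R) :> R by rewrite lnK // posrE.
have npk : n%:R * p <= KA.+1%:R by rewrite mulrC.
have PA := @adj_tail _ _ _ P n d KA w Theta p hp hw ind npk (tA ^+ (2 * KA.+1)) jA kA
  (exprn_gt0 _ tA_gt0).
have PB := @any_noise_tail _ _ _ P n d KB w Theta p sigma Mm hp hw hs hsg ind hM Mm_ge0 Mm0
  (fun y y0 => Mm_egf y (KB.+1 + KB.+1).+1 y0 isT) (tB ^+ (2 * KB.+1)) jB kB (exprn_gt0 _ tB_gt0).
have rA : n%:R * (512 * KA.+1%:R * expR 1) ^+ KA.+1 / tA ^+ (2 * KA.+1) <= n%:R^-1 :> R.
  apply: moment_ratio_le; [by []|exact: ltr0n|exact: ler0n|by []|].
  by rewrite nln -expRD ler_expR mulr_natl mulr2n lerD // (le_trans hln).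
have rB : (\sum_(i < n) d)%:R * (256 * sigma ^+ 2 * KB.+1%:R * expR 1) ^+ KB.+1 /
    tB ^+ (2 * KB.+1) <= n%:R^-1 :> R.
  apply: moment_ratio_le; [by []|by rewrite mulr_gt0 // ltr0n|exact: ler0n|by []|].
  (* The size [n d] of the matrix and the factor [n] of the failure rate must fit in [e^(2 k)]; the
     crude [d <= e^d] suffices, as the moment order is at least [d]. *)
  have dexp : d%:R <= expR d%:R :> R by rewrite (le_trans _ (expR_ge1Dx _)) // lerDr.
  rewrite sum_nat_const card_ord natrM.
  apply: (@le_trans _ _ (expR (ln n%:R) * expR d%:R * expR (ln n%:R))).
    rewrite -nln; apply: ler_wpM2r => //; exact: ler_wpM2l.
  by rewrite -!expRD ler_expR; exact: exponent_le hln pnd pnd' KB_ge (le_trans (ler0n _ _) pnd').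
have mA := @measurable_adj_excess _ _ _ P n d KA w Theta p hp hw ind (tA ^+ (2 * KA.+1)).
have mB := @measurable_any_noise_excess _ _ _ P n d KB w Theta p sigma Mm hp hw hs hsg ind hM
  Mm_ge0 Mm0 (tB ^+ (2 * KB.+1)).
exists (~` (adj_excess KA w p (tA ^+ (2 * KA.+1)) `|`
            any_noise_excess KB w Theta (tB ^+ (2 * KB.+1)))); split.
- exact: measurableC (measurableU _ _ mA mB).
- apply: measure_setC_ge => //; [apply: le_trans PA _|apply: le_trans PB _].
    by rewrite lee_fin.
  by rewrite lee_fin.
move=> x /= /not_orP[xA xB].
have oA := opbound_adj kA tA0 xA.
have oB := opbound_noise hp kB tA0 tB0 deg_le oA xB.
by split=> q Y; [apply: le_trans (oA _ Y) _|apply: le_trans (oB _ Y) _];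
  rewrite ler_wpM2r ?frob_ge0.
Qed.

End HighProbability.

(** * The probability bound *)

(** The two requirements amount to [K alpha sqrt d <= beta sqrt (p n)] and
    [M sigma alpha d <= beta sqrt (p n)], one for each summand in the bound on [b]. *)
Lemma relative_noise_le (R : realType) (alpha beta p n d sigma b K M u v : R) :
  0 < alpha -> 0 < beta -> 0 < p -> 0 < n -> 0 < d -> 0 < K -> 0 < M -> 0 <= u -> 0 <= v ->
  K ^+ 2 * (alpha ^+ 2 * d / (beta ^+ 2 * n)) <= p ->
  sigma <= M^-1 * beta * Num.sqrt (p * n) / (alpha * d) ->
  b <= u * Num.sqrt (p * n) + v * sigma * Num.sqrt (p * n * d) ->
  b * Num.sqrt d / (p * n) <= (u / K + v / M) * (beta / alpha).
Proof.
move=> a0 b0 p0 n0 d0 K0 M0 u0 v0 hp hs hb.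
have pn0 : 0 < p * n by rewrite mulr_gt0.
set L := Num.sqrt (p * n) in hs hb *; set D := Num.sqrt d.
have L0 : 0 < L by rewrite sqrtr_gt0.
have D0 : 0 < D by rewrite sqrtr_gt0.
have LL : L ^+ 2 = p * n by rewrite sqr_sqrtr // ltW.
have DD : D ^+ 2 = d by rewrite sqr_sqrtr // ltW.
have h1 : K * alpha * D <= beta * L.
  rewrite -(@ler_pXn2r _ 2) ?nnegrE ?mulr_ge0 ?(ltW K0) ?(ltW a0) ?(ltW b0) ?(ltW D0) ?(ltW L0) //.
  rewrite !exprMn LL DD -mulrA [leRHS]mulrCA.
  by move: hp; rewrite mulrA ler_pdivrMr // mulr_gt0 ?exprn_gt0.
have h2 : M * sigma * alpha * d <= beta * L.
  by move: hs; rewrite ler_pdivlMr ?mulr_gt0 // -!mulrA ler_pdivlMl // !mulrA.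
have hb' : b <= u * L + v * sigma * (L * D).
  by rewrite -sqrtrM // ltW.
have b2 : b * D <= u * (L * D) + v * sigma * (L * d).
  rewrite -DD (le_trans (ler_wpM2r (ltW D0) hb')) // le_eqVlt.
  by apply/orP; left; apply/eqP; ring.
rewrite ler_pdivrMr // -LL.
have -> : (u / K + v / M) * (beta / alpha) * L ^+ 2 =
    (u / K + v / M) * (beta * L ^+ 2) / alpha by ring.
rewrite ler_pdivlMr //.
apply: le_trans (ler_wpM2r (ltW a0) b2) _.
have -> : (u * (L * D) + v * sigma * (L * d)) * alpha =
    u / K * (L * (K * alpha * D)) + v / M * (L * (M * sigma * alpha * d)).
  by field; rewrite !gt_eqF.
have -> : (u / K + v / M) * (beta * L ^+ 2) =
    u / K * (L * (beta * L)) + v / M * (L * (beta * L)) by ring.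
by apply: lerD; rewrite ler_wpM2l ?divr_ge0 ?(ltW K0) ?(ltW M0) // ler_wpM2l // ltW.
Qed.

Lemma noise_sum_le (R : realType) (L t : R) : 1 <= L ->
  256 * L + 256 * L + 1 + (t + t) <= 513 * L + 2 * t.
Proof. by move=> L1; lra. Qed.

Section Estimator.
Context (R : realType) (n d : nat) (hn : (1 < n)%N) (hd : (0 < d)%N)
  (G : set 'M[R]_d) (Pi : 'M[R]_d -> 'M[R]_d) (alpha beta : R)
  (Gstar : blockcol R n d) (p sigma eps K M : R)
  (dsp : measure_display) (T : measurableType dsp) (P : probability T R)
  (w : 'I_n -> 'I_n -> {RV P >-> bool})
  (Theta : 'I_n -> 'I_n -> 'I_d -> 'I_d -> {RV P >-> measurableTypeR R})
  (V : T -> blockcol R n d) (Qstar : T -> 'M[R]_d)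
  (QQ : T -> set (set 'M[R]_d)) (Ghat : T -> blockcol R n d).
Let C := random_obs_mx w Theta Gstar.
Hypothesis hG : closed_subgroup_Orth G.
Hypothesis hPi : forall X, is_proj G X (Pi X).
Hypothesis a1 : 1 <= alpha.
Hypothesis hb : 0 < beta <= 1.
Hypothesis heb : error_bound_conv G Pi alpha beta.
Hypothesis hGs : in_Gn G Gstar.
Hypothesis hp : 0 < p <= 1.
Hypothesis hw : edges_bernoulli w p.
Hypothesis hs : 0 < sigma.
Hypothesis hid : noise_identically_distributed Theta.
Hypothesis hsg : noise_sub_gaussian Theta sigma.
Hypothesis ind : model_independent w Theta.
Hypothesis K1 : 1 <= K.
Hypothesis M0 : 0 < M.
Hypothesis hKM : 513 / K + 2 * (60 * 1000) / M <= 1000^-1.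
Hypothesis hsigma : sigma <= M^-1 * beta * Num.sqrt (p * n%:R) / (alpha * d%:R).
Hypothesis heps : eps <= 100^-1 * Num.sqrt beta / alpha.
Hypothesis hV : forall x, top_eigvecs (C x) (V x).
Hypothesis hQ : forall x, is_Qstar p Gstar (C x) (V x) (Qstar x).
Hypothesis hQQ : forall x, admissible_cosets G eps (Qstar x) (QQ x).
Hypothesis hGhat : forall x, entropic_spectral_output G (C x) (V x) (QQ x) (Ghat x).
Hypothesis hpn : K ^+ 2 * (alpha ^+ 2 * d%:R / (beta ^+ 2 * n%:R)) <= p.
Hypothesis hln : ln n%:R <= p * n%:R.

Lemma prob_entropic_est_err :
  prob_at_least P [set x | est_err G Gstar (Ghat x) <= Num.sqrt n%:R / (2 * alpha)]
    (1 - (n%:R^-1 + n%:R^-1)).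
Proof.
have n0 : 0 < n%:R :> R by rewrite ltr0n ltnW.
have d0 : 0 < d%:R :> R by rewrite ltr0n.
have d1 : 1 <= d%:R :> R by rewrite ler1n.
have /andP[p0 p1] := hp; have /andP[b0 b1] := hb.
have a0 : 0 < alpha := lt_le_trans ltr01 a1.
have K0 : 0 < K := lt_le_trans ltr01 K1.
have pn0 : 0 < p * n%:R by rewrite mulr_gt0.
(* The condition on [p] implies this because [alpha] and [K] are at least 1 and [beta] is at most
   1. *)
have hpd : d%:R <= p * n%:R.
  move: hpn; rewrite mulrA ler_pdivrMr; last by rewrite mulr_gt0 ?exprn_gt0.
  have aa : 1 <= alpha ^+ 2 by rewrite exprn_ege1.
  have kk : 1 <= K ^+ 2 by rewrite exprn_ege1.
  have bb : beta ^+ 2 <= 1 by rewrite exprn_ile1 // ltW.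
  have h1 : d%:R <= K ^+ 2 * (alpha ^+ 2 * d%:R).
    by rewrite mulrA ler_peMl ?(ltW d0) // mulr_ege1.
  have h2 : p * (beta ^+ 2 * n%:R) <= p * n%:R.
    by rewrite ler_wpM2l ?(ltW p0) // ler_piMl ?(ltW n0).
  by move=> h; apply: le_trans h1 (le_trans h h2).
have [A [mA PA hA]] := high_probability_opbound hd hn hp hw hs hid hsg ind hpd hln.
exists A; split=> // x Ax; have [oA oB] := hA x Ax.
have ge_a : 0 <= 256 * Num.sqrt (p * n%:R) by rewrite mulr_ge0 ?ler0n ?sqrtr_ge0.
have ge_t : 0 <= 60 * 1000 * sigma * Num.sqrt (p * n%:R * d%:R).
  by rewrite !mulr_ge0 ?sqrtr_ge0 ?ler0n // ltW.
have GO : (G `<=` @Orth R d)%classic by case: hG.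
have p01 : 0 <= p <= 1 by rewrite (ltW p0).
have oC := opbound_obs_mx GO hGs ge_a ge_t p01 oA oB.
set b := _ + _ + 1 + _ in oC.
have ge_b : 0 <= b by rewrite !addr_ge0.
apply: (entropic_output_est_err (ltnW hn) hG hPi a1 hb heb hGs p0 ge_b oC
  (dl := b * Num.sqrt d%:R / (p * n%:R)) _ _ _ (hV x) (hQ x) (hQQ x) (hGhat x)).
- by rewrite divfK // gt_eqF.
- rewrite divr_ge0 ?mulr_ge0 ?sqrtr_ge0 ?(ltW p0) ?(ltW n0) //=.
  have -> : beta / (1000 * alpha) = 1000^-1 * (beta / alpha).
    by rewrite invfM mulrCA.
  apply: le_trans (ler_wpM2r (ltW (divr_gt0 b0 a0)) hKM).
  apply: (relative_noise_le a0 b0 p0 n0 d0 K0 M0 (ler0n _ _) _ hpn hsigma).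
    by rewrite mulr_ge0 ?mulr_ge0 ?ler0n.
  have : 1 <= Num.sqrt (p * n%:R).
    by rewrite -[leLHS]sqrtr1 ler_wsqrtr // (le_trans d1).
  rewrite /b; move: (Num.sqrt (p * n%:R)) => L L1.
  rewrite -[2 * (60 * 1000) * sigma]mulrA -[2 * _ * Num.sqrt _]mulrA.
  exact: noise_sum_le.
by rewrite invfM mulrA [_ * 100^-1]mulrC.
Qed.

End Estimator.

Lemma max_condition (R : realType) (c a b p : R) : 1 <= c -> 0 <= b ->
  c * Num.max a b <= p -> c * a <= p /\ b <= p.
Proof.
move=> c1 b0 h; split; apply: le_trans h.
  by rewrite ler_wpM2l ?(le_trans ler01) // le_max lexx.
apply: (@le_trans _ _ (Num.max a b)); first by rewrite le_max lexx orbT.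
by rewrite ler_peMl // le_max b0 orbT.
Qed.

Lemma ln_nat_ge1 (R : realType) (n : nat) : (4 < n)%N -> 1 <= ln n%:R :> R.
Proof.
move=> n4; rewrite -ler_expR lnK ?posrE ?ltr0n ?(leq_trans _ n4) //.
by rewrite (le_trans (expR1_le4 R)) // ler_nat ltnW.
Qed.

(** The last inequality is the error budget: 513 is [256 + 256 + 1], the factor 2 counts the noise
    and its transpose, and [1 / 1000] is the relative perturbation tolerated by
    [est_err_maximizer]. *)
Lemma theorem_constants (R : realType) :
  [/\ 0 < (2 * 1000 * 1000) ^+ 2 :> R, 1 <= 2 * 1000 * 1000 :> R,
      0 < 300 * 1000 * 1000 :> R
    & 513 / (2 * 1000 * 1000) + 2 * (60 * 1000) / (300 * 1000 * 1000) <= 1000^-1 :> R].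
Proof. split; by [lra|]. Qed.

Theorem theorem7 (R : realType) :
  exists c0 c1 c2 c3 : R,
  [/\ 0 < c0, 0 < c1, 0 < c2 & 0 < c3] /\
  forall (n d : nat) (hn : (0 < n)%N) (hd : (0 < d)%N)
    (G : set 'M[R]_d) (Pi : 'M[R]_d -> 'M[R]_d) (alpha beta : R)
    (Gstar : blockcol R n d) (p sigma eps : R)
    (dsp : measure_display) (T : measurableType dsp) (P : probability T R)
    (w : 'I_n -> 'I_n -> {RV P >-> bool})
    (Theta : 'I_n -> 'I_n -> 'I_d -> 'I_d -> {RV P >-> measurableTypeR R})
    (V : T -> blockcol R n d) (Qstar : T -> 'M[R]_d)
    (QQ : T -> set (set 'M[R]_d)) (Ghat : T -> blockcol R n d)
    (C := random_obs_mx w Theta Gstar),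
  closed_subgroup_Orth G ->
  (forall X, is_proj G X (Pi X)) ->
  1 <= alpha -> 0 < beta <= 1 ->
  error_bound_conv G Pi alpha beta ->
  in_Gn G Gstar ->
  0 < p <= 1 ->
  edges_bernoulli w p ->
  0 < sigma ->
  noise_identically_distributed Theta ->
  noise_sub_gaussian Theta sigma ->
  model_independent w Theta ->
  sigma <= c1 * beta * Num.sqrt (p * n%:R) / (alpha * d%:R) ->
  0 <= eps <= c2 * Num.sqrt beta / alpha ->
  (forall x, top_eigvecs (C x) (V x)) ->
  (forall x, is_Qstar p Gstar (C x) (V x) (Qstar x)) ->
  (forall x, admissible_cosets G eps (Qstar x) (QQ x)) ->
  (forall x, entropic_spectral_output G (C x) (V x) (QQ x) (Ghat x)) ->
  (c0 * Num.max (alpha ^+ 2 * d%:R / (beta ^+ 2 * n%:R))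
                (ln n%:R ^+ 2 / n%:R) <= p ->
   prob_at_least P
     [set x | est_err G Gstar (Ghat x) <= Num.sqrt n%:R / (2 * alpha)]
     (1 - c3 / n%:R)) /\
  (noise_gaussian Theta sigma ->
   c0 * Num.max (alpha ^+ 2 * d%:R / (beta ^+ 2 * n%:R))
                (ln n%:R / n%:R) <= p ->
   prob_at_least P
     [set x | est_err G Gstar (Ghat x) <= Num.sqrt n%:R / (2 * alpha)]
     (1 - c3 / n%:R)).
Proof.
have [] := theorem_constants R; set K : R := 2 * 1000 * 1000.
set M : R := 300 * 1000 * 1000; move: K M => K M K2 K1 M0 hKM.
(* The value 4 makes the claim void for [n <= 4], where the empty event will do, and exceeds the 2
   of the failure probability for larger [n]. *)
exists (K ^+ 2), M^-1, 100^-1, 4; split; first by split; rewrite ?invr_gt0 ?ltr0n.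
move=> n d hn hd G Pi alpha beta Gstar p sigma eps dsp T P w Theta V Qstar QQ Ghat C.
move=> hG hPi a1 hb heb hGs hp hw hs hid hsg ind hsigma /andP[_ heps] hV hQ hQQ hGhat.
have n0 : 0 < n%:R :> R by rewrite ltr0n.
have K21 : 1 <= K ^+ 2 by rewrite exprn_ege1.
(* Either requirement on [p] yields [ln n <= p n]; the one with the square of the logarithm does so
   because [ln n >= 1] for [n > 4]. *)
suff main : K ^+ 2 * (alpha ^+ 2 * d%:R / (beta ^+ 2 * n%:R)) <= p ->
    ((4 < n)%N -> ln n%:R <= p * n%:R) ->
    prob_at_least P [set x | est_err G Gstar (Ghat x) <= Num.sqrt n%:R / (2 * alpha)]
      (1 - 4 / n%:R).
  split=> [h|_ h].
    have [h1 h2] := max_condition K21 (divr_ge0 (sqr_ge0 _) (ltW n0)) h.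
    apply: main h1 _ => n4; have l1 := ln_nat_ge1 R n4.
    move: h2; rewrite ler_pdivrMr //; apply: le_trans.
    by rewrite expr2 ler_peMl // (le_trans ler01).
  have l0 : 0 <= ln n%:R :> R by rewrite ln_ge0 // ler1n.
  have [h1 h2] := max_condition K21 (divr_ge0 l0 (ltW n0)) h.
  by apply: main h1 _ => _; move: h2; rewrite ler_pdivrMr.
move=> hpn hln; have [n4|n4] := leqP n 4.
  exists set0; split=> //; rewrite measure0 lee_fin subr_le0 ler_pdivlMr // mul1r.
  by rewrite ler_nat.
have n1 : (1 < n)%N by exact: ltn_trans n4.
have [A [mA AE PA]] := prob_entropic_est_err n1 hd hG hPi a1 hb heb hGs hp hw hs hid hsg
  ind K1 M0 hKM hsigma heps hV hQ hQQ hGhat hpn (hln n4).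
exists A; split=> //; apply: le_trans PA; rewrite lee_fin lerD2l lerN2.
have : 0 < n%:R^-1 :> R by rewrite invr_gt0.
by move: (n%:R^-1) => m; lra.
Qed.
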